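(* Let $S,T$ be weakly anticommuting operators in the Hilbert-$B$-module $E$. Then the operator $S+T$ is self-adjoint and regular on $\mathcal D(S)\cap\mathcal D(T)$. In more detail, with $\mathcal F=\mathcal F(S,T)$: (1) There is a constant $C$ such that for $x\in\mathcal D(S)\cap\mathcal D(T)$ $$C^{-1}\bigl(\langle x,x\rangle+\langle(S+T)x,(S+T)x\rangle\bigr)\le\langle x,x\rangle+\langle Sx,Sx\rangle+\langle Tx,Tx\rangle\le C\bigl(\langle x,x\rangle+\langle(S+T)x,(S+T)x\rangle\bigr).$$ (2) For $\lambda,\mu\in i\mathbb R$, $|\lambda|,|\mu|\ge\lambda_0$ large enough, we have $$(T+\mu)^{-1}(\mathcal D(S))=\mathcal F(S,T)=(S+\lambda)^{-1}(\mathcal D(T))$$ and hence $$\operatorname{ran}\bigl((T+\mu)^{-1}(S+\lambda)^{-1}\bigr)=\mathcal F(S,T)=\operatorname{ran}\bigl((S+\lambda)^{-1}(T+\mu)^{-1}\bigr).$$ (3) For $\lambda_0>0$ large enough and $\lambda,\mu\in i\mathbb R$, $|\lambda|>|\mu|\ge\lambda_0$, $\mu/\lambda>0$, the operator $$S+T+\frac{TS}{\lambda}+\mu:\mathcal F\to E$$ is bijective and its inverse $(S+T+\frac{TS}{\lambda}+\mu)^{-1}$ is a bounded adjointable operator. Moreover, for fixed $\mu$ and for all $x\in E$ $$\lim_{|\lambda|\to\infty}(S+T+\mu)\Bigl(S+T+\frac{TS}{\lambda}+\mu\Bigr)^{-1}x=x$$ in norm, and $$\lim_{|\lambda|\to\infty}\Bigl(S+T+\frac{TS}{\lambda}+\mu\Bigr)^{-1}=(S+T+\mu)^{-1}$$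 in operator norm; here the limits $|\lambda|\to\infty$ are taken over those $\lambda\in i\mathbb R$ with $|\lambda|>|\mu|$, $\mu/\lambda>0$. (4) $\mathcal F(S,T)$ is a core for $S$, for $T$, and for $S+T$.
   Context: $B$ is a $C^*$-algebra and $E$ a Hilbert-$C^*$-module over $B$ with $B$-valued inner product $\langle\cdot,\cdot\rangle$; inequalities between elements of $B$ are in the order of $B$. $\mathcal D(S)$ denotes the domain of $S$. A self-adjoint operator $S$ in $E$ is regular if $S\pm\lambda$ has dense range for one (hence all) $\lambda\in\mathbb C\setminus\mathbb R$. A core for an operator is a submodule of its domain which is dense in the graph norm. For self-adjoint regular $S,T$ in $E$ put $\mathcal F(S,T)=\{x\in\mathcal D(S)\cap\mathcal D(T): Sx\in\mathcal D(T),\ Tx\in\mathcal D(S)\}$ and $[S,T]=ST+TS$ on $\mathcal F(S,T)$. The pair $(S,T)$ is weakly anticommuting if (1) there are constants $C_0,C_1,C_2>0$ such that for all $x\in\mathcal F(S,T)$: $\langle[S,T]x,[S,T]x\rangle\le C_0\langle x,x\rangle+C_1\langle Sx,Sx\rangle+C_2\langle Tx,Tx\rangle$ in $B$; and (2) there are a core $\mathcal E\subset\mathcal D(T)$ for $T$ and $\lambda_0>0$ such that $(S+\lambda)^{-1}(\mathcal E)\subset\mathcal F(S,T)$ for all $\lambda\in i\mathbb R$, $|\lambda|\ge\lambda_0$. The value of the constant $\lambda_0$ may vary from statement to statement. *)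

(* Defs.v *)
From HB Require Import structures.
From mathcomp Require Import all_boot all_order all_algebra.
From mathcomp Require Import complex.
From mathcomp Require Import all_classical all_reals all_analysis.
Set Implicit Arguments.
Unset Strict Implicit.
Unset Printing Implicit Defensive.
Import Order.TTheory GRing.Theory Num.Theory.
Import numFieldNormedType.Exports.
Local Open Scope classical_set_scope.
Local Open Scope ring_scope.
Local Open Scope complex_scope.

(* Complex scalars are [R[i]] for a [realType] [R]; norms are therefore
   [R[i]]-valued, and [0 < z] for [z : R[i]] means that [z] is a positive
   real. *)

(* C*-algebras are not assumed unital, so the product cannot be the ring product
   of the library. *)
HB.mixin Record isCStarAlgebra (R : realType) B of CompleteNormedModule R[i] B
    := {
  cmul : B -> B -> B;
  star : B -> B;
  cmulA : forall a b c, cmul a (cmul b c) = cmul (cmul a b) c;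
  cmulDl : forall a b c, cmul (a + b) c = cmul a c + cmul b c;
  cmulDr : forall a b c, cmul a (b + c) = cmul a b + cmul a c;
  cmulZl : forall (k : R[i]) a b, cmul (k *: a) b = k *: cmul a b;
  cmulZr : forall (k : R[i]) a b, cmul a (k *: b) = k *: cmul a b;
  starD : forall a b, star (a + b) = star a + star b;
  starZ : forall (k : R[i]) a, star (k *: a) = k^* *: star a;
  starM : forall a b, star (cmul a b) = cmul (star b) (star a);
  starK : forall a, star (star a) = a;
  norm_cmul : forall a b, `|cmul a b| <= `|a| * `|b|;
  norm_cstar : forall a, `|cmul (star a) a| = `|a| ^+ 2
}.

#[short(type="cstarAlgType")]
HB.structure Definition CStarAlgebra (R : realType) :=
  {B of isCStarAlgebra R B & CompleteNormedModule R[i] B}.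

Definition cpositive (R : realType) (B : cstarAlgType R) (a : B) : Prop :=
  exists c : B, a = cmul (star c) c.

Definition cle (R : realType) (B : cstarAlgType R) (a b : B) : Prop :=
  cpositive (b - a).

Notation "a ≼ b" := (cle a b) (at level 70, no associativity) : ring_scope.

(* Hilbert modules are right modules, with inner product conjugate linear in
   the first variable. Definiteness of the inner product is contained in
   [norm_inner]. *)
HB.mixin Record isHilbertModule (R : realType) (B : cstarAlgType R) E
    of CompleteNormedModule R[i] E := {
  ract : E -> B -> E;
  inner : E -> E -> B;
  ractDl : forall x y b, ract (x + y) b = ract x b + ract y b;
  ractDr : forall x a b, ract x (a + b) = ract x a + ract x b;
  ractA : forall x a b, ract (ract x a) b = ract x (cmul a b);
  ractZl : forall (k : R[i]) x b, ract (k *: x) b = k *: ract x b;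
  ractZr : forall (k : R[i]) x b, ract x (k *: b) = k *: ract x b;
  innerDr : forall x y z, inner x (y + z) = inner x y + inner x z;
  innerZr : forall (k : R[i]) x y, inner x (k *: y) = k *: inner x y;
  inner_act : forall x y b, inner x (ract y b) = cmul (inner x y) b;
  inner_star : forall x y, star (inner x y) = inner y x;
  inner_pos : forall x, cpositive (inner x x);
  norm_inner : forall x, `|x| ^+ 2 = `|inner x x|
}.

#[short(type="hilbertModType")]
HB.structure Definition HilbertModule (R : realType) (B : cstarAlgType R) :=
  {E of isHilbertModule R B E & CompleteNormedModule R[i] E}.

Notation "⟨ x , y ⟩" := (inner x y) (at level 0, x, y at level 60,
  format "⟨ x ,  y ⟩") : ring_scope.

Section Operators.
Context {R : realType} {B : cstarAlgType R} {E : hilbertModType B}.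
Local Notation C := R[i].

Record is_submodule (A : set E) : Prop := IsSubmodule {
  submod0 : A 0;
  submodD : forall x y, A x -> A y -> A (x + y);
  submodZ : forall (k : C) x, A x -> A (k *: x);
  submod_act : forall x (b : B), A x -> A (ract x b)
}.

(* The values of [S : operator] outside [dom S] are irrelevant. *)
Record operator := Operator {
  dom : set E;
  opfun :> E -> E;
  dom_submod : is_submodule dom;
  opfunD : forall x y, dom x -> dom y -> opfun (x + y) = opfun x + opfun y;
  opfunZ : forall (k : C) x, dom x -> opfun (k *: x) = k *: opfun x;
  opfun_act : forall x (b : B), dom x -> opfun (ract x b) = ract (opfun x) b
}.

(* [adjoint_graph S y z] means that [y] is in the domain of the adjoint [S^*]
   and [S^* y = z]. *)
Definition adjoint_graph (S : operator) (y z : E) : Prop :=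
  forall x, dom S x -> ⟨S x, y⟩ = ⟨x, z⟩.

Definition selfadjoint (S : operator) : Prop :=
  dense (dom S) /\ forall y z, adjoint_graph S y z <-> dom S y /\ S y = z.

(* Only meaningful for self-adjoint [S]. *)
Definition regular (S : operator) : Prop :=
  exists k : C, [/\ complex.Im k != 0,
    dense [set S x + k *: x | x in dom S] &
    dense [set S x - k *: x | x in dom S]].

(* The norm of the [B]-valued inner product
   [(x, y) |-> <x, y> + <S x, S y>] on [dom S]. *)
Definition graph_norm (S : operator) (x : E) : C :=
  sqrtC `|⟨x, x⟩ + ⟨S x, S x⟩|.

Definition core (A : set E) (S : operator) : Prop :=
  [/\ is_submodule A, A `<=` dom S &
      forall x, dom S x -> forall e : C, 0 < e ->
        exists2 y, A y & graph_norm S (x - y) < e].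

(* The junk value [0] only occurs outside the range of [S]. *)
Definition op_inv (S : operator) (y : E) : E :=
  xget 0 [set x | dom S x /\ S x = y].

Definition op_bijective (S : operator) : Prop := set_bij (dom S) setT S.

Definition bounded_adjointable (f : E -> E) : Prop :=
  (exists M : C, forall x, `|f x| <= M * `|x|) /\
  (exists g : E -> E, forall x y, ⟨f x, y⟩ = ⟨x, g y⟩).

(* Extended-real valued, so that unbounded maps have norm [+oo]. *)
Definition op_norm (f : E -> E) : \bar R :=
  ereal_sup [set (complex.Re `|f x|)%:E | x in [set x : E | `|x| <= 1]].

Definition Fdom (S T : operator) : set E :=
  [set x | [/\ dom S x, dom T x, dom T (S x) & dom S (T x)]].

Lemma op0 (S : operator) : S 0 = 0.
Proof. by rewrite -(scale0r 0) opfunZ ?scale0r//; case: (dom_submod S). Qed.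

Lemma submodI (A A' : set E) :
  is_submodule A -> is_submodule A' -> is_submodule (A `&` A').
Proof.
move=> [A0 AD AZ Aa] [B0 BD BZ Ba]; split => [//|x y [? ?] [? ?]|k x [? ?]|x b [? ?]];
  by split; auto.
Qed.

Lemma Fdom_submod (S T : operator) : is_submodule (Fdom S T).
Proof.
have [S0 SD SZ Sa] := dom_submod S; have [T0 TD TZ Ta] := dom_submod T.
split.
- by split => //; rewrite op0.
- by move=> x y [? ? ? ?] [? ? ? ?]; split; rewrite ?opfunD//; auto.
- by move=> k x [? ? ? ?]; split; rewrite ?opfunZ//; auto.
- by move=> x b [? ? ? ?]; split; rewrite ?opfun_act//; auto.
Qed.

Program Definition op_add (S T : operator) : operator :=
  @Operator (dom S `&` dom T) (fun x => S x + T x)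
    (submodI (dom_submod S) (dom_submod T)) _ _ _.
Next Obligation.
move=> S T x y [? ?] [? ?]; rewrite /= !opfunD// -!addrA; congr (_ + _).
by rewrite addrCA.
Qed.
Next Obligation. by move=> S T k x [? ?]; rewrite /= !opfunZ// scalerDr. Qed.
Next Obligation. by move=> S T x b [? ?]; rewrite /= !opfun_act// ractDl. Qed.

Program Definition op_shift (S : operator) (k : C) : operator :=
  @Operator (dom S) (fun x => S x + k *: x) (dom_submod S) _ _ _.
Next Obligation.
move=> S k x y ? ?; rewrite /= opfunD// scalerDr -!addrA; congr (_ + _).
by rewrite addrCA.
Qed.
Next Obligation.
by move=> S k l x ?; rewrite /= opfunZ// scalerDr !scalerA mulrC.
Qed.
Next Obligation.
by move=> S k x b ?; rewrite /= opfun_act// ractDl ractZl.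
Qed.

Program Definition op_pencil (S T : operator) (l m : C) : operator :=
  @Operator (Fdom S T) (fun x => S x + T x + l^-1 *: T (S x) + m *: x)
    (Fdom_submod S T) _ _ _.
Next Obligation.
move=> S T l m x y [? ? ? ?] [? ? ? ?]; rewrite /= !opfunD// !scalerDr.
by rewrite (addrACA (S x)) (addrACA (S x + T x))
  (addrACA (S x + T x + _)).
Qed.
Next Obligation.
move=> S T l m k x [? ? ? ?]; rewrite /= !opfunZ// !scalerDr !scalerA.
by rewrite [l^-1 * k]mulrC [m * k]mulrC.
Qed.
Next Obligation.
by move=> S T l m x b [? ? ? ?]; rewrite /= !opfun_act// !ractDl !ractZl.
Qed.

Definition anticomm (S T : operator) (x : E) : E := S (T x) + T (S x).

Definition imaginary (k : C) : Prop := complex.Re k = 0.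

Record weakly_anticommuting (S T : operator) : Prop := WeaklyAnticommuting {
  wac_selfadjointl : selfadjoint S;
  wac_regularl : regular S;
  wac_selfadjointr : selfadjoint T;
  wac_regularr : regular T;
  wac_bound : exists C0 C1 C2 : R, [/\ 0 < C0, 0 < C1, 0 < C2 &
    forall x, Fdom S T x ->
      ⟨anticomm S T x, anticomm S T x⟩ ≼
        C0%:C *: ⟨x, x⟩ + C1%:C *: ⟨S x, S x⟩ + C2%:C *: ⟨T x, T x⟩];
  wac_core : exists A : set E, core A T /\ exists l0 : R, 0 < l0 /\
    forall l : C, imaginary l -> l0%:C <= `|l| ->
      op_inv (op_shift S l) @` A `<=` Fdom S T
}.

End Operators.

Arguments operator {R B} E.

Definition pencil_params (R : realType) (m : R[i]) : set R[i] :=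
  [set l | [/\ imaginary l, `|m| < `|l| & 0 < m / l]].

(* The filter of [|l| -> oo] with [l] ranging over [D]. *)
Definition norm_infty_in (R : realType) (D : set R[i]) : set_system R[i] :=
  filter_from [set: R] (fun M => [set l | D l /\ M%:C < `|l|]).

(* Not proper when [D] is bounded; see [norm_infty_in_pencil_proper]. *)
Global Instance norm_infty_in_filter (R : realType) (D : set R[i]) :
  Filter (norm_infty_in D).
Proof.
apply: filter_from_filter; first by exists 0.
move=> M N _ _; exists (Num.max M N) => // l [Dl].
by rewrite /= maxEle; case: ifPn => [MN Nl|]; [|rewrite -ltNge => NM Ml];
  split; split => //; [apply: le_lt_trans Nl|apply: lt_trans Ml]; rewrite ?lecR ?ltcR.
Qed.

Lemma norm_infty_in_pencil_proper (R : realType) (m : R[i]) :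
  imaginary m -> m != 0 -> ProperFilter (norm_infty_in (pencil_params m)).
Proof.
move=> m_im m0; apply: filter_from_proper => M _.
case: m m_im m0 => a b; rewrite /imaginary/= => -> m0.
have b0 : b != 0 by apply: contraNneq m0 => ->.
pose t : R := (1 + `|M| / `|b| + 1).
have t1 : 1 < t.
  by rewrite /t -addrA ltrDl ltr_wpDl// divr_ge0.
have t0 : 0 < t by apply: lt_trans t1.
have nE (x y : R) : `|x +i* y| = (Num.sqrt (x ^+ 2 + y ^+ 2))%:C.
  exact: (normc_def (x +i* y)).
have nb : `|0 +i* b| = `|b|%:C by rewrite nE expr0n add0r sqrtr_sqr.
have nt : `|t%:C| = t%:C.
  by rewrite nE expr0n addr0 sqrtr_sqr gtr0_norm.
have m_gt0 : 0 < `|0 +i* b| by rewrite normr_gt0.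
exists (t%:C * (0 +i* b)); split; first split.
- by rewrite /imaginary/= mulr0 mul0r subr0.
- by rewrite normrM nt ltr_pMl// ltcR.
- by rewrite invfM mulrCA mulfV// mulr1 invr_gt0 ltcR.
- rewrite normrM nt nb -rmorphM ltcR /t !mulrDl mul1r divfK ?normr_eq0//.
  by rewrite (le_lt_trans (ler_norm M))// ltr_wpDr// ltrDr normr_gt0.
Qed.

(* Main.v *)
Require Import Defs.
From mathcomp Require Import all_boot all_order all_algebra.
From mathcomp Require Import complex.
From mathcomp Require Import all_classical all_reals all_analysis.
From mathcomp Require Import ring lra.
Set Implicit Arguments.
Unset Strict Implicit.
Unset Printing Implicit Defensive.
Import Order.TTheory GRing.Theory Num.Theory.
Import numFieldNormedType.Exports.
Local Open Scope classical_set_scope.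
Local Open Scope ring_scope.
Local Open Scope complex_scope.

(* For anticommuting S and T one has
     (T + l)(S + l)/l = S + T + TS/l + l,
   so S + T + TS/l + m differs from a bijection F -> E by the bounded operator
   (l - m), which is small enough for a contraction argument when m/l > 0 and
   |m| < |l|. Expanding <x, x> for x = (S + T + TS/l + m) u, all terms with a
   sign problem can be rewritten with the anticommutator, and Young's inequality
   bounds u, Su, Tu and TSu/l by x, uniformly in l. Hence TSu/l = T e with
   e = Su/l -> 0 and T e bounded, so that TSu/l tends to 0 against every fixed
   vector. In a Hilbert module this does not mean weak convergence to 0 in the
   Banach space sense, but averages of the vectors TSu/l still tend to 0 in norm
   (Banach-Saks). So S + T + m has dense range, and closed range by (1).
   The same averaging argument, applied to J_n (T + m)^-1 x for x in D(S) with
   J_n = n (S + n)^-1, shows (T + m)^-1 D(S) = F; this is where the asymmetry of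
   condition (2) is removed.
   The order-theoretic input on the C*-algebra is that the elements c^* c form a
   closed cone on which the norm is monotone. There is no unit available, so
   positivity is expressed through the operators b |-> t b - a b on B. *)

(** For fixed [m] the contraction factor [1 - m/l] tends to [1] as [|l|] grows, so the contraction
    settles bijectivity for each [l] separately, while every bound that must survive the limit comes
    from the expansion of [<x, x>]. The obstacle throughout is the missing duality: a proper closed
    submodule of a Hilbert module may have zero orthogonal complement, and a bounded module map need
    not have an adjoint. Density of a range therefore cannot be read off from a kernel. Approximate
    preimages in [F] are built explicitly, and averaging is the device because each new term has to
    be almost orthogonal to one vector only, the sum so far. The adjoint of the inverse is likewise
    produced by solving an equation. The operator norm limit is out of reach of averages, which
    carry no rate. It rests on the size [1/|l|] of [e = Su/l], which becomes usable once [T] is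
    moved across the resolvent of [S + T]. *)

Section LinearCombinations.
Context {K : pzRingType} {V : lmodType K}.

(** Reflected syntax of module expressions: two of them agree as soon as the coefficients of each
    atom agree, which turns a module identity into scalar identities for [ring] and [field]. *)
Inductive lincomb :=
| LVar of nat | LZero | LAdd of lincomb & lincomb | LOpp of lincomb
| LScale of K & lincomb.

Fixpoint lc_eval (env : seq V) (e : lincomb) : V :=
  match e with
  | LVar i => env`_i
  | LZero => 0
  | LAdd e1 e2 => lc_eval env e1 + lc_eval env e2
  | LOpp e1 => - lc_eval env e1
  | LScale k e1 => k *: lc_eval env e1
  end.

Fixpoint lc_coef (e : lincomb) (i : nat) : K :=
  match e with
  | LVar j => if j == i then 1 else 0
  | LZero => 0
  | LAdd e1 e2 => lc_coef e1 i + lc_coef e2 i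
  | LOpp e1 => - lc_coef e1 i
  | LScale k e1 => k * lc_coef e1 i
  end.

Lemma lc_evalE (env : seq V) (e : lincomb) :
  lc_eval env e = \sum_(i < size env) lc_coef e i *: env`_i.
Proof.
elim: e => [j||e1 IH1 e2 IH2|e1 IH1|k e1 IH1] /=.
- have [ji|ij] := ltnP j (size env).
    rewrite (bigD1 (Ordinal ji))//= eqxx scale1r big1 ?addr0// => i ij.
    by rewrite ifN ?scale0r// eq_sym.
  rewrite nth_default// big1// => i _.
  by rewrite ifN ?scale0r// gtn_eqF// (leq_trans (ltn_ord i)).
- by rewrite big1// => i _; rewrite scale0r.
- by rewrite IH1 IH2 -big_split/=; apply: eq_bigr => i _; rewrite scalerDl.
- by rewrite IH1 -sumrN; apply: eq_bigr => i _; rewrite scaleNr.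
- by rewrite IH1 scaler_sumr; apply: eq_bigr => i _; rewrite scalerA.
Qed.

(** A recursive conjunction instead of a quantifier over indices, so that it computes to one
    explicit scalar goal per atom. *)
Fixpoint lc_eqs (e1 e2 : lincomb) (n : nat) : Prop :=
  if n is n'.+1 then lc_coef e1 n' = lc_coef e2 n' /\ lc_eqs e1 e2 n' else True.

Lemma lc_eq (env : seq V) (e1 e2 : lincomb) :
  lc_eqs e1 e2 (size env) -> lc_eval env e1 = lc_eval env e2.
Proof.
rewrite !lc_evalE => h; apply: eq_bigr => -[i /= ilt] _; congr (_ *: _).
elim: (size env) ilt h => //= n IH; rewrite ltnS leq_eqVlt.
by case/predU1P => [-> []//|ilt [_]]; exact: IH.
Qed.

End LinearCombinations.

Ltac lc_mem a l :=
  lazymatch l with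
  | nil => constr:(false)
  | cons a _ => constr:(true)
  | cons _ ?l' => lc_mem a l'
  end.
Ltac lc_atoms t l :=
  lazymatch t with
  | 0 => l
  | ?a + ?b => let l' := lc_atoms a l in lc_atoms b l'
  | - ?a => lc_atoms a l
  | ?k *: ?a => lc_atoms a l
  | _ => lazymatch lc_mem t l with true => l | false => constr:(cons t l) end
  end.
Ltac lc_index t l :=
  lazymatch l with
  | cons t _ => constr:(O)
  | cons _ ?l' => let n := lc_index t l' in constr:(S n)
  end.
Ltac lc_quote K t l :=
  lazymatch t with
  | 0 => constr:(@LZero K)
  | ?a + ?b => let a' := lc_quote K a l in let b' := lc_quote K b l in
               constr:(@LAdd K a' b')
  | - ?a => let a' := lc_quote K a l in constr:(@LOpp K a')
  | ?k *: ?a => let a' := lc_quote K a l in constr:(@LScale K k a')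
  | _ => let n := lc_index t l in constr:(@LVar K n)
  end.
(* Leaves the equalities of the coefficients of each atom as subgoals. *)
Ltac lmod R :=
  lazymatch goal with
  | |- @eq ?V ?a ?b =>
    let l := lc_atoms a (@nil V) in
    let l := lc_atoms b l in
    let ea := lc_quote (R[i]) a l in
    let eb := lc_quote (R[i]) b l in
    refine (@lc_eq (R[i]) _ l ea eb _);
    cbn [lc_eqs size lc_coef eq_op Nat.eqb]; rewrite /=;
    repeat split
  end.

(** * Real-valued norms and convergence of sequences *)

Section RealNorm.
Context {R : realType}.
Local Notation C := R[i].

Lemma ltr0c (k : R) : (0 < k%:C) = (0 < k).
Proof. exact: (ltcR 0). Qed.

Lemma conj_real (r : R) : Num.conj r%:C = r%:C.
Proof. by apply/conj_Creal/complex_realP; exists r. Qed.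

Lemma conj_imaginary (k : C) : imaginary k -> Num.conj k = - k.
Proof.
rewrite /imaginary; case: k => a b /= ->.
change (conjc (0 +i* b) = - (0 +i* b)).
by apply/eqP; rewrite eq_complex /= oppr0 !eqxx.
Qed.

Lemma ReZ (r : R) (z : C) : complex.Re (r%:C * z) = r * complex.Re z.
Proof. by case: z => a b /=; rewrite mul0r subr0. Qed.

Section Norm.
Context {V : normedModType C}.
Implicit Types (x y : V).

(** The norm of [V] takes values in [R[i]], whose order is only partial; its real part is accessible
    to [lra] and [nra]. *)
Definition nrm x : R := complex.Re `|x|.

Lemma nrmE x : `|x| = (nrm x)%:C.
Proof. by rewrite /nrm RRe_real// normr_real. Qed.

Lemma nrm_ge0 x : 0 <= nrm x.
Proof. by rewrite -ler0c -nrmE. Qed.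

Lemma nrm0 : nrm 0 = 0.
Proof. by rewrite /nrm normr0. Qed.

Lemma nrm_eq0 x : nrm x = 0 -> x = 0.
Proof. by move=> x0; apply/eqP; rewrite -normr_eq0 nrmE x0. Qed.

Lemma nrm_le0 x : nrm x <= 0 -> x = 0.
Proof. by move=> x0; apply: nrm_eq0; apply/eqP; rewrite eq_le x0 nrm_ge0. Qed.

Lemma nrmN x : nrm (- x) = nrm x.
Proof. by rewrite /nrm normrN. Qed.

Lemma nrmB x y : nrm (x - y) = nrm (y - x).
Proof. by rewrite -nrmN opprB. Qed.

Lemma nrm_triangle x y : nrm (x + y) <= nrm x + nrm y.
Proof. by rewrite -lecR rmorphD/= -!nrmE ler_normD. Qed.

Lemma nrm_triangleB x y : nrm (x - y) <= nrm x + nrm y.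
Proof. by rewrite -(nrmN y) nrm_triangle. Qed.

Lemma nrm_triangle3 x y z : nrm (x - z) <= nrm (x - y) + nrm (y - z).
Proof. by rewrite -[x](subrK y) -addrA addrK nrm_triangle. Qed.

End Norm.

Definition cabs (k : C) : R := complex.Re `|k|.

Lemma cabsE (k : C) : `|k| = (cabs k)%:C.
Proof. by rewrite /cabs RRe_real// normr_real. Qed.

Lemma cabs_ge0 k : 0 <= cabs k.
Proof. by rewrite -ler0c -cabsE. Qed.

Lemma cabsM k l : cabs (k * l) = cabs k * cabs l.
Proof. by rewrite /cabs normrM [`|k|]cabsE ReZ. Qed.

Lemma cabsN k : cabs (- k) = cabs k.
Proof. by rewrite /cabs normrN. Qed.

Lemma cabs_real (r : R) : cabs r%:C = `|r|.
Proof. by rewrite /cabs normc_def/= expr0n addr0 sqrtr_sqr. Qed.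

Lemma cabsV k : cabs k^-1 = (cabs k)^-1.
Proof. by rewrite /cabs normfV [`|k|]cabsE -fmorphV. Qed.

Lemma cabs_gt0 k : (0 < cabs k) = (k != 0).
Proof. by rewrite -ltr0c -cabsE normr_gt0. Qed.

Section NormScale.
Context {V : normedModType C}.

Lemma nrmZ (k : C) (x : V) : nrm (k *: x) = cabs k * nrm x.
Proof. by rewrite /nrm normrZ cabsE ReZ. Qed.

Lemma nrmZr (r : R) (x : V) : 0 <= r -> nrm (r%:C *: x) = r * nrm x.
Proof. by move=> r0; rewrite nrmZ cabs_real ger0_norm. Qed.

Lemma cvg_nrmP (u : nat -> V) (l : V) :
  (u n @[n --> \oo] --> l) <->
  (forall e : R, 0 < e -> exists N, forall n, (N <= n)%N -> nrm (u n - l) < e).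
Proof.
split=> [/cvgrPdist_lt ul e e0|h].
  have /ul [N _ hN] : 0 < e%:C by rewrite ltr0c.
  by exists N => n /hN; rewrite distrC nrmE ltcR.
apply/cvgrPdist_lt => e e0.
have eE : e = (complex.Re e)%:C by rewrite RRe_real// gtr0_real.
rewrite eE ltr0c in e0 *; have [N hN] := h _ e0.
by exists N => // n /hN; rewrite distrC nrmE ltcR.
Qed.

Lemma cvg_nrm_le (u : nat -> V) (l : V) (M : R) :
  u n @[n --> \oo] --> l -> (forall n, nrm (u n) <= M) -> nrm l <= M.
Proof.
move=> /cvg_nrmP ul uM; apply/ler_addgt0Pr => e /ul[N /(_ N (leqnn N)) uN].
have := nrm_triangleB (u N) (u N - l); rewrite opprB addrCA subrr addr0.
by have := uM N; lra.
Qed.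

Lemma cvg_nrm_squeeze (u : nat -> V) (l : V) (a : nat -> R) :
  (forall n, nrm (u n - l) <= a n) -> a n @[n --> \oo] --> (0 : R) ->
  u n @[n --> \oo] --> l.
Proof.
move=> ua /cvgrPdist_lt a0; apply/cvg_nrmP => e /a0[N _ hN].
exists N => n /hN /=; rewrite sub0r normrN => h.
by apply: le_lt_trans (ua n) _; apply: le_lt_trans h; exact: ler_norm.
Qed.

Definition cauchys (u : nat -> V) : Prop :=
  forall e : R, 0 < e -> exists N, forall n m, (N <= n)%N -> (N <= m)%N ->
    nrm (u n - u m) < e.

Lemma cvg_cauchys (u : nat -> V) (l : V) :
  u n @[n --> \oo] --> l -> cauchys u.
Proof.
move=> /cvg_nrmP ul e e0; have /ul[N hN] : 0 < e / 2 by lra.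
exists N => n m /hN un /hN um; have := nrm_triangle3 (u n) l (u m).
by rewrite [nrm (l - _)]nrmB; lra.
Qed.

End NormScale.

Lemma cauchys_le (V W1 W2 : normedModType C) (v : nat -> W1) (w : nat -> W2)
    (u : nat -> V) (c : R) : 0 <= c -> cauchys v -> cauchys w ->
  (forall n m, nrm (u n - u m) <= c * (nrm (v n - v m) + nrm (w n - w m))) ->
  cauchys u.
Proof.
move=> c0 vc wc h e e0; have c1 : 0 < c * 2 + 1 by lra.
have d0 : 0 < e / (c * 2 + 1) by exact: divr_gt0.
have [N hN] := vc _ d0; have [M hM] := wc _ d0.
exists (maxn N M) => n m; rewrite !geq_max => /andP[Nn Mn] /andP[Nm Mm].
apply: le_lt_trans (h n m) _.
have := hN _ _ Nn Nm; have := hM _ _ Mn Mm; set d := e / _ in d0 *.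
have -> : e = d * (c * 2 + 1) by rewrite divfK// gt_eqF.
by have := nrm_ge0 (v n - v m); nra.
Qed.

Lemma cauchys_cvg (V : completeNormedModType C) (u : nat -> V) :
  cauchys u -> exists l : V, u n @[n --> \oo] --> l.
Proof.
move=> uc; suff /cvg_ex[l ul] : cvg (u @ \oo) by exists l.
apply: cauchy_cvg; apply: cauchy_exP => e e0.
have eE : e = (complex.Re e)%:C by rewrite RRe_real// gtr0_real.
rewrite eE ltr0c in e0 *; have [N hN] := uc _ e0.
exists (u N); exists N => // n /= Nn.
by rewrite /ball_ -ball_normE /= nrmE ltcR hN.
Qed.

Lemma cvg_nrmB (V : normedModType C) (u : nat -> V) (l : V) :
  u n @[n --> \oo] --> l -> nrm (u n - l) @[n --> \oo] --> (0 : R).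
Proof.
move=> /cvg_nrmP ul; apply/cvgrPdist_lt => e /ul[N hN].
by exists N => // n /hN; rewrite sub0r normrN ger0_norm// nrm_ge0.
Qed.

(** Only additivity is asked, so that the lemma covers the inner product, conjugate linear in its
    first variable, along with the product of [B]. *)
Lemma cvg_biadditive (V1 V2 W : normedModType C) (f : V1 -> V2 -> W) (K : R) :
  (forall x x' y, f (x - x') y = f x y - f x' y) ->
  (forall x y y', f x (y - y') = f x y - f x y') ->
  (forall x y, nrm (f x y) <= K * (nrm x * nrm y)) ->
  forall u v a b, u n @[n --> \oo] --> a -> v n @[n --> \oo] --> b ->
  f (u n) (v n) @[n --> \oo] --> f a b.
Proof.
move=> fBl fBr fK u v a b /cvg_nrmB ua /cvg_nrmB vb.
apply: (@cvg_nrm_squeeze _ _ _ (fun n => `|K| *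
  (nrm (u n - a) * (nrm (v n - b) + nrm b) + nrm a * nrm (v n - b)))); last first.
  rewrite -[X in _ --> X](mulr0 `|K|); apply: cvgMr.
  rewrite -[X in _ --> X]add0r; apply: cvgD; last first.
    by rewrite -[X in _ --> X](mulr0 (nrm a)); apply: cvgMr.
  rewrite -[X in _ --> X](mul0r (0 + nrm b)); apply: cvgM => //.
  by apply: cvgD => //; exact: cvg_cst.
have {}fK x y : nrm (f x y) <= `|K| * (nrm x * nrm y).
  apply: le_trans (fK x y) _; rewrite ler_wpM2r ?mulr_ge0 ?nrm_ge0//.
  exact: ler_norm.
move=> n; have -> : f (u n) (v n) - f a b = f (u n - a) (v n) + f a (v n - b).
  by rewrite fBl fBr addrA subrK.
apply: le_trans (nrm_triangle _ _) _; rewrite mulrDr lerD//.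
apply: le_trans (fK _ _) _; rewrite ler_wpM2l// ler_wpM2l ?nrm_ge0//.
by rewrite -{1}[v n](subrK b) nrm_triangle.
Qed.

Lemma cvg_scaler (V : normedModType C) (a : nat -> R) (l : R) (u : nat -> V)
    (x : V) :
  a n @[n --> \oo] --> l -> u n @[n --> \oo] --> x ->
  (a n)%:C *: u n @[n --> \oo] --> l%:C *: x.
Proof.
move=> al /cvg_nrmB ux; apply: (@cvg_nrm_squeeze _ _ _ (fun n =>
    `|a n - l| * (nrm (u n - x) + nrm x) + `|l| * nrm (u n - x))) => [n|].
  have -> : (a n)%:C *: u n - l%:C *: x
      = (a n - l)%:C *: u n + l%:C *: (u n - x) by lmod R; ring.
  apply: le_trans (nrm_triangle _ _) _.
  rewrite !nrmZ !cabs_real lerD// ler_wpM2l//.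
  by rewrite -{1}[u n](subrK x) nrm_triangle.
rewrite -[X in _ --> X]addr0; apply: cvgD; last first.
  by rewrite -[X in _ --> X](mulr0 `|l|); apply: cvgMr.
rewrite -[X in _ --> X](mul0r (0 + nrm x)); apply: cvgM.
  rewrite -[X in _ --> X](normr0 R); apply: cvg_norm.
  by rewrite -[X in _ --> X](subrr l); apply: cvgB => //; exact: cvg_cst.
by apply: cvgD => //; exact: cvg_cst.
Qed.

Lemma cvg_nrm_shift (V : normedModType C) (k : nat) (u : nat -> V) (l : V) :
  u n @[n --> \oo] --> l -> u (k + n)%N @[n --> \oo] --> l.
Proof.
move=> /cvg_nrmP ul; apply/cvg_nrmP => e /ul[N hN].
by exists N => n Nn; apply: hN; exact: leq_trans Nn (leq_addl _ _).
Qed.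

Lemma cvg_nrm_unique (V : normedModType C) (u : nat -> V) (l l' : V) :
  u n @[n --> \oo] --> l -> u n @[n --> \oo] --> l' -> l = l'.
Proof. by apply: cvg_unique; exact: norm_hausdorff. Qed.

End RealNorm.

(** * Positivity in a C*-algebra without unit *)

Section CStar.
Context {R : realType} {B : cstarAlgType R}.
Local Notation C := R[i].
Implicit Types a b c x y z : B.

Lemma cmul0l b : cmul 0 b = 0.
Proof. by apply: (addrI (cmul 0 b)); rewrite -cmulDl !addr0. Qed.

Lemma cmul0r b : cmul b 0 = 0.
Proof. by apply: (addrI (cmul b 0)); rewrite -cmulDr !addr0. Qed.

Lemma cmulNl a b : cmul (- a) b = - cmul a b.
Proof. by rewrite -scaleN1r cmulZl scaleN1r. Qed.

Lemma cmulNr a b : cmul a (- b) = - cmul a b.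
Proof. by rewrite -scaleN1r cmulZr scaleN1r. Qed.

Lemma cmulBl a b c : cmul (a - b) c = cmul a c - cmul b c.
Proof. by rewrite cmulDl cmulNl. Qed.

Lemma cmulBr a b c : cmul a (b - c) = cmul a b - cmul a c.
Proof. by rewrite cmulDr cmulNr. Qed.

Lemma star0 : star (0 : B) = 0.
Proof. by apply: (addrI (star 0)); rewrite -starD !addr0. Qed.

Lemma starN a : star (- a) = - star a.
Proof. by apply: (addrI (star a)); rewrite -starD !subrr star0. Qed.

Lemma starB a b : star (a - b) = star a - star b.
Proof. by rewrite starD starN. Qed.

Lemma starZr (r : R) a : star (r%:C *: a) = r%:C *: star a.
Proof. by rewrite starZ conj_real. Qed.

Lemma nrm_cmul a b : nrm (cmul a b) <= nrm a * nrm b.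
Proof. by rewrite -lecR rmorphM/= -!nrmE norm_cmul. Qed.

Lemma nrm_cstar a : nrm (cmul (star a) a) = nrm a ^+ 2.
Proof.
by apply: complexI; rewrite rmorphXn/= -!nrmE norm_cstar.
Qed.

Lemma nrm_star a : nrm (star a) = nrm a.
Proof.
suff h b : nrm b <= nrm (star b).
  by apply/eqP; rewrite eq_le h andbT -{2}[a]starK h.
have := nrm_cmul (star b) b; rewrite nrm_cstar.
by have := nrm_ge0 b; have := nrm_ge0 (star b); nra.
Qed.

(** Testing on [b = star a] recovers the norm by the C*-identity. Left multiplication is thus
    isometric, and estimates of operators on [B] can replace estimates in a unitization. *)
Lemma nrm_opl a (M : R) : 0 <= M ->
  (forall b, nrm (cmul a b) <= M * nrm b) -> nrm a <= M.
Proof.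
move=> M0 h; have := h (star a); rewrite -{1}[a]starK nrm_cstar nrm_star.
by have := nrm_ge0 a; nra.
Qed.

Lemma cvg_cmul (u v : nat -> B) a b :
  u n @[n --> \oo] --> a -> v n @[n --> \oo] --> b ->
  cmul (u n) (v n) @[n --> \oo] --> cmul a b.
Proof.
apply: (@cvg_biadditive _ _ _ _ (@cmul R B) 1) => *; rewrite ?cmulBl ?cmulBr//.
by rewrite mul1r nrm_cmul.
Qed.

Lemma cvg_star (u : nat -> B) a :
  u n @[n --> \oo] --> a -> star (u n) @[n --> \oo] --> star a.
Proof.
move=> /cvg_nrmP ua; apply/cvg_nrmP => e /ua[N hN]; exists N => n /hN.
by rewrite -starB nrm_star.
Qed.

(* The iteration [y |-> (X + y^2) / 2] for [1 - sqrt (1 - X)], where [X] is the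
   operator [r + x] on [B] and [y] has scalar part [sqrt_coef r] and remaining
   part [sqrt_seq r x]. It is dominated by the scalar iteration with [X = 1]. *)
Fixpoint sqrt_coef (r : R) (n : nat) : R :=
  if n is n'.+1 then (r + sqrt_coef r n' ^+ 2) / 2 else 0.

(** The error [e = 1 - sqrt_coef 1 n] obeys [e |-> e - e^2 / 2], whose orbits decay like [2 / n]. *)
Lemma sqrt_coef_bounds n : 1 - 2 / n.+2%:R <= sqrt_coef 1 n <= 1.
Proof.
elim: n => [|n /andP[IH1 IH2]] /=; first by rewrite divff ?subrr ?lexx ?ler01.
have n2 : 0 < n.+2%:R :> R by [].
have n3 : 0 < n.+3%:R :> R by [].
have : 2 / n.+2%:R <= 1 :> R by rewrite ler_pdivrMr// mul1r ler_nat.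
have : 2 / n.+2%:R - (2 / n.+2%:R) ^+ 2 / 2 <= 2 / n.+3%:R :> R.
  rewrite -subr_ge0; have -> : 2 / n.+3%:R -
    (2 / n.+2%:R - (2 / n.+2%:R) ^+ 2 / 2) = 2 / (n.+3%:R * n.+2%:R ^+ 2) :> R.
    have -> : n.+3%:R = n.+2%:R + 1 :> R by rewrite natr1.
    move: n2 {n3 IH1 IH2}; set t := n.+2%:R => t0; field.
    by rewrite !gt_eqF//; lra.
  by rewrite divr_ge0// mulr_ge0// ?exprn_ge0.
have : 0 <= 2 / n.+2%:R :> R by rewrite divr_ge0.
move: IH1 IH2; set t := 2 / n.+2%:R; set u := 2 / _; set s := sqrt_coef 1 n.
move=> IH1 IH2 t0 ut t1; have s0 : 0 <= s by lra.
have h1 : (1 - t) ^+ 2 <= s ^+ 2 by rewrite lerXn2r// ?nnegrE; lra.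
have h2 : s ^+ 2 <= 1 by rewrite exprn_ile1.
by apply/andP; split; nra.
Qed.

Lemma sqrt_coef_le n : sqrt_coef 1 n <= sqrt_coef 1 n.+1.
Proof. by rewrite /=; have := sqr_ge0 (1 - sqrt_coef 1 n); nra. Qed.

Lemma sqrt_coef_ge0 n : 0 <= sqrt_coef 1 n.
Proof. by case: n => //= n; rewrite divr_ge0// addr_ge0// sqr_ge0. Qed.

Lemma sqrt_coef0 n : sqrt_coef 0 n = 0.
Proof. by elim: n => //= n ->; rewrite expr0n/= addr0 mul0r. Qed.

(** The scalar limit [1 - sqrt (1 - r)] equals [r] exactly for these two values. The value [0]
    serves [sqrt (1 - a^2)], the value [1] square roots of positive elements. *)
Lemma cvg_sqrt_coef r : (r = 0) \/ (r = 1) ->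
  sqrt_coef r n @[n --> \oo] --> r.
Proof.
case=> ->; first by under eq_cvg do rewrite sqrt_coef0; exact: cvg_cst.
apply/cvgrPdist_le => e e0; near=> n.
have /andP[h1 h2] := sqrt_coef_bounds n.
rewrite ger0_norm ?subr_ge0//; apply: (@le_trans _ _ (2 / n.+2%:R)).
  by rewrite lerBlDr addrC -lerBlDr.
rewrite ler_pdivrMr// mulrC -ler_pdivrMr// ltW//.
near: n; exists (Num.bound (2 / e)) => // n /= Nn.
apply: lt_le_trans (archi_boundP _) _; first by rewrite divr_ge0// ltW.
by rewrite ler_nat (leq_trans Nn)// -addn2 leq_addr.
Unshelve. all: by end_near. Qed.

Definition uop (r : R) x b : B := r%:C *: b + cmul x b.

Fixpoint sqrt_seq (r : R) x (n : nat) : B :=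
  if n is n'.+1 then
    (1 / 2)%:C *: (x + (2 * sqrt_coef r n')%:C *: sqrt_seq r x n'
                   + cmul (sqrt_seq r x n') (sqrt_seq r x n'))
  else 0.

Definition sqrt_op r x n b := uop (sqrt_coef r n) (sqrt_seq r x n) b.

Lemma sqrt_opS r x n b : sqrt_op r x n.+1 b =
  (1 / 2)%:C *: (uop r x b + sqrt_op r x n (sqrt_op r x n b)).
Proof.
rewrite /sqrt_op /uop /= !(cmulZl, cmulZr, cmulDl, cmulDr, cmulA).
by lmod R; field.
Qed.

Lemma uopB r x b b' : uop r x (b - b') = uop r x b - uop r x b'.
Proof. by rewrite /uop cmulBr; lmod R; ring. Qed.

Lemma sqrt_opB r x n b b' :
  sqrt_op r x n (b - b') = sqrt_op r x n b - sqrt_op r x n b'.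
Proof. exact: uopB. Qed.

Section SquareRoot.
Variables (r : R) (x : B).
Hypothesis r01 : r = 0 \/ r = 1.
Hypothesis xs : star x = x.
Hypothesis xb : forall b, nrm (uop r x b) <= nrm b.

Local Notation s := (sqrt_coef 1).
Local Notation v := (sqrt_seq r x).
Local Notation Y := (sqrt_op r x).

Lemma sqrt_op_le n b : nrm (Y n b) <= s n * nrm b.
Proof.
elim: n b => [|n IH] b.
  by rewrite /sqrt_op /uop /= cmul0l addr0 scale0r nrm0 mul0r.
rewrite sqrt_opS nrmZr ?divr_ge0//; apply: (@le_trans _ _
  ((1 / 2) * (nrm b + s n * (s n * nrm b)))).
  rewrite ler_wpM2l// ?divr_ge0//; apply: le_trans (nrm_triangle _ _) _.
  rewrite lerD ?xb//; apply: le_trans (IH _) _.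
  by rewrite ler_wpM2l ?IH// sqrt_coef_ge0.
have -> : s n.+1 = (1 + s n ^+ 2) / 2 by [].
by rewrite le_eqVlt; apply/orP; left; apply/eqP; field.
Qed.

Lemma sqrt_op_diff n b : nrm (Y n.+1 b - Y n b) <= (s n.+1 - s n) * nrm b.
Proof.
elim: n b => [|n IH] b.
  have -> : s 1%N - s 0%N = 1 / 2 by rewrite /= expr0n/= addr0 subr0.
  rewrite sqrt_opS /sqrt_op /uop /= !(cmul0l, addr0, scale0r, subr0).
  by rewrite nrmZr ?divr_ge0// ler_wpM2l ?divr_ge0//; exact: xb.
(* This is [p^2 - q^2 = p (p - q) + (p - q) q], a splitting that does not require [p] and [q] to
   commute. *)
have -> : Y n.+2 b - Y n.+1 b = (1 / 2)%:C *: (Y n.+1 (Y n.+1 b - Y n b)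
    + (Y n.+1 (Y n b) - Y n (Y n b))).
  rewrite sqrt_opB !sqrt_opS; lmod R; ring.
rewrite nrmZr ?divr_ge0//; apply: (@le_trans _ _
  ((1 / 2) * (s n.+1 * ((s n.+1 - s n) * nrm b)
            + (s n.+1 - s n) * (s n * nrm b)))); last first.
  have -> : s n.+2 = (1 + s n.+1 ^+ 2) / 2 by [].
  have -> : s n.+1 = (1 + s n ^+ 2) / 2 by [].
  by by rewrite le_eqVlt; apply/orP; left; apply/eqP; field.
rewrite ler_wpM2l ?divr_ge0//; apply: le_trans (nrm_triangle _ _) _.
rewrite lerD//.
  by apply: le_trans (sqrt_op_le _ _) _; rewrite ler_wpM2l ?IH ?sqrt_coef_ge0.
apply: le_trans (IH _) _; rewrite ler_wpM2l ?sqrt_op_le//.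
by rewrite subr_ge0 sqrt_coef_le.
Qed.

Lemma sqrt_seq_diff n : nrm (v n.+1 - v n) <= 2 * (s n.+1 - s n).
Proof.
have s0 : 0 <= s n.+1 - s n by rewrite subr_ge0 sqrt_coef_le.
apply: nrm_opl => [|b]; first by rewrite mulr_ge0.
have -> : cmul (v n.+1 - v n) b = (Y n.+1 b - Y n b)
    - (sqrt_coef r n.+1 - sqrt_coef r n)%:C *: b.
  by rewrite /sqrt_op /uop cmulBl rmorphB/=; lmod R; ring.
apply: le_trans (nrm_triangleB _ _) _.
suff h : nrm ((sqrt_coef r n.+1 - sqrt_coef r n)%:C *: b) <= (s n.+1 - s n) * nrm b.
  by have := sqrt_op_diff n b; lra.
case: r01 => ->; last by rewrite nrmZr.
by rewrite !sqrt_coef0 subr0 scale0r nrm0 mulr_ge0// nrm_ge0.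
Qed.

Lemma sqrt_seq_cauchy : cauchys v.
Proof.
have h n k : nrm (v (n + k)%N - v n) <= 2 * (s (n + k)%N - s n).
  elim: k => [|k IH]; first by rewrite addn0 !subrr nrm0 mulr0.
  have := nrm_triangle3 (v (n + k.+1)%N) (v (n + k)%N) (v n).
  by rewrite addnS; have := sqrt_seq_diff (n + k)%N; lra.
have h2 n m : (n <= m)%N -> nrm (v m - v n) <= 2 * (1 - s n).
  move=> /subnKC <-; apply: le_trans (h _ _) _.
  by have /andP[_] := sqrt_coef_bounds (n + (m - n)); lra.
move=> e e0; have e4 : 0 < e / 4 by lra.
have /cvgrPdist_lt/(_ _ e4)[N _ hN] := cvg_sqrt_coef (or_intror (erefl 1)).
have {}hN := hN N (leqnn N); exists N => n m Nn Nm.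
have /(le_lt_trans (ler_norm _)) {}hN := hN.
have := nrm_triangle3 (v n) (v N) (v m); rewrite [nrm (v N - _)]nrmB.
have := h2 _ _ Nn; have := h2 _ _ Nm; lra.
Qed.

(** For [y = r + w] the last clause is the fixed point equation [2 y = (r + x) + y^2], with its
    scalar part [2 r = r + r^2] removed. *)
Lemma sqrt_exists : exists w : B,
  [/\ star w = w, (forall c, cmul c x = cmul x c -> cmul c w = cmul w c),
      (forall b, nrm (uop r w b) <= nrm b) &
      2%:C *: w = x + (2 * r)%:C *: w + cmul w w].
Proof.
have [w vw] := cauchys_cvg sqrt_seq_cauchy.
have vs n : star (v n) = v n.
  elim: n => [|n IH] /=; first exact: star0.
  by rewrite starZr !starD starZr starM xs IH.
have vc c : cmul c x = cmul x c -> forall n, cmul c (v n) = cmul (v n) c.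
  move=> cx; elim=> [|n IH] /=; first by rewrite cmul0l cmul0r.
  rewrite cmulZr cmulZl !cmulDr !cmulDl cx cmulZr cmulZl IH cmulA IH -cmulA IH.
  by rewrite cmulA.
have sr := cvg_sqrt_coef r01.
exists w; split.
- suff : star (v n) @[n --> \oo] --> w.
    by apply: cvg_nrm_unique; exact: cvg_star.
  by under eq_cvg do rewrite vs.
- move=> c /vc cv; suff : cmul c (v n) @[n --> \oo] --> cmul w c.
    apply: cvg_nrm_unique.
    by apply: cvg_cmul => //; exact: cvg_cst.
  under eq_cvg do rewrite cv.
  by apply: cvg_cmul => //; exact: cvg_cst.
- move=> b; apply: (@cvg_nrm_le _ _ (fun n => Y n b)) => [|n].
    apply: cvgD; last by apply: cvg_cmul => //; exact: cvg_cst.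
    by apply: cvg_scaler => //; exact: cvg_cst.
  apply: le_trans (sqrt_op_le _ _) _; rewrite -[leRHS]mul1r ler_wpM2r ?nrm_ge0//.
  by have /andP[] := sqrt_coef_bounds n.
- have /(cvg_scaler (@cvg_cst _ (2 : R) _ _ _))/cvg_nrm_unique := cvg_nrm_shift 1 vw.
  apply; rewrite [X in X @ _](_ : _ = fun n =>
    x + (2 * sqrt_coef r n)%:C *: v n + cmul (v n) (v n)); last first.
    by apply/funext => n; rewrite add1n /=; lmod R; field.
  apply: cvgD; last exact: cvg_cmul.
  apply: cvgD; first exact: cvg_cst.
  by apply: cvg_scaler => //; apply: cvgMr.
Qed.

End SquareRoot.

Lemma nrm_square a : star a = a -> nrm (cmul a a) = nrm a ^+ 2.
Proof. by move=> sa; rewrite -{1}sa nrm_cstar. Qed.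

(* With [q = sqrt (1 - a^2)], the operators [q + 'i a] and [q - 'i a] are
   isometric, and [1 - 2 a^2] is the mean of their squares. *)
Lemma nrm_one_sub_square a b : star a = a -> nrm a <= 1 ->
  nrm (b - 2%:C *: cmul (cmul a a) b) <= nrm b.
Proof.
move=> sa a1.
have [] := @sqrt_exists 0 (cmul a a) (or_introl (erefl 0)).
- by rewrite starM sa.
- move=> c; rewrite /uop scale0r add0r; apply: le_trans (nrm_cmul _ _) _.
  by rewrite -[leRHS]mul1r ler_wpM2r ?nrm_ge0// nrm_square// exprn_ile1// nrm_ge0.
move=> v [sv cv _]; rewrite mulr0 scale0r addr0 => vE.
have av : cmul a v = cmul v a by apply: cv; rewrite cmulA.
have vv z : cmul (cmul z v) v = 2%:C *: cmul z v - cmul (cmul z a) a.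
  by rewrite -!cmulA -cmulZr vE cmulDr; lmod R; ring.
have va z : cmul (cmul z a) v = cmul (cmul z v) a by rewrite -!cmulA av.
(* Here [v = 1 - q], so [U k] is left multiplication by [q + k a]. *)
pose U (k : C) c := c - cmul v c + k *: cmul a c.
have isoU (k : C) c : Num.conj k = - k -> k * k = -1 -> nrm (U k c) = nrm c.
  move=> ck kk; apply/eqP; rewrite -(@eqrXn2 _ 2%N) ?nrm_ge0// -!nrm_cstar.
  apply/eqP; congr nrm; rewrite /U !(starD, starN, starB, starM, starZ, sv, sa).
  rewrite ck !(cmulDl, cmulDr, cmulNl, cmulNr, cmulZl, cmulZr, cmulA).
  rewrite va vv !(cmulDl, cmulNl, cmulZl).
  have kkN : - k * k = 1 by rewrite mulNr kk opprK.
  by lmod R; rewrite ?(mulrA (- k)) ?kkN; ring.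
have [k ck kk] : exists2 k : C, Num.conj k = - k & k * k = -1.
  by exists 'i%C; [exact: conj_imaginary|rewrite -expr2 sqr_i].
have -> : b - 2%:C *: cmul (cmul a a) b
    = (1 / 2)%:C *: (U k (U k b) + U (- k) (U (- k) b)).
  rewrite /U !(cmulDl, cmulDr, cmulNl, cmulNr, cmulZl, cmulZr, cmulA).
  have -> : cmul (cmul v v) b = 2%:C *: cmul v b - cmul (cmul a a) b.
    by rewrite -cmulZl vE cmulDl; lmod R; ring.
  (* Some coefficients agree only modulo [k^2 = -1]; [red] supplies the multiple of [k^2 + 1] that
     [field] cannot find. *)
  have red (x y c : C) : x = y + c * (k * k + 1) -> x = y.
    by rewrite kk addNr mulr0 addr0.
  by rewrite av; lmod R; solve [by field|by apply: (red _ _ (-1)); field].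
have hk c : nrm (U k c) = nrm c by exact: isoU.
have hNk c : nrm (U (- k) c) = nrm c.
  apply: isoU; last by rewrite mulrNN.
  by rewrite rmorphN/= ck.
rewrite nrmZr ?divr_ge0//; have := nrm_triangle (U k (U k b)) (U (- k) (U (- k) b)).
by rewrite !hk !hNk; lra.
Qed.

(** In a unitization this says that [t - a] has norm at most [t], that is, that the spectrum of [a]
    lies in [[0, 2 t]]. In this form, stability under sums is just the triangle inequality. *)
Definition pos a : Prop :=
  star a = a /\ exists2 t : R, 0 <= t & forall b, nrm (uop t (- a) b) <= t * nrm b.

Lemma posD a b : pos a -> pos b -> pos (a + b).
Proof.
move=> [sa [t t0 ha]] [sb [s s0 hb]]; split; first by rewrite starD sa sb.
exists (t + s) => [|c]; first by rewrite addr_ge0.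
have -> : uop (t + s) (- (a + b)) c = uop t (- a) c + uop s (- b) c.
  by rewrite /uop !cmulNl cmulDl; lmod R; ring.
by apply: le_trans (nrm_triangle _ _) _; rewrite mulrDl lerD.
Qed.

Lemma posZ (r : R) a : 0 <= r -> pos a -> pos (r%:C *: a).
Proof.
move=> r0 [sa [t t0 ha]]; split; first by rewrite starZr sa.
exists (r * t) => [|c]; first by rewrite mulr_ge0.
have -> : uop (r * t) (- (r%:C *: a)) c = r%:C *: uop t (- a) c.
  by rewrite /uop !cmulNl cmulZl; lmod R; ring.
by rewrite nrmZr// -mulrA ler_wpM2l.
Qed.

(** Rescaling [a] by [sqrt T] reduces this to [nrm_one_sub_square]. Any [T] above the norm is
    allowed, so that one [T] can serve a whole bounded sequence. *)
Lemma pos_square_sharp a (T : R) b : star a = a -> nrm (cmul a a) <= T ->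
  nrm (T%:C *: b - 2%:C *: cmul (cmul a a) b) <= T * nrm b.
Proof.
move=> sa aT; have [T0|T0] := leP T 0.
  have a0 : cmul a a = 0 by apply: nrm_le0; apply: le_trans T0.
  have -> : T = 0 by apply/eqP; rewrite eq_le T0 (le_trans _ aT)// nrm_ge0.
  by rewrite a0 cmul0l scale0r scaler0 subr0 nrm0 mul0r.
pose r := Num.sqrt T; have r0 : 0 < r by rewrite sqrtr_gt0.
have rr : r ^+ 2 = T by rewrite sqr_sqrtr// ltW.
have -> : T%:C *: b - 2%:C *: cmul (cmul a a) b = T%:C *:
    (b - 2%:C *: cmul (cmul (r^-1%:C *: a) (r^-1%:C *: a)) b).
  rewrite -rr !(cmulZl, cmulZr); lmod R; first ring.
  by rewrite !rmorphXn/= !fmorphV/=; field; rewrite -(rmorph0 (real_complex R)) (inj_eq (@complexI _)) gt_eqF.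
rewrite nrmZr ?ler_wpM2l ?(ltW T0)//.
apply: nrm_one_sub_square; first by rewrite starZr sa.
rewrite nrmZr ?invr_ge0 ?(ltW r0)// mulrC ler_pdivrMr// mul1r.
by rewrite -(ler_pXn2r (n := 2))// ?nnegrE ?nrm_ge0 ?(ltW r0)// -nrm_square// rr.
Qed.

Lemma pos_square a : star a = a -> pos (cmul a a).
Proof.
move=> sa; split; first by rewrite starM sa.
exists (nrm (cmul a a)) => [|c]; first exact: nrm_ge0.
set T := nrm (cmul a a); have -> : uop T (- cmul a a) c = (1 / 2)%:C *: (T%:C *: c
    + (T%:C *: c - 2%:C *: cmul (cmul a a) c)).
  by rewrite /uop cmulNl; lmod R; field.
rewrite nrmZr ?divr_ge0//; have := pos_square_sharp c sa (lexx _).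
have := nrm_triangle (T%:C *: c) (T%:C *: c - 2%:C *: cmul (cmul a a) c).
by rewrite [nrm (T%:C *: c)]nrmZr ?nrm_ge0// /T; lra.
Qed.

(** For [X = 1 - a/T] the iteration converges to [1 - sqrt (a/T)]. Its part in [B] is
    [v = - sqrt (a/T)], so the root of [a] is [- sqrt T v]; [T = t + 1] makes the division
    legitimate. *)
Lemma pos_sqrt a : pos a -> exists w : B, [/\ star w = w, pos w,
  cmul w w = a & forall c, cmul c a = cmul a c -> cmul c w = cmul w c].
Proof.
move=> [sa [t t0 ha]]; pose T := t + 1; have T0 : 0 < T by rewrite /T; lra.
pose x := - (T^-1%:C *: a).
have := @sqrt_exists 1 x (or_intror (erefl 1)) => -[].
- by rewrite starN starZr sa.
- move=> b; have -> : uop 1 x b = T^-1%:C *: (uop t (- a) b + b).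
    have TC : T^-1%:C * (t%:C + 1) = 1.
      by rewrite -[1]/(1%:C) -rmorphD -rmorphM/= mulVf// gt_eqF.
    rewrite /uop /x !cmulNl cmulZl; lmod R; last ring.
    by apply: etrans (etrans _ (esym TC)) _; move: (T^-1%:C) => u; ring.
  rewrite nrmZr ?invr_ge0 ?(ltW T0)// mulrC ler_pdivrMr//.
  by apply: le_trans (nrm_triangle _ _) _; have := ha b; rewrite /T; lra.
move=> v [sv cv vb vE].
pose r := Num.sqrt T; have r0 : 0 < r by rewrite sqrtr_gt0.
have rr : r * r = T by rewrite -expr2 sqr_sqrtr// ltW.
have vv : cmul v v = T^-1%:C *: a.
  have -> : cmul v v = 2%:C *: v - (x + (2 * 1)%:C *: v).
    by rewrite vE; lmod R; ring.
  by rewrite /x; lmod R; ring.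
exists (- (r%:C *: v)); split.
- by rewrite starN starZr sv.
- split; first by rewrite starN starZr sv.
  exists r => [|b]; first exact: ltW.
  have -> : uop r (- - (r%:C *: v)) b = r%:C *: uop 1 v b.
    by rewrite /uop opprK cmulZl; lmod R; ring.
  by rewrite nrmZr ?(ltW r0)// ler_wpM2l// ltW.
- rewrite cmulNl cmulNr opprK cmulZl cmulZr vv !scalerA -!rmorphM rr mulfV ?gt_eqF//.
  by rewrite scale1r.
- move=> c ca; rewrite cmulNr cmulNl cmulZr cmulZl cv// /x cmulNr cmulNl.
  by rewrite cmulZr cmulZl ca.
Qed.

(* Convexity of [r |-> |r + x|]: it is at most [T / 2] at [- T / 2] and equal to
   [T] at [0], where [T = |x|], hence has slope at least [1] on [r >= 0]. *)
Lemma pos_shift x (r M : R) : pos x -> 0 <= r ->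
  (forall b, nrm (uop r x b) <= M * nrm b) -> nrm x = 0 \/ r + nrm x <= M.
Proof.
move=> /pos_sqrt[w [sw _ wx _]] r0 hM.
have [->|x0] := eqVneq (nrm x) 0; first by left.
right; set T := nrm x; have T0 : 0 < T by rewrite lt_def x0 nrm_ge0.
have M0 : 0 <= M.
  rewrite -(pmulr_lge0 _ T0); apply: le_trans (hM x); exact: nrm_ge0.
have rT : 0 < r + T / 2 by rewrite ltr_wpDl// divr_gt0.
suff h : nrm x <= (T / 2 * M + r * (T / 2)) / (r + T / 2).
  move: h; rewrite ler_pdivlMr// -/T => h; have : 0 < T / 2 by rewrite divr_gt0.
  nra.
apply: nrm_opl => [|b].
  by rewrite divr_ge0 ?(ltW rT)// addr_ge0 ?mulr_ge0 ?divr_ge0 ?(ltW T0).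
rewrite mulrAC ler_pdivlMr// mulrC.
have -> : (r + T / 2) * nrm (cmul x b) = nrm ((T / 2)%:C *: uop r x b
    - (r / 2)%:C *: (T%:C *: b - 2%:C *: cmul (cmul w w) b)).
  rewrite -nrmZr ?(ltW rT)//; congr nrm; rewrite wx /uop.
  by lmod R; field.
apply: le_trans (nrm_triangleB _ _) _.
rewrite !nrmZr ?divr_ge0 ?(ltW T0)//.
have := hM b; have /(pos_square_sharp b sw) : nrm (cmul w w) <= T by rewrite wx.
move: T0 r0; set n1 := nrm (_ - _); set n2 := nrm (uop _ _ _); nra.
Qed.

(** From [|t - (y - x)| <= t] one gets [|t + x| <= t + |y|], and for positive [x] the left side is
    at least [t + |x|]. *)
Lemma pos_le_nrm x y : pos x -> pos (y - x) -> nrm x <= nrm y.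
Proof.
move=> px [_ [t t0 ht]]; have y0 := nrm_ge0 y.
have : forall b, nrm (uop t x b) <= (t + nrm y) * nrm b.
  move=> b; have -> : uop t x b = uop t (- (y - x)) b + cmul y b.
    by rewrite /uop cmulNl cmulBl; lmod R; ring.
  apply: le_trans (nrm_triangle _ _) _; rewrite mulrDl lerD//.
  exact: nrm_cmul.
by move=> /(pos_shift px t0) [->//|]; rewrite lerD2l.
Qed.

End CStar.

(** * Geometric growth against linear bounds *)

Section RealGrowth.
Context {R : realType}.

Lemma bernoulli (d : R) (n : nat) : 0 <= d -> 1 + n%:R * d <= (1 + d) ^+ n.
Proof.
move=> d0; elim: n => [|n IH]; first by rewrite mul0r addr0 expr0.
rewrite exprS -natr1; have : 0 <= n%:R * d by rewrite mulr_ge0.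
by nra.
Qed.

Lemma natr_unbounded (d K : R) : 0 < d -> exists n : nat, K < n%:R * d.
Proof.
move=> d0; exists (Num.bound (K / d)); rewrite -ltr_pdivrMr//.
have [K0|K0] := leP 0 (K / d); first exact: archi_boundP.
by apply: lt_le_trans K0 _.
Qed.

(** If [s = t (1 + d)] with [d > 0], Bernoulli's inequality squared makes [(1 + d)^(2 m)] grow
    quadratically in [m], beating the linear factor; hence the even exponents. *)
Lemma geometric_le_linear (t s D : R) : 0 < t ->
  (forall n, s ^+ n * t <= t ^+ n * (t + n%:R * D)) -> s <= t.
Proof.
move=> t0 h; rewrite leNgt; apply/negP => ts.
pose d := s / t - 1; have d0 : 0 < d by rewrite subr_gt0 ltr_pdivlMr// mul1r.
have sE : s = t * (1 + d) by rewrite /d addrC subrK mulrCA mulfV ?mulr1// gt_eqF.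
have [m hm] := natr_unbounded `|2 * D / t| (exprn_gt0 2 d0).
have := h (2 * m)%N; rewrite sE exprMn -mulrA ler_pM2l ?exprn_gt0//.
rewrite mulnC exprM natrM => h2; have := bernoulli m (ltW d0).
have md0 : 0 <= m%:R * d by rewrite mulr_ge0// ltW.
move=> h1; have h3 : (1 + m%:R * d) ^+ 2 <= ((1 + d) ^+ m) ^+ 2.
  by rewrite lerXn2r// nnegrE ?exprn_ge0//; lra.
have {}h2 : (1 + m%:R * d) ^+ 2 * t <= t + m%:R * 2 * D.
  by apply: le_trans h2; rewrite ler_pM2r.
have hm' : 2 * D < m%:R * d ^+ 2 * t by rewrite -ltr_pdivrMr// (le_lt_trans _ hm)// ler_norm.
have [m0|m0] := posnP m.
  by move: hm; rewrite m0 mul0r ltNge normr_ge0.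
have {}m0 : 1 <= m%:R :> R by rewrite ler1n.
by have : 0 < m%:R * d * t; [rewrite !mulr_gt0//; lra|nra].
Qed.

End RealGrowth.

(** * Positivity of the elements c^* c *)

Section Kaplansky.
Context {R : realType} {B : cstarAlgType R}.
Local Notation C := R[i].
Implicit Types a b c d x y z : B.

Lemma uop_selfadjoint (t : R) z x y : star z = z ->
  cmul (star (uop t z x)) y = cmul (star x) (uop t z y).
Proof.
move=> sz; rewrite /uop starD starZr starM sz !cmulDl cmulDr cmulZl cmulZr.
by rewrite cmulA.
Qed.

(** A spectral radius argument, vector by vector: for self-adjoint [G] the norms [|G^n b|] are
    log-convex, so their consecutive ratios never drop below the first one, [s], and
    [s^n |b| <= |G^n b|]. *)
Lemma iter_uop_le (t D : R) z b : 0 < t -> star z = z ->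
  (forall n, nrm (iter n (uop t z) b) * t <= t ^+ n * (t + n%:R * D) * nrm b) ->
  nrm (uop t z b) <= t * nrm b.
Proof.
move=> t0 sz h; pose al n := nrm (iter n (uop t z) b).
have al0 n : 0 <= al n by exact: nrm_ge0.
have conv n : al n.+1 ^+ 2 <= al n * al n.+2.
  rewrite /al -nrm_cstar iterS uop_selfadjoint// -iterS.
  by apply: le_trans (nrm_cmul _ _) _; rewrite nrm_star.
have [b0|b0] := eqVneq (nrm b) 0.
  by rewrite (nrm_eq0 b0) /uop scaler0 cmul0r addr0 nrm0 mulr0.
have {}b0 : 0 < nrm b by rewrite lt_def b0 nrm_ge0.
pose s := al 1%N / nrm b; suff : s <= t by rewrite ler_pdivrMr.
have [s0|s0] := leP s 0; first by apply: le_trans s0 (ltW t0).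
apply: (@geometric_le_linear _ t s D) => // n.
have grow m : 0 < al m /\ s * al m <= al m.+1.
  elim: m => [|m [IH1 IH2]]; first by rewrite /s /= divfK ?gt_eqF.
  have a1 : 0 < al m.+1 by apply: lt_le_trans IH2; rewrite mulr_gt0.
  split=> //; rewrite -(ler_pM2l IH1); apply: le_trans (conv m).
  by rewrite expr2 mulrA ler_pM2r// mulrC.
have {grow} : s ^+ n * nrm b <= al n.
  elim: n => [|m IH]; first by rewrite expr0 mul1r.
  by rewrite exprS -mulrA; apply: le_trans (grow m).2; rewrite ler_pM2l.
rewrite -(ler_pM2r t0) => h1; have := le_trans h1 (h n).
by rewrite mulrAC ler_pM2r.
Qed.

(* Let [G = t + d d^*] and [H = t + d^* d], with [|H| <= t] by hypothesis. From
   [G^(n+1) = t G^n + d H^n d^*] the norms [|G^n|] grow at most like [n t^n], so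
   that [|G| <= t] because [G] is self-adjoint. As [d d^*] is positive (its sum
   with [d^* d] is a sum of squares), it must vanish. *)
Lemma pos_opp_cstar0 d : pos (- cmul (star d) d) -> d = 0.
Proof.
move=> pd; pose z := cmul d (star d).
have sz : star z = z by rewrite /z starM starK.
have pz : pos z.
  have [k ck kk] : exists2 k : C, Num.conj k = - k & k * k = -1.
    by exists 'i%C; [exact: conj_imaginary|rewrite -expr2 sqr_i].
  pose s1 := d + star d; pose s2 := k *: (d - star d).
  have -> : z = (1 / 2)%:C *: (cmul s1 s1 + cmul s2 s2) - cmul (star d) d.
    rewrite /s1 /s2 cmulZl cmulZr scalerA kk scaleN1r /z.
    by rewrite !(cmulDl, cmulDr, cmulNl, cmulNr); lmod R; field.
  apply: posD => //; apply: posZ; first by rewrite divr_ge0.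
  apply: posD; apply: pos_square; first by rewrite /s1 starD starK addrC.
  by rewrite /s2 starZ starB starK ck; lmod R; ring.
have [_ [t0 t0_ge0 ht0]] := pd; pose t := t0 + 1.
have t_gt0 : 0 < t by rewrite /t; lra.
pose H := uop t (cmul (star d) d); pose G := uop t z.
have hH n b : nrm (iter n H b) <= t ^+ n * nrm b.
  elim: n => [|n IH]; first by rewrite mul1r.
  apply: (@le_trans _ _ (t * nrm (iter n H b))); last first.
    by rewrite exprS -mulrA ler_pM2l.
  rewrite iterS; set x := iter n H b.
  have -> : H x = uop t0 (- (- cmul (star d) d)) x + x.
    by rewrite /H /uop opprK; lmod R; rewrite /t ?rmorphD/=; ring.
  by apply: le_trans (nrm_triangle _ _) _; have := ht0 x; rewrite /t; lra.
have GH n b : iter n G (cmul d b) = cmul d (iter n H b).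
  elim: n => // n IH; rewrite !iterS IH /G /H /uop cmulDr cmulZr.
  by rewrite /z !cmulA.
have GD n x y (r : R) : iter n G (r%:C *: x + y) = r%:C *: iter n G x + iter n G y.
  elim: n => // n IH; rewrite !iterS IH /G /uop cmulDr cmulZr.
  by lmod R; ring.
have hG b : nrm (G b) <= t * nrm b.
  apply: (@iter_uop_le t (nrm d ^+ 2)) => // n.
  elim: n => [|n IH]; first by rewrite expr0 mul0r addr0 mul1r mulrC.
  rewrite iterSr -/G {2}/G /uop GD /z -cmulA GH.
  apply: (@le_trans _ _ ((t * nrm (iter n G b) + nrm d * (t ^+ n * (nrm d * nrm b))) * t)).
    rewrite ler_pM2r//; apply: le_trans (nrm_triangle _ _) _.
    rewrite nrmZr ?(ltW t_gt0)// lerD2l; apply: le_trans (nrm_cmul _ _) _.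
    rewrite ler_wpM2l ?nrm_ge0//; apply: le_trans (hH _ _) _.
    rewrite ler_wpM2l ?exprn_ge0 ?(ltW t_gt0)//.
    by apply: le_trans (nrm_cmul _ _) _; rewrite nrm_star.
  rewrite mulrDl -mulrA; apply: (@le_trans _ _
    (t * (t ^+ n * (t + n%:R * nrm d ^+ 2) * nrm b)
     + nrm d * (t ^+ n * (nrm d * nrm b)) * t)).
    by rewrite lerD2r ler_pM2l.
  by rewrite le_eqVlt; apply/orP; left; apply/eqP; rewrite [t ^+ n.+1]exprS -natr1; ring.
have : nrm z = 0.
  by case: (pos_shift pz (ltW t_gt0) hG) => // h; have := nrm_ge0 z; lra.
rewrite /z -{1}(starK d) nrm_cstar nrm_star => /eqP; rewrite sqrf_eq0 => /eqP.
exact: nrm_eq0.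
Qed.

(* Kaplansky: with [a = c^* c] and [k = |a| - a], the element [d = c k] satisfies
   [- d^* d = k |a| k >= 0]. *)
Lemma cstar_pos c : pos (cmul (star c) c).
Proof.
have [a aE] : exists a, a = cmul (star c) c by exists (cmul (star c) c).
have sa : star a = a by rewrite aE starM starK.
have [h [sh ph hh hc]] := pos_sqrt (pos_square sa).
have ah : cmul a h = cmul h a by apply: hc; rewrite cmulA.
pose k := h - a; have sk : star k = k by rewrite /k starB sh sa.
have [r [sr _ rr rc]] := pos_sqrt ph.
have kh : cmul k h = cmul h k by rewrite /k cmulBl cmulBr ah.
have kr : cmul k r = cmul r k by exact: rc.
have kk : cmul k k = 2%:C *: cmul h k.
  by rewrite /k !(cmulBl, cmulBr) ah hh; lmod R; ring.
pose e := cmul r k; have se : star e = e by rewrite /e starM sk sr kr.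
have ee : cmul e e = cmul k (cmul h k).
  by rewrite /e -rr -{1}kr !cmulA.
have dd : cmul (star (cmul c k)) (cmul c k) = - cmul e e.
  rewrite starM sk cmulA -(cmulA k) -aE ee.
  have -> : a = h - k by rewrite /k opprB addrC subrK.
  rewrite cmulBr cmulBl -[cmul (cmul k k) k]cmulA kk cmulZr cmulA.
  by lmod R; ring.
have /nrm_square := se.
have := @pos_opp_cstar0 (cmul c k); rewrite dd opprK => /(_ (pos_square se)) ck0.
have -> : cmul e e = 0 by apply: oppr_inj; rewrite -dd ck0 cmul0r oppr0.
rewrite nrm0 => /esym/eqP; rewrite sqrf_eq0 => /eqP/nrm_eq0 e0.
have /nrm_square : star k = k by [].
rewrite kk -rr -cmulA -/e e0 cmul0r scaler0 nrm0 => /esym/eqP.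
rewrite sqrf_eq0 => /eqP/nrm_eq0/eqP; rewrite subr_eq0 -aE => /eqP <-.
exact: ph.
Qed.

Lemma cpositiveP a : cpositive a <-> pos a.
Proof.
split=> [[c ->]|/pos_sqrt[w [sw _ <- _]]]; first exact: cstar_pos.
by exists w; rewrite sw.
Qed.

Lemma cpositiveD a b : cpositive a -> cpositive b -> cpositive (a + b).
Proof. by move=> /cpositiveP pa /cpositiveP pb; apply/cpositiveP/posD. Qed.

Lemma cpositiveZ (r : R) a : 0 <= r -> cpositive a -> cpositive (r%:C *: a).
Proof. by move=> r0 /cpositiveP pa; apply/cpositiveP/posZ. Qed.

Lemma cpositive_star a : cpositive a -> star a = a.
Proof. by move=> /cpositiveP[]. Qed.

Lemma cle_nrm a b : cpositive a -> a ≼ b -> nrm a <= nrm b.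
Proof. by move=> /cpositiveP pa /cpositiveP; exact: pos_le_nrm. Qed.

(** The radius [t] in [pos] could vary along the sequence. Writing the late terms as squares of norm
    at most [|a| + 1] provides a common [t], for which the condition passes to the limit. *)
Lemma cpositive_closed (u : nat -> B) a :
  u n @[n --> \oo] --> a -> (forall n, cpositive (u n)) -> cpositive a.
Proof.
move=> ua pu; apply/cpositiveP.
have sa : star a = a.
  apply: (@cvg_nrm_unique _ _ (fun n => star (u n))); first exact: cvg_star.
  by under eq_cvg do rewrite cpositive_star//.
split=> //; have /cvg_nrmP/(_ 1 ltr01)[N hN] := ua.
pose t := nrm a + 1; have t0 : 0 <= t by rewrite /t addr_ge0 ?nrm_ge0.
exists t => // b.
have cv : uop t (- u (N + n)%N) b @[n --> \oo] --> uop t (- a) b.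
  apply: cvgD; first exact: cvg_cst.
  apply: cvg_cmul; last exact: cvg_cst.
  exact: cvgN (cvg_nrm_shift N ua).
apply: cvg_nrm_le cv _ => n; have /cpositiveP/pos_sqrt[w [sw _ wE _]] := pu (N + n)%N.
have unt : nrm (cmul w w) <= t.
  rewrite wE; have := hN _ (leq_addr n N); have := nrm_triangle (u (N + n)%N - a) a.
  by rewrite subrK /t; lra.
have := pos_square_sharp b sw unt; rewrite wE => h.
have -> : uop t (- u (N + n)%N) b = (1 / 2)%:C *: (t%:C *: b
    + (t%:C *: b - 2%:C *: cmul (u (N + n)%N) b)).
  by rewrite /uop cmulNl; lmod R; field.
rewrite nrmZr ?divr_ge0//.
have := nrm_triangle (t%:C *: b) (t%:C *: b - 2%:C *: cmul (u (N + n)%N) b).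
by rewrite [nrm (t%:C *: b)]nrmZr//; lra.
Qed.

End Kaplansky.

(** * Hilbert modules *)

Section Contraction.
Context {R : realType} {V : completeNormedModType R[i]}.

Lemma contraction_fixpoint (f : V -> V) (r : R) : 0 <= r < 1 ->
  (forall x y, nrm (f x - f y) <= r * nrm (x - y)) -> exists x, f x = x.
Proof.
move=> /andP[r0 r1] fr; pose u n := iter n f 0.
have d0 k : nrm (u k - u 0%N) * (1 - r) <= nrm (f 0).
  elim: k => [|k IH]; first by rewrite subrr nrm0 mul0r nrm_ge0.
  have := nrm_triangle3 (u k.+1) (f 0) (u 0%N); rewrite [f 0 - _]subr0.
  have := fr (u k) 0; rewrite -[f (u k)]/(u k.+1) -{2}[0]/(u 0%N).
  have := nrm_ge0 (f 0); have := nrm_ge0 (u k - u 0%N).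
  by move: IH; set n1 := nrm (u k - _); set n2 := nrm (u k.+1 - u _);
    set n3 := nrm (u k.+1 - _); nra.
have dn n k : nrm (u (n + k)%N - u n) <= r ^+ n * nrm (u k - u 0%N).
  elim: n => [|n IH]; first by rewrite add0n expr0 mul1r.
  rewrite addSn /u !iterS; apply: le_trans (fr _ _) _.
  by rewrite exprS -mulrA ler_wpM2l.
have uc : cauchys u.
  move=> e e0; pose d := e * (1 - r) / (2 * (nrm (f 0) + 1)).
  have f0 := nrm_ge0 (f 0).
  have dpos : 0 < d by rewrite divr_gt0 ?mulr_gt0//; lra.
  have /cvgrPdist_lt/(_ _ dpos)[N _ hN] : r ^+ n @[n --> \oo] --> (0 : R).
    by apply: cvg_expr; rewrite ger0_norm.
  have {}hN := hN N (leqnn N).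
  rewrite /= sub0r normrN ger0_norm ?exprn_ge0// in hN.
  have hu n : (N <= n)%N -> nrm (u n - u N) < e / 2.
    move=> /subnKC <-; set k := (n - N)%N; apply: le_lt_trans (dn _ _) _.
    rewrite -(ltr_pM2r (x := 1 - r)); last lra.
    apply: (@le_lt_trans _ _ (d * nrm (f 0))).
      rewrite -mulrA; apply: ler_pM; rewrite ?exprn_ge0 ?(ltW hN)//.
      by rewrite mulr_ge0 ?nrm_ge0//; lra.
    apply: (@lt_le_trans _ _ (d * (nrm (f 0) + 1))).
      by rewrite ltr_pM2l//; lra.
    rewrite /d le_eqVlt; apply/orP; left; apply/eqP; field.
    by apply/eqP; lra.
  exists N => n m Nn Nm; have := nrm_triangle3 (u n) (u N) (u m).
  by have := hu _ Nn; have := hu _ Nm; rewrite [nrm (u N - _)]nrmB; lra.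
have [x ux] := cauchys_cvg uc; exists x.
apply: (@cvg_nrm_unique _ _ (fun n => u (1 + n)%N)); last exact: cvg_nrm_shift.
apply/cvg_nrmP => e; have /cvg_nrmP/[apply] -[N hN] := ux; exists N => n /hN.
apply: le_lt_trans; rewrite add1n; apply: le_trans (fr _ _) _.
by rewrite -[leRHS]mul1r ler_wpM2r ?nrm_ge0// ltW.
Qed.

End Contraction.

Section HilbertModule.
Context {R : realType} {B : cstarAlgType R} {E : hilbertModType B}.
Local Notation C := R[i].
Implicit Types x y z : E.

Lemma innerDl x y z : ⟨x + y, z⟩ = ⟨x, z⟩ + ⟨y, z⟩.
Proof. by rewrite -inner_star innerDr starD !inner_star. Qed.

Lemma innerZl (k : C) x y : ⟨k *: x, y⟩ = Num.conj k *: ⟨x, y⟩.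
Proof. by rewrite -inner_star innerZr starZ inner_star. Qed.

Lemma inner0l y : ⟨0 : E, y⟩ = 0.
Proof. by apply: (addrI ⟨0 : E, y⟩); rewrite -innerDl !addr0. Qed.

Lemma inner0r y : ⟨y, 0 : E⟩ = 0.
Proof. by rewrite -inner_star inner0l star0. Qed.

Lemma innerNl x y : ⟨- x, y⟩ = - ⟨x, y⟩.
Proof. by apply: (addrI ⟨x, y⟩); rewrite -innerDl !subrr inner0l. Qed.

Lemma innerNr x y : ⟨x, - y⟩ = - ⟨x, y⟩.
Proof. by rewrite -inner_star innerNl starN inner_star. Qed.

Lemma innerBl x y z : ⟨x - y, z⟩ = ⟨x, z⟩ - ⟨y, z⟩.
Proof. by rewrite innerDl innerNl. Qed.

Lemma innerBr x y z : ⟨x, y - z⟩ = ⟨x, y⟩ - ⟨x, z⟩.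
Proof. by rewrite innerDr innerNr. Qed.

Lemma nrm_sq x : nrm ⟨x, x⟩ = nrm x ^+ 2.
Proof.
by apply: (@complexI R); rewrite rmorphXn/= -!nrmE norm_inner.
Qed.

(* Polarization gives the Cauchy-Schwarz inequality up to the constant [4]. *)
Lemma nrm_inner x y : nrm ⟨x, y⟩ <= 4 * (nrm x * nrm y).
Proof.
have [k ck kk] : exists2 k : C, Num.conj k = - k & k * k = -1.
  by exists 'i%C; [exact: conj_imaginary|rewrite -expr2 sqr_i].
have k1 : cabs k = 1.
  have := congr1 cabs kk; rewrite cabsM cabsN -[1]/(1%:C) cabs_real normr1.
  by have := cabs_ge0 k; nra.
have pol z w : nrm ⟨z, w⟩ <= (nrm z + nrm w) ^+ 2.
  have q0 (l : C) : cabs l = 1 -> nrm ⟨z + l *: w, z + l *: w⟩ <= (nrm z + nrm w) ^+ 2.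
    move=> l1; rewrite nrm_sq lerXn2r// ?nnegrE ?nrm_ge0 ?addr_ge0 ?nrm_ge0//.
    by apply: le_trans (nrm_triangle _ _) _; rewrite nrmZ l1 mul1r.
  have -> : ⟨z, w⟩ = (1 / 4)%:C *: (⟨z + w, z + w⟩ - ⟨z - w, z - w⟩
     - k *: ⟨z + k *: w, z + k *: w⟩ + k *: ⟨z - k *: w, z - k *: w⟩).
    have red (a b c : C) : a = b + c * (k * k + 1) -> a = b.
      by rewrite kk addNr mulr0 addr0.
    rewrite !(innerDl, innerDr, innerNl, innerNr, innerZl, innerZr) ck.
    lmod R; solve [by field|by apply: (red _ _ (1 / 2)); field
      |by apply: (red _ _ (- (1 / 2))); field].
  rewrite nrmZr ?divr_ge0//.
  have := q0 1; rewrite scale1r -[1]/(1%:C) cabs_real normr1 => /(_ erefl) h1.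
  have := q0 (- 1); rewrite scaleN1r cabsN -[1]/(1%:C) cabs_real normr1 => /(_ erefl) h2.
  have h3 := q0 k k1; have := q0 (- k); rewrite cabsN scaleNr => /(_ k1) h4.
  set a := ⟨z + w, _⟩; set b := ⟨z - w, _⟩; set c := ⟨z + _, _⟩; set d := ⟨z - _, _⟩.
  have := nrm_triangle (a - b - k *: c) (k *: d).
  have := nrm_triangleB (a - b) (k *: c); have := nrm_triangleB a b.
  rewrite !nrmZ k1 !mul1r; move: h1 h2 h3 h4; rewrite -/a -/b -/c -/d; lra.
have [x0|x0] := eqVneq (nrm x) 0.
  by rewrite (nrm_eq0 x0) inner0l !nrm0 mul0r mulr0.
have [y0|y0] := eqVneq (nrm y) 0.
  by rewrite (nrm_eq0 y0) inner0r !nrm0 !mulr0.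
have {}x0 : 0 < nrm x by rewrite lt_def x0 nrm_ge0.
have {}y0 : 0 < nrm y by rewrite lt_def y0 nrm_ge0.
have := pol ((nrm x)^-1%:C *: x) ((nrm y)^-1%:C *: y).
rewrite innerZl innerZr conj_real !nrmZr ?invr_ge0 ?nrm_ge0//.
rewrite !mulVf ?gt_eqF// => h.
have -> : nrm ⟨x, y⟩ = ((nrm x)^-1 * ((nrm y)^-1 * nrm ⟨x, y⟩)) * (nrm x * nrm y).
  by field; rewrite !gt_eqF.
rewrite ler_wpM2r ?mulr_ge0 ?nrm_ge0//; apply: le_trans h _; lra.
Qed.

Lemma cvg_inner (u v : nat -> E) x y :
  u n @[n --> \oo] --> x -> v n @[n --> \oo] --> y ->
  ⟨u n, v n⟩ @[n --> \oo] --> ⟨x, y⟩.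
Proof.
apply: (@cvg_biadditive _ _ _ _ (@inner R B E) 4) => *; rewrite ?innerBl ?innerBr//.
exact: nrm_inner.
Qed.

(** Expand the inner product of [sqrt e x - (s / sqrt e) y] with itself; [s = -1] gives the bound
    for minus the cross terms. *)
Lemma inner_young (s : C) (e : R) x y : s * Num.conj s = 1 -> 0 < e ->
  s *: ⟨x, y⟩ + Num.conj s *: ⟨y, x⟩ ≼ e%:C *: ⟨x, x⟩ + e^-1%:C *: ⟨y, y⟩.
Proof.
move=> ss e0; rewrite /cle.
pose r := Num.sqrt e; have r0 : 0 < r by rewrite sqrtr_gt0.
have rr : r ^+ 2 = e by rewrite sqr_sqrtr// ltW.
have := inner_pos (r%:C *: x - (r^-1%:C * s) *: y); congr cpositive.
rewrite !(innerBl, innerBr, innerZl, innerZr) rmorphM/= !conj_real.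
have -> : e%:C = r%:C * r%:C by rewrite -rmorphM/= -expr2 rr.
have -> : e^-1%:C = r^-1%:C * r^-1%:C by rewrite -rmorphM/= -invfM -expr2 rr.
rewrite fmorphV/=; have {r0} : r%:C != 0 by rewrite gt_eqF// ltr0c.
move: (r%:C) (Num.conj s) ss => u t ss u0.
have red (a b c : C) : a = b + c * (s * t - 1) -> a = b.
  by rewrite ss subrr mulr0 addr0.
by lmod R; solve [by field|by apply: (red _ _ (u^-1 * u^-1)); field].
Qed.

(* If all [<z, f n>] tend to [0] then sums of [k] suitable terms of [f] have
   norm [O(sqrt k)], so that averages of the [f n] become arbitrarily small
   (Banach-Saks). The predicate [A] keeps track of what is being averaged. *)
Lemma banach_saks (f : nat -> E) (M : R) (N0 : nat) (A : nat -> E -> Prop) :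
  (forall n, nrm (f n) <= M) ->
  (forall z, ⟨z, f n⟩ @[n --> \oo] --> (0 : B)) ->
  A 0%N 0 ->
  (forall k w n, A k w -> (N0 <= n)%N -> A k.+1 (w + f n)) ->
  forall e : R, 0 < e -> exists k w, [/\ (0 < k)%N, A k w & nrm w <= e * k%:R].
Proof.
move=> fM f0 A0 AS e e0.
have hk k : exists2 w, A k w & nrm w ^+ 2 <= k%:R * (M ^+ 2 + 1).
  elim: k => [|k [w Aw hw]]; first by exists 0 => //; rewrite nrm0 mul0r expr0n.
  have h2 : 0 < 1 / 2 :> R by lra.
  (* Both cross terms with the current sum [w] fall below [1/2]; they account for the [1] in
     [M ^+ 2 + 1]. *)
  have /cvg_nrmP/(_ _ h2)[N hN] := f0 w.
  pose n := maxn N N0; exists (w + f n); first exact/AS/leq_maxr.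
  have := hN n (leq_maxl _ _); rewrite subr0 => hn.
  rewrite -nrm_sq !(innerDl, innerDr) -(inner_star w (f n)).
  have M0 : nrm (f n) ^+ 2 <= M ^+ 2.
    by rewrite lerXn2r// nnegrE ?nrm_ge0// (le_trans (nrm_ge0 (f 0%N))).
  apply: le_trans (nrm_triangle _ _) _.
  have := nrm_triangle ⟨w, w⟩ ⟨w, f n⟩; have := nrm_triangle (star ⟨w, f n⟩) ⟨f n, f n⟩.
  by rewrite nrm_star !nrm_sq -natr1; lra.
have [k hke] := natr_unbounded (M ^+ 2 + 1) (exprn_gt0 2 e0).
have k0 : (0 < k)%N.
  by case: k hke => //; rewrite mul0r; have := sqr_ge0 M; lra.
have [w Aw hw] := hk k; exists k, w; split=> //.
rewrite -(ler_pXn2r (n := 2))// ?nnegrE ?nrm_ge0 ?mulr_ge0 ?(ltW e0)//.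
apply: le_trans hw _; rewrite exprMn mulrC expr2 [k%:R ^+ 2]expr2 mulrA.
by rewrite ler_wpM2r// -expr2 mulrC ltW.
Qed.

End HilbertModule.

(** * Self-adjoint regular operators *)

Section ComplexModulus.
Context {R : realType}.
Local Notation C := R[i].

Lemma cabs_sqE (z : C) : cabs z ^+ 2 = complex.Re z ^+ 2 + complex.Im z ^+ 2.
Proof.
by apply: (@complexI R); rewrite [LHS]rmorphXn/= -cabsE add_Re2_Im2.
Qed.

Lemma mul_conj_cabs (z : C) : Num.conj z * z = (cabs z ^+ 2)%:C.
Proof. by rewrite mulrC -normCK cabsE rmorphXn. Qed.

Lemma imaginary_neq0 (l : C) (l0 : R) : 0 < l0 -> l0 <= cabs l -> l != 0.
Proof. by move=> h1 h2; rewrite -cabs_gt0; apply: lt_le_trans h2. Qed.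

Lemma imaginaryN (l : C) : imaginary l -> imaginary (- l).
Proof. by rewrite /imaginary; case: l => a b /= ->; rewrite oppr0. Qed.

End ComplexModulus.

Section Approximation.
Context {R : realType}.
Local Notation C := R[i].

Lemma approx_seq (T : Type) (A : T -> Prop) (g : T -> R) :
  (forall e : R, 0 < e -> exists2 a, A a & g a < e) ->
  exists2 u : nat -> T, (forall n, A (u n)) & forall n, g (u n) < n.+1%:R^-1.
Proof.
move=> h; have {}h n : exists a, A a /\ g a < n.+1%:R^-1.
  by have [|a Aa ga] := h n.+1%:R^-1; [rewrite invr_gt0|exists a].
by have [u hu] := choice h; exists u => n; case: (hu n).
Qed.

Lemma cvg_harmonic_le (V : normedModType C) (u : nat -> V) (l : V) :
  (forall n, nrm (u n - l) < n.+1%:R^-1) -> u n @[n --> \oo] --> l.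
Proof.
move=> ul; apply: (@cvg_nrm_squeeze _ _ _ _ (fun n => n.+1%:R^-1)) => [n|].
  exact: ltW.
exact: cvg_harmonic.
Qed.

Lemma denseP (V : normedModType C) (A : set V) :
  dense A <-> forall x (e : R), 0 < e -> exists2 a, A a & nrm (a - x) < e.
Proof.
split=> [dA x e e0|h O [x Ox] Oopen].
  have [||a [/= + Aa]] := dA (ball x e%:C).
  - by exists x; apply: ballxx; rewrite ltr0c.
  - by apply: ball_open; rewrite ltr0c.
  - by rewrite -ball_normE /ball_ /= nrmE ltcR nrmB => ?; exists a.
have /nbhs_ballP [e /= e0 he] : nbhs x O by apply: open_nbhs_nbhs.
have eE : e = (complex.Re e)%:C by rewrite RRe_real// gtr0_real.
rewrite eE ltr0c in e0; have [a Aa ae] := h x _ e0.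
by exists a; split=> //; apply: he; rewrite -ball_normE /ball_ /= nrmE eE ltcR nrmB.
Qed.

End Approximation.

Section Operators.
Context {R : realType} {B : cstarAlgType R} {E : hilbertModType B}.
Local Notation C := R[i].
Implicit Types (S T : operator E) (x y z : E).

Lemma domD S x y : dom S x -> dom S y -> dom S (x + y).
Proof. by case: (dom_submod S) => _ h _ _; exact: h. Qed.

Lemma domZ S (k : C) x : dom S x -> dom S (k *: x).
Proof. by case: (dom_submod S) => _ _ h _; exact: h. Qed.

Lemma domN S x : dom S x -> dom S (- x).
Proof. by rewrite -scaleN1r; exact: domZ. Qed.

Lemma domB S x y : dom S x -> dom S y -> dom S (x - y).
Proof. by move=> dx dy; apply: domD dx _; exact: domN. Qed.

Lemma opfunN S x : dom S x -> S (- x) = - S x.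
Proof. by move=> dx; rewrite -scaleN1r opfunZ// scaleN1r. Qed.

Lemma opfunB S x y : dom S x -> dom S y -> S (x - y) = S x - S y.
Proof. by move=> dx dy; rewrite opfunD ?opfunN//; exact: domN. Qed.

Definition symmetric_op S : Prop :=
  forall x y, dom S x -> dom S y -> ⟨S x, y⟩ = ⟨x, S y⟩.

Definition closed_op S : Prop := forall (u : nat -> E) x z,
  (forall n, dom S (u n)) -> u n @[n --> \oo] --> x -> S (u n) @[n --> \oo] --> z ->
  dom S x /\ S x = z.

Definition onto_shift S (k : C) : Prop :=
  forall y, exists2 x, dom S x & S x + k *: x = y.

Lemma selfadjoint_symmetric S : selfadjoint S -> symmetric_op S.
Proof.
move=> [_ h] x y dx dy; have /h : dom S y /\ S y = S y by [].
exact.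
Qed.

Lemma selfadjoint_closed S : selfadjoint S -> closed_op S.
Proof.
move=> sS u x z du ux Su; apply: (sS.2 x z).1 => y dy.
apply: (@cvg_nrm_unique _ _ (fun n => ⟨y, S (u n)⟩)).
  under eq_cvg do rewrite -(selfadjoint_symmetric sS dy (du _)).
  by apply: cvg_inner => //; exact: cvg_cst.
by apply: cvg_inner => //; exact: cvg_cst.
Qed.

Lemma shift_sq S l x : symmetric_op S -> imaginary l -> dom S x ->
  ⟨S x + l *: x, S x + l *: x⟩ = ⟨S x, S x⟩ + (cabs l ^+ 2)%:C *: ⟨x, x⟩.
Proof.
move=> sS il dx; rewrite !(innerDl, innerDr, innerZl, innerZr) (sS x x)//.
rewrite -mul_conj_cabs conj_imaginary//.
by lmod R; ring.
Qed.

Lemma shift_sq_bound S l x : symmetric_op S -> imaginary l -> dom S x ->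
  cabs l * nrm x <= nrm (S x + l *: x) /\ nrm (S x) <= nrm (S x + l *: x).
Proof.
move=> sS il dx; have := shift_sq sS il dx.
set y := S x + _ => yE.
have px : cpositive ((cabs l ^+ 2)%:C *: ⟨x, x⟩).
  by apply: cpositiveZ; [exact: sqr_ge0|exact: inner_pos].
split; rewrite -(ler_pXn2r (n := 2))// ?nnegrE ?mulr_ge0 ?nrm_ge0 ?cabs_ge0//.
  rewrite exprMn -!nrm_sq -nrmZr ?sqr_ge0//; apply: cle_nrm => //.
  by rewrite /cle yE addrK; exact: inner_pos.
rewrite -!nrm_sq; apply: cle_nrm; first exact: inner_pos.
by rewrite /cle yE addrC addKr.
Qed.

(** The real part of [k] is absorbed into [S], which stays symmetric. *)
Lemma shift_bound S (k : C) x : symmetric_op S -> dom S x ->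
  `|complex.Im k| * nrm x <= nrm (S x + k *: x).
Proof.
move=> sS dx; pose S' := op_shift S (complex.Re k)%:C.
have sS' : symmetric_op S'.
  by move=> y z dy dz; rewrite /S' /= innerDl innerDr innerZl innerZr conj_real sS.
have il : imaginary (0 +i* complex.Im k) by [].
have [+ _] := shift_sq_bound sS' il dx.
rewrite /S' /= -addrA -scalerDl.
have -> : (complex.Re k)%:C + (0 +i* complex.Im k) = k.
  by case: (k) => a b; apply/eqP; rewrite eq_complex /= addr0 add0r !eqxx.
have -> // : cabs (0 +i* complex.Im k) = `|complex.Im k|.
by rewrite /cabs normc_def /= expr0n add0r sqrtr_sqr.
Qed.

Lemma onto_shift_dense S (k : C) : symmetric_op S -> closed_op S ->
  complex.Im k != 0 -> dense [set S x + k *: x | x in dom S] -> onto_shift S k.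
Proof.
move=> sS cS k0 /denseP dS y; have {}k0 : 0 < `|complex.Im k| by rewrite normr_gt0.
have [|u du uy] := @approx_seq _ E (dom S) (fun x => nrm (S x + k *: x - y)).
  by move=> e e0; have [_ [x dx <-] xy] := dS y e e0; exists x.
have {}uy := cvg_harmonic_le uy.
have /cauchys_cvg [x ux] : cauchys u.
  apply: (cauchys_le (v := fun n => S (u n) + k *: u n)
    (w := fun n => S (u n) + k *: u n) (c := `|complex.Im k|^-1));
    rewrite ?invr_ge0//; try exact: cvg_cauchys uy.
  move=> n m; rewrite ler_pdivlMl//.
  have := shift_bound k sS (domB (du n) (du m)); rewrite opfunB//.
  have -> : S (u n) - S (u m) + k *: (u n - u m)
     = S (u n) + k *: u n - (S (u m) + k *: u m) by lmod R; ring.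
  by move=> /le_trans; apply; rewrite lerDl nrm_ge0.
have Su : S (u n) @[n --> \oo] --> y - k *: x.
  have -> : (fun n => S (u n)) = (fun n => S (u n) + k *: u n - k *: u n).
    by apply/funext => n; rewrite addrK.
  by apply: cvgB => //; exact: cvgZl_tmp.
by have [dx SE] := cS _ _ _ du ux Su; exists x => //; rewrite SE subrK.
Qed.

(** The Neumann series of the resolvent as a fixed point: [|Im k|^-1] bounds [(S + k)^-1], so
    [x |-> (S + k)^-1 (y - (l - k) x)] is a contraction. *)
Lemma onto_shift_near S (k l : C) : symmetric_op S -> onto_shift S k ->
  cabs (l - k) < `|complex.Im k| -> onto_shift S l.
Proof.
move=> sS ok lk y.
have k0 : 0 < `|complex.Im k| by apply: le_lt_trans lk; exact: cabs_ge0.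
have [g hg] := choice (fun y => let: ex_intro2 x h1 h2 := ok y in
  ex_intro (fun x => dom S x /\ S x + k *: x = y) x (conj h1 h2)).
have gB a b : `|complex.Im k| * nrm (g a - g b) <= nrm (a - b).
  have [[da ga] [db gb]] := (hg a, hg b).
  have := shift_bound k sS (domB da db); congr (_ <= nrm _).
  by rewrite opfunB// -[in RHS]ga -[in RHS]gb; lmod R; ring.
have [|x' x''|x fx] := @contraction_fixpoint _ E
    (fun x => g (y - (l - k) *: x)) (cabs (l - k) / `|complex.Im k|).
- by rewrite divr_ge0 ?cabs_ge0//= ltr_pdivrMr// mul1r.
- rewrite mulrAC ler_pdivlMr// mulrC; apply: le_trans (gB _ _) _.
  rewrite -nrmZ -nrmN le_eqVlt; apply/orP; left; apply/eqP; congr nrm.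
  by lmod R; ring.
have [] := hg (y - (l - k) *: x); rewrite fx => dx Sx; exists x => //.
have -> : S x + l *: x = S x + k *: x + (l - k) *: x by lmod R; ring.
by rewrite Sx subrK.
Qed.

(* From [a + 'i b] one first moves up the vertical line, by a factor [3 / 2] in
   each step, until the disc of radius [|Im k|] around [k] contains ['i t]. *)
Lemma onto_shift_imaginary S (a b t : R) : symmetric_op S -> 0 < t * b ->
  onto_shift S (a +i* b) -> onto_shift S (0 +i* t).
Proof.
move=> sS tb ob.
have b0 : b != 0 by apply: contraTneq tb => ->; rewrite mulr0 ltxx.
pose N n := b * (1 + 1 / 2) ^+ n.
have N0 n : 0 < `|N n|.
  by rewrite normr_gt0 mulf_neq0// expf_neq0//; apply/eqP; lra.
have {ob} oN n : onto_shift S (a +i* N n).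
  elim: n => [|n IH]; first by rewrite /N expr0 mulr1.
  apply: onto_shift_near IH _ => //; rewrite [complex.Im _]/=.
  have -> : (a +i* N n.+1) - (a +i* N n) = 0 +i* (N n / 2).
    apply/eqP; rewrite eq_complex /= subrr eqxx /= /N exprS.
    by apply/eqP; field.
  rewrite -(ltr_pXn2r (n := 2))// ?nnegrE ?cabs_ge0// cabs_sqE /= expr0n add0r.
  by rewrite -normrX (ger0_norm (sqr_ge0 _)); have := exprn_gt0 2 (N0 n);
    rewrite -normrX (ger0_norm (sqr_ge0 _)); nra.
(* The disc around [a + i N] of radius [|N|] contains [i t] exactly when [a^2 + t^2 < 2 t N];
   Bernoulli's inequality yields such an [n]. *)
have half : 0 < 1 / 2 * (2 * (t * b)) by lra.
have [n hn] := natr_unbounded (a ^+ 2 + t ^+ 2) half.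
apply: onto_shift_near (oN n) _ => //; rewrite [complex.Im _]/=.
rewrite -(ltr_pXn2r (n := 2))// ?nnegrE ?cabs_ge0// cabs_sqE /=.
rewrite -normrX (ger0_norm (sqr_ge0 _)) sub0r sqrrN.
have h2 : 0 <= 1 / 2 :> R by lra.
have := bernoulli n h2; rewrite -(ler_pM2l tb).
have -> : t * b * (1 + 1 / 2) ^+ n = t * N n by rewrite /N mulrA.
by nra.
Qed.

Lemma regular_onto_shift S (l : C) : selfadjoint S -> regular S ->
  imaginary l -> l != 0 -> onto_shift S l.
Proof.
move=> sS [k [k0 d1 d2]] il l0.
have sym := selfadjoint_symmetric sS; have cl := selfadjoint_closed sS.
have {d1} := onto_shift_dense sym cl k0 d1.
have {d2} : onto_shift S (- k).
  apply: onto_shift_dense => //; first by case: (k) k0 => ? ?; rewrite /= oppr_eq0.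
  by move: d2; congr dense; apply: eq_imagel => x _; rewrite scaleNr.
rewrite /imaginary in il; case: k k0 l il l0 => a b /= b0 [? t] /= -> t0; rewrite eq_complex eqxx /= in t0.
(* The point [i t] is reached from whichever of [k] and [- k] lies in the same half-plane. *)
have [tb|tb|/eqP] := ltgtP 0 (t * b); last first.
- by rewrite eq_sym mulf_eq0 (negbTE t0) (negbTE b0).
- move=> + _; apply: (@onto_shift_imaginary S (- a) (- b)) => //.
  by rewrite mulrN oppr_gt0.
- by move=> _; apply: onto_shift_imaginary.
Qed.

Lemma graph_normE S x :
  graph_norm S x = (Num.sqrt (nrm (⟨x, x⟩ + ⟨S x, S x⟩)))%:C.
Proof.
rewrite /graph_norm nrmE -[in LHS](sqr_sqrtr (nrm_ge0 (⟨x, x⟩ + ⟨S x, S x⟩))).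
by rewrite rmorphXn/= sqrCK// ler0c sqrtr_ge0.
Qed.

Lemma graph_norm_ge S x (e : R) : graph_norm S x < e%:C -> nrm x < e /\ nrm (S x) < e.
Proof.
rewrite graph_normE ltcR => h.
have e0 : 0 < e by apply: le_lt_trans h; exact: sqrtr_ge0.
have h2 y : nrm ⟨y, y⟩ <= nrm (⟨x, x⟩ + ⟨S x, S x⟩) -> nrm y < e.
  rewrite nrm_sq => ?; apply: le_lt_trans h.
  by rewrite -[leLHS]ger0_norm ?nrm_ge0// -sqrtr_sqr ler_sqrt// ?nrm_ge0.
split; apply: h2; apply: cle_nrm; rewrite ?/cle; try exact: inner_pos.
  by rewrite addrC addKr; exact: inner_pos.
by rewrite addrK; exact: inner_pos.
Qed.

Lemma graph_norm_le S x (e : R) :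
  nrm x < e / 2 -> nrm (S x) < e / 2 -> graph_norm S x < e%:C.
Proof.
rewrite graph_normE ltcR => h1 h2; have := nrm_ge0 x; have := nrm_ge0 (S x) => h3 h4.
have e0 : 0 < e by lra.
rewrite -[ltRHS]gtr0_norm// -sqrtr_sqr ltr_sqrt ?exprn_gt0//.
by have := nrm_triangle ⟨x, x⟩ ⟨S x, S x⟩; rewrite !nrm_sq; nra.
Qed.

End Operators.

(** * The anticommutator estimate *)

Section Resolvent.
Context {R : realType} {B : cstarAlgType R} {E : hilbertModType B}.
Local Notation C := R[i].
Variable S : operator E.
Hypothesis symS : symmetric_op S.
Hypothesis ontoS : forall l : C, imaginary l -> l != 0 -> onto_shift S l.
Local Notation res l y := (op_inv (op_shift S l) y).

Lemma resP (l : C) y : imaginary l -> l != 0 ->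
  dom S (res l y) /\ S (res l y) + l *: res l y = y.
Proof.
move=> il l0; have [x dx xy] := ontoS il l0 y.
by apply: (@xgetI _ 0 [set x | dom S x /\ S x + l *: x = y] x).
Qed.

Lemma res_unique (l : C) x y : imaginary l -> l != 0 -> dom S x ->
  S x + l *: x = y -> res l y = x.
Proof.
move=> il l0 dx xy; have [dr ry] := resP y il l0.
apply/eqP; rewrite -subr_eq0; apply/eqP/nrm_le0.
have [+ _] := shift_sq_bound symS il (domB dr dx).
have -> : S (res l y - x) + l *: (res l y - x) = 0.
  rewrite opfunB//; apply: (@etrans _ _ ((S (res l y) + l *: res l y)
    - (S x + l *: x))); first by lmod R; ring.
  by rewrite ry xy subrr.
by rewrite nrm0 pmulr_rle0// cabs_gt0.
Qed.

Lemma resK (l : C) x : imaginary l -> l != 0 -> dom S x ->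
  res l (S x + l *: x) = x.
Proof. by move=> il l0 dx; apply: res_unique. Qed.

Lemma resB (l : C) x y : imaginary l -> l != 0 ->
  res l (x - y) = res l x - res l y.
Proof.
move=> il l0; have [[dx rx] [dy ry]] := (resP x il l0, resP y il l0).
apply: res_unique => //; first exact: domB.
by rewrite opfunB// -[in RHS]rx -[in RHS]ry; lmod R; ring.
Qed.

Lemma res_scale (l k : C) x : imaginary l -> l != 0 ->
  res l (k *: x) = k *: res l x.
Proof.
move=> il l0; have [dx rx] := resP x il l0.
apply: res_unique => //; first exact: domZ.
by rewrite opfunZ// -[in RHS]rx; lmod R; ring.
Qed.

Lemma res_bound (l : C) y : imaginary l -> l != 0 ->
  cabs l * nrm (res l y) <= nrm y /\ nrm (S (res l y)) <= nrm y.
Proof.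
move=> il l0; have [dr ry] := resP y il l0.
by have := shift_sq_bound symS il dr; rewrite ry.
Qed.

Lemma res_op (l : C) x : imaginary l -> l != 0 -> dom S x ->
  dom S (S (res l x)) /\ S (res l x) = res l (S x).
Proof.
move=> il l0 dx; have [dr rx] := resP x il l0.
have SrE : S (res l x) = x - l *: res l x by apply/eqP; rewrite -subr_eq0 opprB addrA rx subrr.
have dSr : dom S (S (res l x)) by rewrite SrE; apply: domB => //; exact: domZ.
split=> //; apply/esym/res_unique => //.
rewrite -[in RHS]rx opfunD ?opfunZ//; exact: domZ.
Qed.

Hypothesis denseS : dense (dom S).

(** On [dom S] the operator [S (S + l)^-1] equals [(S + l)^-1 S], of size [1/|l|]. Since it never
    increases norms, density of [dom S] does the rest. *)
Lemma cvg_op_res (l : nat -> C) x : (forall k, imaginary (l k)) ->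
  (forall k, k.+1%:R <= cabs (l k)) -> S (res (l k) x) @[k --> \oo] --> (0 : E).
Proof.
move=> il hl; have l0 k : l k != 0 by apply: imaginary_neq0 (hl k).
apply/cvg_nrmP => e e0; have e2 : 0 < e / 2 by lra.
have [y dy xy] := (denseP _).1 denseS x _ e2.
have [N hN] := natr_unbounded (nrm (S y)) e2.
exists N => k Nk; rewrite subr0.
have [_ rx] := res_bound (y - x) (il k) (l0 k).
have [dr _] := resP x (il k) (l0 k); have [dr' _] := resP y (il k) (l0 k).
have [_ SrE] := res_op (il k) (l0 k) dy.
have [ry _] := res_bound (S y) (il k) (l0 k).
move: rx; rewrite resB// opfunB// SrE nrmB => rx.
have := nrm_triangle (S (res (l k) x) - res (l k) (S y)) (res (l k) (S y)).
rewrite subrK; suff : nrm (res (l k) (S y)) < e / 2 by lra.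
have kN : N%:R <= cabs (l k).
  by apply: le_trans (hl k); rewrite ler_nat (leq_trans Nk).
have kp : 0 < cabs (l k) by rewrite cabs_gt0.
rewrite -(ltr_pM2l kp); apply: le_lt_trans ry _; apply: lt_le_trans hN _.
by rewrite ler_pM2r.
Qed.

Lemma cvg_res (l : nat -> C) x : (forall k, imaginary (l k)) ->
  (forall k, k.+1%:R <= cabs (l k)) -> l k *: res (l k) x @[k --> \oo] --> x.
Proof.
move=> il hl; have l0 k : l k != 0 by apply: imaginary_neq0 (hl k).
have -> : (fun k => l k *: res (l k) x) = (fun k => x - S (res (l k) x)).
  by apply/funext => k; have [_ rx] := resP x (il k) (l0 k); rewrite -{2}rx addrC addKr.
rewrite -[X in _ --> X]subr0; apply: cvgB; first exact: cvg_cst.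
exact: cvg_op_res.
Qed.

End Resolvent.

Section Anticommutator.
Context {R : realType} {B : cstarAlgType R} {E : hilbertModType B}.
Local Notation C := R[i].

Lemma FdomC (S T : operator E) x : Fdom S T x -> Fdom T S x.
Proof. by case. Qed.

Lemma anticommC (S T : operator E) x : anticomm S T x = anticomm T S x.
Proof. exact: addrC. Qed.

Lemma Fdom0 (S T : operator E) : Fdom S T 0.
Proof. by case: (Fdom_submod S T). Qed.

Lemma FdomD (S T : operator E) x y : Fdom S T x -> Fdom S T y -> Fdom S T (x + y).
Proof. by case: (Fdom_submod S T) => _ + _ _; exact. Qed.

Lemma FdomZ (S T : operator E) (k : C) x : Fdom S T x -> Fdom S T (k *: x).
Proof. by case: (Fdom_submod S T) => _ _ + _; exact. Qed.

Lemma FdomB (S T : operator E) x y : Fdom S T x -> Fdom S T y -> Fdom S T (x - y).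
Proof. by move=> Fx Fy; apply: FdomD => //; rewrite -scaleN1r; exact: FdomZ. Qed.

Section Closure.
Variables (S T : operator E) (c : R).
Hypothesis symS : symmetric_op S.
Hypothesis closedS : closed_op S.
Hypothesis closedT : closed_op T.
Hypothesis c_ge0 : 0 <= c.
Hypothesis anti_le : forall x, Fdom S T x ->
  nrm (anticomm S T x) <= c * (nrm x + nrm (S x) + nrm (T x)).

(** Moving [T] past [S + l] turns it into [S - l] up to the anticommutator. This is why resolvents
    at [l] and [- l] always occur in pairs. *)
Lemma op_anticomm_shift (l : C) x : Fdom S T x ->
  S (T x) + (- l) *: T x = anticomm S T x - T (S x + l *: x).
Proof.
move=> [dS dT dTS dST]; rewrite opfunD ?opfunZ//; last exact: domZ.
by rewrite /anticomm; lmod R; ring.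
Qed.

(** The resolvent estimate is applied to [x] at [l] and to [T x] at [- l]. The term [c |T x|] from
    the anticommutator is absorbed because [c <= |l| / 4]. *)
Lemma Fdom_bound (l : C) x : imaginary l -> 4 * c + 1 <= cabs l -> Fdom S T x ->
  let y := S x + l *: x in
  [/\ nrm x <= nrm y, nrm (S x) <= nrm y,
      cabs l * nrm (T x) <= 2 * (1 + 2 * c) * (nrm y + nrm (T y)) &
      nrm (S (T x)) <= 2 * (1 + 2 * c) * (nrm y + nrm (T y))].
Proof.
move=> il lc Fx y; have [dS dT dTS dST] := Fx.
have [h1 h2] := shift_sq_bound symS il dS.
have [] := shift_sq_bound symS (imaginaryN il) dST.
rewrite op_anticomm_shift// cabsN -/y => h3 h4.
have := nrm_triangleB (anticomm S T x) (T y).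
have := anti_le Fx; rewrite -/y in h1 h2.
have := nrm_ge0 x; have := nrm_ge0 (S x); have := nrm_ge0 (T x).
have := nrm_ge0 (T y); have := nrm_ge0 y.
move: h1 h2 h3 h4; set L := cabs l in lc *.
set nx := nrm x; set nS := nrm (S x); set nT := nrm (T x); set ny := nrm y.
set nTy := nrm (T y); set a := nrm (anticomm S T x); set d := nrm (_ - _).
set e := nrm (S (T x)) => h1 h2 h3 h4 p1 p2 p3 p4 p5 h6 h7.
have L1 : 1 <= L by move: lc c_ge0; lra.
have hx : nx <= ny by apply: le_trans h1; rewrite ler_peMl.
have hc : c * nT <= 1 / 4 * (L * nT).
  by rewrite mulrA ler_wpM2r//; move: lc c_ge0; lra.
have hS : c * (nx + nS) <= c * (2 * ny) by rewrite ler_wpM2l//; lra.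
have p6 : 0 <= c * nTy by rewrite mulr_ge0.
have p7 : 0 <= c * ny by rewrite mulr_ge0.
have hT : L * nT <= 2 * (1 + 2 * c) * (ny + nTy).
  by lra.
by split=> //; lra.
Qed.

(** By [Fdom_bound] on differences, [u], [S u], [T u] and [S T u] are all Cauchy, and [T S u]
    converges by subtraction. So the image of [F] under [S + l] is closed in the graph norm of
    [T]. *)
Lemma Fdom_closure (l : C) (u : nat -> E) (y z : E) :
  imaginary l -> 4 * c + 1 <= cabs l -> (forall n, Fdom S T (u n)) ->
  S (u n) + l *: u n @[n --> \oo] --> y ->
  T (S (u n) + l *: u n) @[n --> \oo] --> z ->
  exists2 x, Fdom S T x & S x + l *: x = y.
Proof.
move=> il lc Fu cy cz; have c0 := c_ge0; pose K := 2 * (1 + 2 * c); have K0 : 0 <= K by rewrite /K; lra.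
have K1 : 1 <= K by rewrite /K; lra.
have L1 : 1 <= cabs l by lra.
pose v n := S (u n) + l *: u n.
have dS n : dom S (u n) by case: (Fu n).
have dT n : dom T (u n) by case: (Fu n).
have dTS n : dom T (S (u n)) by case: (Fu n).
have dST n : dom S (T (u n)) by case: (Fu n).
have dTv n : dom T (v n) by apply: domD => //; exact: domZ.
have hb n m : let r := K * (nrm (v n - v m) + nrm (T (v n) - T (v m))) in
    [/\ nrm (u n - u m) <= r, nrm (S (u n) - S (u m)) <= r,
        nrm (T (u n) - T (u m)) <= r & nrm (S (T (u n)) - S (T (u m))) <= r].
  have [] := Fdom_bound il lc (FdomB (Fu n) (Fu m)).
  have -> : S (u n - u m) + l *: (u n - u m) = v n - v m.
    by rewrite opfunB// /v; lmod R; ring.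
  rewrite !opfunB// -/K; move: (nrm_ge0 (v n - v m)) (nrm_ge0 (T (v n) - T (v m))).
  move: (nrm_ge0 (T (u n) - T (u m))).
  set a := nrm (v n - _); set b := nrm (T (v n) - _) => t0 a0 b0 h1 h2 h3 h4.
  have ab : a <= K * (a + b) by nra.
  by split; [lra|lra|apply: le_trans h3; nra|].
have [cv cTv] : cauchys v /\ cauchys (fun n => T (v n)).
  by split; [exact: cvg_cauchys cy|exact: cvg_cauchys cz].
have [|x cx] := @cauchys_cvg _ _ u.
  by apply: cauchys_le K0 cv cTv _ => n m; case: (hb n m).
have [|x1 cx1] := @cauchys_cvg _ _ (fun n => S (u n)).
  by apply: cauchys_le K0 cv cTv _ => n m; case: (hb n m).
have [|x2 cx2] := @cauchys_cvg _ _ (fun n => T (u n)).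
  by apply: cauchys_le K0 cv cTv _ => n m; case: (hb n m).
have [|x3 cx3] := @cauchys_cvg _ _ (fun n => S (T (u n))).
  by apply: cauchys_le K0 cv cTv _ => n m; case: (hb n m).
have [dSx Sx] := closedS dS cx cx1; have [dTx Tx] := closedT dT cx cx2.
have [dSTx _] := closedS dST cx2 cx3.
have cTS : T (S (u n)) @[n --> \oo] --> z - l *: x2.
  have -> : (fun n => T (S (u n))) = (fun n => T (v n) - l *: T (u n)).
    apply/funext => n; rewrite /v opfunD ?opfunZ ?addrK//; exact: domZ.
  by apply: cvgB => //; exact: cvgZl_tmp.
have [dTSx _] := closedT dTS cx1 cTS.
exists x; first by split; rewrite ?Sx ?Tx.
rewrite Sx; apply: cvg_nrm_unique cy; apply: cvgD => //; exact: cvgZl_tmp.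
Qed.

End Closure.
End Anticommutator.

(** * Approximation by Yosida regularization *)

Section Yosida.
Context {R : realType} {B : cstarAlgType R} {E : hilbertModType B}.
Local Notation C := R[i].
Variables (S T : operator E) (c l0 : R).
Hypothesis symS : symmetric_op S.
Hypothesis ontoS : forall l : C, imaginary l -> l != 0 -> onto_shift S l.
Hypothesis denseS : dense (dom S).
Hypothesis c_ge0 : 0 <= c.
Hypothesis anti_le : forall x, Fdom S T x ->
  nrm (anticomm S T x) <= c * (nrm x + nrm (S x) + nrm (T x)).
Hypothesis l0_ge : 4 * c + 1 <= l0.
Local Notation res l y := (op_inv (op_shift S l) y).
Hypothesis Fdom_res : forall (l : C) y, imaginary l -> l0 <= cabs l ->
  dom T y -> Fdom S T (res l y).

Section Sequence.
Variable l : nat -> C.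
Hypothesis iml : forall k, imaginary (l k).
Hypothesis lge : forall k, l0 + k.+1%:R <= cabs (l k).

Local Lemma yosida_base_gt0 : 0 < l0.
Proof. by move: l0_ge c_ge0; lra. Qed.

Local Lemma yosida_cabs_ge1 k : k.+1%:R <= cabs (l k).
Proof. by have := lge k; have := yosida_base_gt0; lra. Qed.

Local Lemma yosida_cabs_ge_base k : l0 <= cabs (l k).
Proof. by have := lge k; have := ler0n R k.+1; lra. Qed.

Local Lemma yosida_neq0 k : l k != 0.
Proof. exact: imaginary_neq0 yosida_base_gt0 (yosida_cabs_ge_base k). Qed.

Lemma Fdom_yosida k x : dom T x -> Fdom S T (l k *: res (l k) x).
Proof. by move=> dx; apply/FdomZ/Fdom_res => //; exact: yosida_cabs_ge_base. Qed.

Lemma cvg_yosida x : l k *: res (l k) x @[k --> \oo] --> x.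
Proof. by apply: cvg_res => //; exact: yosida_cabs_ge1. Qed.

Lemma cvg_op_yosida x : dom S x -> S (l k *: res (l k) x) @[k --> \oo] --> S x.
Proof.
move=> dx; have -> : (fun k => S (l k *: res (l k) x)) =
    (fun k => l k *: res (l k) (S x)).
  apply/funext => k; have [dr _] := resP ontoS x (iml k) (yosida_neq0 k).
  by rewrite opfunZ// (res_op symS ontoS (iml k) (yosida_neq0 k) dx).2.
exact: cvg_yosida.
Qed.

(** With [J = l (S + l)^-1] and its adjoint [J^* = - l (S - l)^-1] this reads
    [T J x = J^* (T x - W)], where [W] is the anticommutator at [(S + l)^-1 x]. *)
Lemma op_res_anticomm k x : dom T x ->
  l k *: T (res (l k) x) =
  - l k *: res (- l k) (T x - anticomm S T (res (l k) x)).
Proof.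
move=> dx; have Fr := Fdom_res (iml k) (yosida_cabs_ge_base k) dx.
have [_ rx] := resP ontoS x (iml k) (yosida_neq0 k).
have iN := imaginaryN (iml k); have N0 : - l k != 0 by rewrite oppr_eq0 yosida_neq0.
have : res (- l k) (anticomm S T (res (l k) x) - T x) = T (res (l k) x).
  apply: (res_unique symS ontoS) => //; first by case: Fr.
  by rewrite (op_anticomm_shift (l k) Fr) rx.
by move=> <-; rewrite !(resB symS ontoS)//; lmod R; ring.
Qed.

Lemma cvg_anticomm_res x : dom T x ->
  anticomm S T (res (l k) x) @[k --> \oo] --> (0 : E).
Proof.
move=> dx; pose M := 2 * (1 + 2 * c) * (nrm x + nrm (T x)).
apply: (@cvg_nrm_squeeze _ _ _ _ (fun k => c * (nrm x * k.+1%:R^-1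
  + nrm (S (res (l k) x) - 0) + M * k.+1%:R^-1))) => [k|].
  rewrite !subr0; have Fr := Fdom_res (iml k) (yosida_cabs_ge_base k) dx.
  apply: le_trans (anti_le Fr) _; rewrite ler_wpM2l//.
  have lk : 4 * c + 1 <= cabs (l k) by apply: le_trans l0_ge (yosida_cabs_ge_base k).
  have [_ _ hT _] := Fdom_bound symS c_ge0 anti_le (iml k) lk Fr.
  have [_ rx] := resP ontoS x (iml k) (yosida_neq0 k).
  have [hx _] := res_bound symS ontoS x (iml k) (yosida_neq0 k).
  move: hT; rewrite /= rx -/M => hT.
  rewrite !lerD// ler_pdivlMr// mulrC; [apply: le_trans hx|apply: le_trans hT];
    by rewrite ler_wpM2r ?nrm_ge0// yosida_cabs_ge1.
rewrite -[X in _ --> X](mulr0 c); apply: cvgMr.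
rewrite -[X in _ --> X]addr0; apply: cvgD; last first.
  by rewrite -[X in _ --> X](mulr0 M); apply: cvgMr; exact: cvg_harmonic.
rewrite -[X in _ --> X]addr0; apply: cvgD; last first.
  by apply: cvg_nrmB; apply: cvg_op_res => //; exact: yosida_cabs_ge1.
by rewrite -[X in _ --> X](mulr0 (nrm x)); apply: cvgMr; exact: cvg_harmonic.
Qed.

Lemma cvg_T_yosida x : dom T x -> T (l k *: res (l k) x) @[k --> \oo] --> T x.
Proof.
move=> dx; have iN k : imaginary (- l k) by exact/imaginaryN/iml.
have N0 k : - l k != 0 by rewrite oppr_eq0 yosida_neq0.
have -> : (fun k => T (l k *: res (l k) x)) = (fun k =>
    - l k *: res (- l k) (T x)
    - - l k *: res (- l k) (anticomm S T (res (l k) x))).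
  apply/funext => k; have [_ dTr _ _] := Fdom_res (iml k) (yosida_cabs_ge_base k) dx.
  by rewrite opfunZ// op_res_anticomm// (resB symS ontoS)// scalerBr.
rewrite -[X in _ --> X]subr0; apply: cvgB.
  by apply: cvg_res => // k; rewrite cabsN yosida_cabs_ge1.
apply: cvg_nrm_squeeze (cvg_nrmB (cvg_anticomm_res dx)) => k; rewrite !subr0.
by rewrite nrmZ; have [] := res_bound symS ontoS (anticomm S T (res (l k) x)) (iN k) (N0 k).
Qed.

End Sequence.

(** The offset [l0] makes [Fdom_res] applicable from the first term on. *)
Definition yosida_seq (k : nat) : C := 0 +i* (l0 + k.+1%:R).

Lemma yosida_seq_imaginary k : imaginary (yosida_seq k).
Proof. by []. Qed.

Lemma yosida_seq_ge k : l0 + k.+1%:R <= cabs (yosida_seq k).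
Proof.
rewrite /cabs normc_def /= expr0n add0r sqrtr_sqr; exact: ler_norm.
Qed.

Lemma Fdom_approx x : dom T x -> exists u : nat -> E,
  [/\ forall k, Fdom S T (u k), u k @[k --> \oo] --> x,
      T (u k) @[k --> \oo] --> T x &
      dom S x -> S (u k) @[k --> \oo] --> S x].
Proof.
move=> dx; exists (fun k => yosida_seq k *: res (yosida_seq k) x); split.
- by move=> k; apply: Fdom_yosida => //; exact: yosida_seq_ge.
- by apply: cvg_yosida => //; exact: yosida_seq_ge.
- by apply: cvg_T_yosida => //; exact: yosida_seq_ge.
- by apply: cvg_op_yosida => //; exact: yosida_seq_ge.
Qed.

Lemma core_of_approx (D : operator E) (A : set E) : is_submodule A ->
  A `<=` dom D ->
  (forall x, dom D x -> exists u : nat -> E, [/\ forall k, A (u k),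
     u k @[k --> \oo] --> x & D (u k) @[k --> \oo] --> D x]) ->
  core A D.
Proof.
move=> sA AD h; split=> // x dx e e0; have [u [Au ux Du]] := h x dx.
have eE : e = (complex.Re e)%:C by rewrite RRe_real// gtr0_real.
rewrite eE ltr0c in e0 *.
have e2 : 0 < complex.Re e / 2 by rewrite divr_gt0.
have /cvg_nrmP/(_ _ e2)[N hN] := ux; have /cvg_nrmP/(_ _ e2)[M hM] := Du.
exists (u (maxn N M)) => //; have dv := AD _ (Au (maxn N M)).
apply: graph_norm_le; rewrite ?opfunB// nrmB; [apply: hN|apply: hM].
  exact: leq_maxl.
exact: leq_maxr.
Qed.

Lemma core_FdomT : core (Fdom S T) T.
Proof.
apply: core_of_approx => [||x /Fdom_approx[u [Fu ux Tu _]]]; last by exists u.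
  exact: Fdom_submod.
by move=> x [].
Qed.

Lemma core_Fdom_add : core (Fdom S T) (op_add S T).
Proof.
apply: core_of_approx => [||x [dSx /Fdom_approx[u [Fu ux Tu /(_ dSx) Su]]]].
- exact: Fdom_submod.
- by move=> x [].
- by exists u; split=> //; exact: cvgD.
Qed.

(** [(S + m)^-1] turns norm approximation of [(S + m) x] into graph norm approximation of [x], and
    it maps [dom T] into [F]; so density of [dom T] suffices. *)
Lemma core_FdomS : dense (dom T) -> core (Fdom S T) S.
Proof.
move=> /denseP dT; apply: core_of_approx => [||x dx].
- exact: Fdom_submod.
- by move=> x [].
have i0 := yosida_seq_imaginary 0; have n0 := yosida_neq0 yosida_seq_ge 0.
pose m := yosida_seq 0; rewrite -/m in i0 n0.
have [|u Tu uy] := @approx_seq _ E (dom T) (fun y => nrm (y - (S x + m *: x))).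
  by move=> e e0; have [y] := dT (S x + m *: x) e e0; exists y.
have xE := resK symS ontoS i0 n0 dx.
have hb k : nrm (res m (u k) - x) <= nrm (u k - (S x + m *: x)) /\
    nrm (S (res m (u k)) - S x) <= nrm (u k - (S x + m *: x)).
  have [dr _] := resP ontoS (u k) i0 n0.
  have := res_bound symS ontoS (u k - (S x + m *: x)) i0 n0.
  rewrite (resB symS ontoS)// xE opfunB// => -[h ->]; split=> //.
  apply: le_trans h; rewrite ler_peMl ?nrm_ge0//.
  by apply: le_trans (yosida_cabs_ge1 yosida_seq_ge 0).
exists (fun k => res m (u k)); split.
- by move=> k; apply: Fdom_res => //; exact: yosida_cabs_ge_base yosida_seq_ge 0%N.
- by apply: cvg_harmonic_le => k; apply: le_lt_trans (hb k).1 (uy k).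
- by apply: cvg_harmonic_le => k; apply: le_lt_trans (hb k).2 (uy k).
Qed.

End Yosida.

(** * Comparison of graph norms on the domain of S + T *)

Section SumEstimates.
Context {R : realType} {B : cstarAlgType R} {E : hilbertModType B}.
Local Notation C := R[i].
Variables (S T : operator E) (K : R).
Hypothesis symS : symmetric_op S.
Hypothesis symT : symmetric_op T.
Hypothesis K_gt0 : 0 < K.
Hypothesis anti_cle : forall x, Fdom S T x ->
  ⟨anticomm S T x, anticomm S T x⟩ ≼ K%:C *: (⟨x, x⟩ + ⟨S x, S x⟩ + ⟨T x, T x⟩).

Lemma sum_sq_Fdom x : Fdom S T x ->
  ⟨S x + T x, S x + T x⟩ = ⟨S x, S x⟩ + ⟨T x, T x⟩
    + (1 / 2)%:C *: (⟨x, anticomm S T x⟩ + ⟨anticomm S T x, x⟩).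
Proof.
move=> [dS dT dTS dST]; rewrite /anticomm !(innerDl, innerDr).
rewrite -(symS dS dST) -(symT dT dTS) (symS dST dS) (symT dTS dT).
by lmod R; field.
Qed.

(** Call the left side [N]. Young's inequality with weight [1/K] bounds the anticommutator terms
    below by [- N - K <x, x>], so twice [sum_sq_Fdom] leaves [N] at the price of
    [(2 + K) <x, x>]. *)
Lemma sum_lower_Fdom x : Fdom S T x ->
  ⟨x, x⟩ + ⟨S x, S x⟩ + ⟨T x, T x⟩
    ≼ (2 + K)%:C *: (⟨x, x⟩ + ⟨S x + T x, S x + T x⟩).
Proof.
move=> Fx; have := sum_sq_Fdom Fx; have := anti_cle Fx; rewrite /cle.
set W := anticomm S T x; set D := ⟨S x + T x, _⟩ => p2 DE.
have K1 : 0 < K^-1 by rewrite invr_gt0.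
have := inner_young W x (s := -1) _ K1.
rewrite rmorphN1 mulrNN mulr1 invrK => /(_ erefl); rewrite /cle => p1.
have -> : (2 + K)%:C *: (⟨x, x⟩ + D) - (⟨x, x⟩ + ⟨S x, S x⟩ + ⟨T x, T x⟩) =
  (K^-1%:C *: ⟨W, W⟩ + K%:C *: ⟨x, x⟩ - (-1 *: ⟨W, x⟩ + -1 *: ⟨x, W⟩))
  + (K^-1%:C *: (K%:C *: (⟨x, x⟩ + ⟨S x, S x⟩ + ⟨T x, T x⟩) - ⟨W, W⟩) + K%:C *: D).
  have K0 : K%:C != 0 by rewrite gt_eqF// ltr0c.
  by rewrite DE fmorphV rmorphD/=; move: K0; move: (K%:C) => k K0; lmod R; field.
apply: cpositiveD => //; apply: cpositiveD; apply: cpositiveZ => //; try exact: ltW.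
exact: inner_pos.
Qed.

(** The parallelogram identity; the constant is that of [sum_lower], so that one constant serves
    both inequalities. *)
Lemma sum_upper x : (2 + K)^-1%:C *: (⟨x, x⟩ + ⟨S x + T x, S x + T x⟩)
  ≼ ⟨x, x⟩ + ⟨S x, S x⟩ + ⟨T x, T x⟩.
Proof.
have K2 : 0 < 2 + K by rewrite addr_gt0.
rewrite /cle; have -> : ⟨x, x⟩ + ⟨S x, S x⟩ + ⟨T x, T x⟩
    - (2 + K)^-1%:C *: (⟨x, x⟩ + ⟨S x + T x, S x + T x⟩)
  = (2 + K)^-1%:C *: ((1 + K)%:C *: ⟨x, x⟩
     + (K%:C *: (⟨S x, S x⟩ + ⟨T x, T x⟩) + ⟨S x - T x, S x - T x⟩)).
  have : (2 + K)%:C != 0 by rewrite gt_eqF// ltr0c.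
  rewrite fmorphV !rmorphD/= !(innerDl, innerDr, innerNl, innerNr).
  by move: (K%:C) => k K0; lmod R; field.
have [h1 h2] : 0 <= 1 + K /\ 0 <= K by move: K_gt0; split; lra.
apply: cpositiveZ; first by rewrite invr_ge0 ltW.
apply: cpositiveD; first by apply: cpositiveZ => //; exact: inner_pos.
apply: cpositiveD; last exact: inner_pos.
by apply: cpositiveZ => //; apply: cpositiveD; exact: inner_pos.
Qed.

Hypothesis approx : forall x, dom S x -> dom T x -> exists u : nat -> E,
  [/\ forall k, Fdom S T (u k), u k @[k --> \oo] --> x,
      T (u k) @[k --> \oo] --> T x & S (u k) @[k --> \oo] --> S x].

Lemma sum_lower x : dom S x -> dom T x ->
  ⟨x, x⟩ + ⟨S x, S x⟩ + ⟨T x, T x⟩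
    ≼ (2 + K)%:C *: (⟨x, x⟩ + ⟨S x + T x, S x + T x⟩).
Proof.
move=> dS dT; have [u [Fu ux Tu Su]] := approx dS dT.
have cD : S (u k) + T (u k) @[k --> \oo] --> S x + T x by exact: cvgD.
apply: (@cpositive_closed _ _ (fun k => (2 + K)%:C *: (⟨u k, u k⟩
     + ⟨S (u k) + T (u k), S (u k) + T (u k)⟩)
     - (⟨u k, u k⟩ + ⟨S (u k), S (u k)⟩ + ⟨T (u k), T (u k)⟩))).
  apply: cvgB; last by do 2?[apply: cvgD]; exact: cvg_inner.
  by apply: cvgZl_tmp; apply: cvgD; exact: cvg_inner.
by move=> k; exact: sum_lower_Fdom (Fu k).
Qed.

Lemma sum_lower_nrm x : dom S x -> dom T x ->
  nrm (S x) <= (2 + K) * (nrm x + nrm (S x + T x)) /\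
  nrm (T x) <= (2 + K) * (nrm x + nrm (S x + T x)).
Proof.
move=> dS dT; have h := sum_lower dS dT.
have K2 : 1 <= 2 + K by move: K_gt0; lra.
have hb (y : E) : ⟨y, y⟩ ≼ ⟨x, x⟩ + ⟨S x, S x⟩ + ⟨T x, T x⟩ ->
    nrm y <= (2 + K) * (nrm x + nrm (S x + T x)).
  move=> yN; have {yN h} : ⟨y, y⟩ ≼ (2 + K)%:C *: (⟨x, x⟩ + ⟨S x + T x, S x + T x⟩).
    rewrite /cle in yN h *; have := cpositiveD h yN; congr cpositive.
    by lmod R; ring.
  move=> /(cle_nrm (inner_pos _)); rewrite nrm_sq nrmZr; last by move: K2; lra.
  have := nrm_triangle ⟨x, x⟩ ⟨S x + T x, S x + T x⟩; rewrite !nrm_sq.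
  have := nrm_ge0 x; have := nrm_ge0 (S x + T x); have := nrm_ge0 y.
  set a := nrm x; set b := nrm (S x + T x); set d := nrm y; set n := nrm (⟨_, _⟩ + _).
  move=> d0 b0 a0 nab h.
  have K2' : 0 <= 2 + K by apply: le_trans K2.
  rewrite -(ler_pXn2r (n := 2))// ?nnegrE ?mulr_ge0 ?(addr_ge0 a0 b0)//.
  apply: le_trans h _; apply: (@le_trans _ _ ((2 + K) * (a + b) ^+ 2)).
    apply: ler_wpM2l => //.
    by have := mulr_ge0 a0 b0; rewrite sqrrD; move: nab; lra.
  by rewrite exprMn ler_wpM2r ?sqr_ge0// expr2 ler_peMl.
split; apply: hb; rewrite /cle.
  have := cpositiveD (inner_pos x) (inner_pos (T x)); congr cpositive.
  by lmod R; ring.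
have := cpositiveD (inner_pos x) (inner_pos (S x)); congr cpositive.
by lmod R; ring.
Qed.

End SumEstimates.

(** * The pencil S + T + TS/l + m *)

Section Pencil.
Context {R : realType} {B : cstarAlgType R} {E : hilbertModType B}.
Local Notation C := R[i].
Variables (S T : operator E) (K l0 : R).
Hypothesis symS : symmetric_op S.
Hypothesis symT : symmetric_op T.
Hypothesis ontoS : forall l : C, imaginary l -> l != 0 -> onto_shift S l.
Hypothesis ontoT : forall l : C, imaginary l -> l != 0 -> onto_shift T l.
Hypothesis K_gt0 : 0 < K.
Hypothesis anti_cle : forall x, Fdom S T x ->
  ⟨anticomm S T x, anticomm S T x⟩ ≼ K%:C *: (⟨x, x⟩ + ⟨S x, S x⟩ + ⟨T x, T x⟩).
Hypothesis l0_ge : 16 * K + 1 <= l0.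
Local Notation res S l y := (op_inv (op_shift S l) y).
Hypothesis Fdom_res : forall (l : C) y, imaginary l -> l0 <= cabs l ->
  dom T y -> Fdom S T (res S l y).

Section FixedParameters.
Variables (l m : C) (t : R).
Hypothesis iml : imaginary l.
Hypothesis l0l : l0 <= cabs l.
Hypothesis l0m : l0 <= cabs m.
Hypothesis t01 : 0 < t < 1.
Hypothesis mE : m = t%:C * l.

Let l_neq0 : l != 0.
Proof. by apply: imaginary_neq0 l0l; move: l0_ge K_gt0; lra. Qed.

Let conjl : Num.conj l = - l.
Proof. exact: conj_imaginary. Qed.

(** Since [l] and [m] are imaginary, [S x] and [T x] against [m x], and [S x] against [l^-1 T S x],
    cancel with their adjoints. The pairing of [l^-1 T S x] with [m x] gives [- t] times that of
    [S x] with [T x], hence [1 - t]. Against [T x], [l^-1 S T x] cancels as well and may be added to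
    complete the anticommutator. *)
Lemma pencil_sq x : Fdom S T x ->
  ⟨op_pencil S T l m x, op_pencil S T l m x⟩ =
  ⟨S x, S x⟩ + ⟨T x, T x⟩ + (cabs m ^+ 2)%:C *: ⟨x, x⟩
  + ⟨l^-1 *: T (S x), l^-1 *: T (S x)⟩
  + ((1 - t) / 2)%:C *: (⟨x, anticomm S T x⟩ + ⟨anticomm S T x, x⟩)
  + (⟨T x, l^-1 *: anticomm S T x⟩ + ⟨l^-1 *: anticomm S T x, T x⟩).
Proof.
move=> [dS dT dTS dST] /=; rewrite /anticomm -mul_conj_cabs mE.
rewrite !(innerDl, innerDr, innerZl, innerZr) !rmorphM !fmorphV/= conjl conj_real.
rewrite (symT dTS dTS) (symS dST dST).
have -> : ⟨x, T (S x)⟩ = ⟨T x, S x⟩ by rewrite symT.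
have -> : ⟨T (S x), x⟩ = ⟨S x, T x⟩ by rewrite symT.
have -> : ⟨x, S (T x)⟩ = ⟨S x, T x⟩ by rewrite symS.
have -> : ⟨S (T x), x⟩ = ⟨T x, S x⟩ by rewrite symS.
have -> : ⟨S x, x⟩ = ⟨x, S x⟩ by rewrite symS.
have -> : ⟨T x, x⟩ = ⟨x, T x⟩ by rewrite symT.
by move: l_neq0 => l1; rewrite !(rmorphB, rmorphM, fmorphV)/=; lmod R; field.
Qed.

Lemma pencil_lower x : Fdom S T x ->
  (1 / 4)%:C *: (⟨x, x⟩ + ⟨S x, S x⟩ + ⟨T x, T x⟩)
  + ⟨l^-1 *: T (S x), l^-1 *: T (S x)⟩
    ≼ ⟨op_pencil S T l m x, op_pencil S T l m x⟩.
Proof.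
move=> Fx; have K0 := K_gt0; have lK := l0_ge.
have := anti_cle Fx; rewrite /cle pencil_sq//.
set W := anticomm S T x; set V := l^-1 *: T (S x) => p3.
have e1 : 0 < 1 / (2 * K) by rewrite divr_gt0// mulr_gt0.
have e2 : 0 < 1 / 4 :> R by lra.
have := inner_young W x (s := -1) _ e1.
rewrite rmorphN1 mulrNN mulr1 => /(_ erefl); rewrite /cle => p1.
have := inner_young (T x) (l^-1 *: W) (s := -1) _ e2.
rewrite rmorphN1 mulrNN mulr1 => /(_ erefl); rewrite /cle => p2.
have lW : ⟨l^-1 *: W, l^-1 *: W⟩ = (cabs l ^- 2)%:C *: ⟨W, W⟩.
  rewrite innerZl innerZr scalerA mul_conj_cabs cabsV; congr (_%:C *: _).
  by rewrite exprVn.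
(* [ka] is the total weight of [<W, W>] from the two uses of Young's inequality. The weights
   [1 / (2 K)] and [1 / 4], with [16 K + 1 <= |l|], keep [ka K] below [1/2], which is what the [S]
   and [T] terms can give away. *)
pose ka := (1 - t) / 2 * (1 / (2 * K)) + 4 * cabs l ^- 2.
have /andP[t0 t1] := t01.
have L1 : 1 <= cabs l by apply: le_trans l0l; lra.
have lK2 : 4 * cabs l ^- 2 * K <= 1 / 4.
  rewrite mulrAC ler_pdivrMr ?exprn_gt0//; last by lra.
  by have := l0l; nra.
have kaE : ka * K = (1 - t) / 4 + 4 * cabs l ^- 2 * K.
  by rewrite /ka; field; rewrite !gt_eqF//; lra.
have ka0 : 0 <= ka.
  by rewrite addr_ge0// ?mulr_ge0 ?invr_ge0 ?sqr_ge0//; lra.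
have -> : ⟨S x, S x⟩ + ⟨T x, T x⟩ + (cabs m ^+ 2)%:C *: ⟨x, x⟩ + ⟨V, V⟩
    + ((1 - t) / 2)%:C *: (⟨x, W⟩ + ⟨W, x⟩)
    + (⟨T x, l^-1 *: W⟩ + ⟨l^-1 *: W, T x⟩)
    - ((1 / 4)%:C *: (⟨x, x⟩ + ⟨S x, S x⟩ + ⟨T x, T x⟩) + ⟨V, V⟩)
  = (3 / 4 - ka * K)%:C *: ⟨S x, S x⟩ + (1 / 2 - ka * K)%:C *: ⟨T x, T x⟩
    + (cabs m ^+ 2 - (1 - t) * K - ka * K - 1 / 4)%:C *: ⟨x, x⟩
    + ((1 - t) / 2)%:C *: ((1 / (2 * K))%:C *: ⟨W, W⟩ + (1 / (2 * K))^-1%:C *: ⟨x, x⟩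
       - (-1 *: ⟨W, x⟩ + -1 *: ⟨x, W⟩))
    + ((1 / 4)%:C *: ⟨T x, T x⟩ + (1 / 4)^-1%:C *: ⟨l^-1 *: W, l^-1 *: W⟩
       - (-1 *: ⟨T x, l^-1 *: W⟩ + -1 *: ⟨l^-1 *: W, T x⟩))
    + ka%:C *: (K%:C *: (⟨x, x⟩ + ⟨S x, S x⟩ + ⟨T x, T x⟩) - ⟨W, W⟩).
  rewrite lW /ka; have KC : K%:C != 0 by rewrite gt_eqF// ltr0c.
  have LC : (cabs l)%:C != 0 by rewrite gt_eqF// ltr0c (lt_le_trans _ L1).
  by lmod R; field; rewrite ?KC ?LC.
have mK : K + 1 <= cabs m ^+ 2 by have := l0m; nra.
apply: cpositiveD; last by apply: cpositiveZ.
apply: cpositiveD => //; apply: cpositiveD; last by apply: cpositiveZ => //; lra.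
do 2?[apply: cpositiveD]; apply: cpositiveZ; try exact: inner_pos; try lra.
by nra.
Qed.

Lemma pencil_bounds x : Fdom S T x -> let y := op_pencil S T l m x in
  [/\ nrm x <= 2 * nrm y, nrm (S x) <= 2 * nrm y, nrm (T x) <= 2 * nrm y &
      nrm (l^-1 *: T (S x)) <= nrm y].
Proof.
move=> Fx y; have := pencil_lower Fx; rewrite -/y /cle.
set V := l^-1 *: T (S x) => p.
have hb (z : E) : cpositive (⟨y, y⟩ - (1 / 4)%:C *: ⟨z, z⟩) -> nrm z <= 2 * nrm y.
  move=> h; have : nrm ((1 / 4)%:C *: ⟨z, z⟩) <= nrm ⟨y, y⟩.
    by apply: cle_nrm => //; apply: cpositiveZ; [lra|exact: inner_pos].
  rewrite nrmZr; last by lra.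
  rewrite !nrm_sq; have := nrm_ge0 y; have := nrm_ge0 z; nra.
have q4 (z : E) : cpositive ((1 / 4)%:C *: ⟨z, z⟩).
  by apply: cpositiveZ; [lra|exact: inner_pos].
have [[px pS] [pT pV]] := ((q4 x, q4 (S x)), (q4 (T x), inner_pos V)).
split; try apply: hb.
- have := cpositiveD p (cpositiveD pS (cpositiveD pT pV)).
  by congr cpositive; lmod R; ring.
- have := cpositiveD p (cpositiveD px (cpositiveD pT pV)).
  by congr cpositive; lmod R; ring.
- have := cpositiveD p (cpositiveD px (cpositiveD pS pV)).
  by congr cpositive; lmod R; ring.
- rewrite -(ler_pXn2r (n := 2))// ?nnegrE ?nrm_ge0// -!nrm_sq.
  apply: cle_nrm => //; rewrite /cle.
  have := cpositiveD p (cpositiveD px (cpositiveD pS pT)).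
  by congr cpositive; lmod R; ring.
Qed.

Let m_neq0 : m != 0.
Proof. by apply: imaginary_neq0 l0m; move: l0_ge K_gt0; lra. Qed.

Lemma pencilE x : Fdom S T x -> op_pencil S T l m x =
  l^-1 *: (T (S x + l *: x) + l *: (S x + l *: x)) - (l - m) *: x.
Proof.
move=> [dS dT dTS dST] /=; rewrite opfunD ?opfunZ//; last exact: domZ.
by move: l_neq0 => l1; lmod R; field.
Qed.

Let cabs_lm : cabs (l - m) = (1 - t) * cabs l.
Proof.
have -> : l - m = (1 - t)%:C * l by rewrite mE rmorphB/= mulrBl mul1r.
by rewrite cabsM cabs_real ger0_norm//; case/andP: t01; lra.
Qed.

Let cabs_l : 0 < cabs l. Proof. by rewrite cabs_gt0. Qed.

(** The unknown is [g = (T + l)(S + l) u / l], which must equal [x + (l - m) u]. Each resolvent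
    contributes [1/|l|], so the factor is [|l - m| / |l| = 1 - t]. *)
Lemma pencil_surjective x : exists2 u, Fdom S T u & op_pencil S T l m u = x.
Proof.
have [|g g'|g fg] := @contraction_fixpoint _ E
    (fun g => x + (l - m) *: (l *: res S l (op_inv (op_shift T l) g))) (1 - t).
- by case/andP: t01 => *; apply/andP; split; lra.
- have -> : x + (l - m) *: (l *: res S l (op_inv (op_shift T l) g))
    - (x + (l - m) *: (l *: res S l (op_inv (op_shift T l) g')))
    = (l - m) *: (l *: res S l (op_inv (op_shift T l) (g - g'))).
    by rewrite (resB symT ontoT)// (resB symS ontoS)//; lmod R; ring.
  have [hT _] := res_bound symT ontoT (g - g') iml l_neq0.
  have [hS _] := res_bound symS ontoS (op_inv (op_shift T l) (g - g')) iml l_neq0.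
  rewrite !nrmZ cabs_lm -mulrA; have /andP[_ t1] := t01.
  apply: ler_wpM2l; first lra.
  by apply: le_trans hT; rewrite ler_wpM2l// ltW.
have [dT Tg] := resP ontoT g iml l_neq0.
have [dS Sg] := resP ontoS (op_inv (op_shift T l) g) iml l_neq0.
have Fu : Fdom S T (l *: res S l (op_inv (op_shift T l) g)).
  exact/FdomZ/Fdom_res.
exists (l *: res S l (op_inv (op_shift T l) g)) => //; rewrite pencilE//.
have -> : S (l *: res S l (op_inv (op_shift T l) g))
    + l *: (l *: res S l (op_inv (op_shift T l) g)) = l *: op_inv (op_shift T l) g.
  by rewrite opfunZ// -[in RHS]Sg scalerDr.
have -> : T (l *: op_inv (op_shift T l) g) + l *: (l *: op_inv (op_shift T l) g)
    = l *: g by rewrite opfunZ// -[in RHS]Tg scalerDr.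
rewrite [l^-1 *: _]scalerA mulVf// scale1r -[X in X - _ = _]fg.
by rewrite addrK.
Qed.

Lemma pencil_injective u u' : Fdom S T u -> Fdom S T u' ->
  op_pencil S T l m u = op_pencil S T l m u' -> u = u'.
Proof.
move=> Fu Fu' h; apply/eqP; rewrite -subr_eq0; apply/eqP/nrm_le0.
have [] := pencil_bounds (FdomB Fu Fu').
by rewrite (opfunB (S := op_pencil S T l m))// h subrr nrm0 mulr0.
Qed.

Lemma pencil_bijective : op_bijective (op_pencil S T l m).
Proof.
split=> // [u u' /set_mem Fu /set_mem Fu'|x _]; first exact: pencil_injective.
by have [u Fu ux] := pencil_surjective x; exists u.
Qed.

Lemma pencil_invP x : Fdom S T (op_inv (op_pencil S T l m) x) /\
  op_pencil S T l m (op_inv (op_pencil S T l m) x) = x.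
Proof.
have [u Fu ux] := pencil_surjective x.
by apply: (@xgetI _ 0 [set u | Fdom S T u /\ op_pencil S T l m u = x] u).
Qed.

(** The formal adjoint of the pencil is [- (S - l)(T - l)/l + (l - m)], with the factors in reverse
    order. A solution [w] of the adjoint equation is again a fixed point with factor [1 - t];
    testing it against [F] uses only [dom T w] and [dom S z], [z = - (T - l) w / l]. *)
Lemma pencil_inv_bounded_adjointable :
  bounded_adjointable (op_inv (op_pencil S T l m)).
Proof.
split.
  exists 2%:C => x; have [Fu ux] := pencil_invP x.
  have [h _ _ _] := pencil_bounds Fu; rewrite ux in h.
  by rewrite !nrmE -rmorphM/= lecR.
have imN := imaginaryN iml; have l0N : - l != 0 by rewrite oppr_eq0.
suff /choice[g hg] : forall y, exists w, forall u, Fdom S T u ->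
    ⟨op_pencil S T l m u, w⟩ = ⟨u, y⟩.
  exists g => x y; have [Fu ux] := pencil_invP x.
  by rewrite -[in RHS]ux hg.
move=> y; pose G w := - l *: op_inv (op_shift T (- l)) (res S (- l) (y - (l - m) *: w)).
have [|w w'|w Gw] := @contraction_fixpoint _ E G (1 - t).
- by case/andP: t01 => *; apply/andP; split; lra.
- have -> : G w - G w' = - l *: op_inv (op_shift T (- l)) (res S (- l)
      (- (l - m) *: (w - w'))).
    rewrite /G -scalerBr -(resB symT ontoT)// -(resB symS ontoS)//.
    by do 3!congr (_ _); lmod R; ring.
  have [hS _] := res_bound symS ontoS (- (l - m) *: (w - w')) imN l0N.
  have [hT _] := res_bound symT ontoT (res S (- l) (- (l - m) *: (w - w'))) imN l0N.
  rewrite nrmZ; apply: le_trans hT _; rewrite -(ler_pM2l cabs_l).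
  apply: le_trans (_ : _ <= nrm (- (l - m) *: (w - w'))) _; first by rewrite -cabsN.
  by rewrite nrmZ cabsN cabs_lm mulrA [_ * (1 - t)]mulrC.
pose z := res S (- l) (y - (l - m) *: w).
have [dz Sz] : dom S z /\ S z + (- l) *: z = y - (l - m) *: w by exact: resP.
have [dr Tr] := resP ontoT z imN l0N.
have wE : w = - l *: op_inv (op_shift T (- l)) z by rewrite -[LHS]Gw.
have dw : dom T w by rewrite wE; exact: domZ.
have Tw : T w - l *: w = - l *: z.
  by rewrite wE opfunZ// -[in RHS]Tr; lmod R; ring.
exists w => u Fu; have [dS dT dTS dST] := Fu; rewrite pencilE//.
have [v vE] : exists v, v = S u + l *: u by exists (S u + l *: u).
have dv : dom T v by rewrite vE; apply: domD => //; exact: domZ.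
have cm : Num.conj m = - m by rewrite mE rmorphM/= conj_real conjl mulrN.
rewrite -vE; have -> : ⟨l^-1 *: (T v + l *: v) - (l - m) *: u, w⟩
   = - l^-1 *: ⟨v, T w - l *: w⟩ + (l - m) *: ⟨u, w⟩.
  rewrite !(innerBl, innerBr, innerDl, innerZl, innerZr) fmorphV rmorphB/= conjl cm.
  by rewrite (symT dv dw); move: l_neq0 => l1; lmod R; field.
rewrite Tw innerZr scalerA mulrNN mulVf// scale1r.
have -> : ⟨v, z⟩ = ⟨u, S z + (- l) *: z⟩.
  by rewrite vE !(innerDl, innerDr, innerZl, innerZr) conjl symS.
by rewrite Sz innerBr innerZr subrK.
Qed.

End FixedParameters.
End Pencil.

(** * Self-adjointness of the sum *)

Section WeaklyNull.
Context {R : realType} {B : cstarAlgType R} {E : hilbertModType B}.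

(** For [w] in [dom S] one has [<w, S u> = <S w, u>], which tends to [0]; boundedness of [S u]
    extends this to all [z] by density. *)
Lemma weakly_null_op (S : operator E) (u : nat -> E) (M : R) :
  symmetric_op S -> dense (dom S) -> (forall k, dom S (u k)) ->
  u k @[k --> \oo] --> (0 : E) -> (forall k, nrm (S (u k)) <= M) ->
  forall z, ⟨z, S (u k)⟩ @[k --> \oo] --> (0 : B).
Proof.
move=> symS /denseP dS du u0 uM z; apply/cvg_nrmP => e e0.
have M0 : 0 <= M by apply: le_trans (uM 0%N); exact: nrm_ge0.
(* [8] is the constant [4] of [nrm_inner] times [2], to end up with [e / 2]; [M + 1] avoids a zero
   denominator. *)
have d0 : 0 < e / (8 * (M + 1)) by rewrite divr_gt0// mulr_gt0//; lra.
have [w dw zw] := dS z _ d0.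
have /cvg_nrmP/(_ (e / 2)) : ⟨S w, u k⟩ @[k --> \oo] --> ⟨S w, 0 : E⟩.
  by apply: cvg_inner => //; exact: cvg_cst.
rewrite inner0r => /(_ ltac:(lra))[N hN]; exists N => k Nk.
rewrite subr0; have := hN k Nk; rewrite subr0 symS// => h.
have -> : ⟨z, S (u k)⟩ = ⟨w, S (u k)⟩ - ⟨w - z, S (u k)⟩.
  by rewrite innerBl; lmod R; ring.
apply: le_lt_trans (nrm_triangleB _ _) _.
suff : nrm ⟨w - z, S (u k)⟩ <= e / 2 by lra.
apply: le_trans (nrm_inner _ _) _.
apply: (@le_trans _ _ (4 * (e / (8 * (M + 1)) * (M + 1)))).
  rewrite ler_wpM2l// ler_pM ?nrm_ge0 ?(ltW zw)//.
  by have := uM k; lra.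
rewrite le_eqVlt; apply/orP; left; apply/eqP; field.
by apply/eqP; lra.
Qed.

End WeaklyNull.

Section SelfadjointCriterion.
Context {R : realType} {B : cstarAlgType R} {E : hilbertModType B}.

Lemma symmetric_onto_selfadjoint (S : operator E) (m : R[i]) :
  dense (dom S) -> symmetric_op S -> imaginary m ->
  onto_shift S m -> onto_shift S (- m) -> selfadjoint S.
Proof.
move=> dS symS im om oN; split=> // y z; split=> [adj|[dy <-] x dx]; last exact: symS.
have [w dw Sw] := oN (z - m *: y).
have h x : dom S x -> ⟨S x + m *: x, y - w⟩ = 0.
  move=> dx; rewrite innerBr; apply/eqP; rewrite subr_eq0; apply/eqP.
  apply: (@etrans _ _ ⟨x, z - m *: y⟩).
    rewrite innerDl innerZl innerBr innerZr adj// conj_imaginary//.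
    by lmod R; ring.
  rewrite -Sw innerDl innerZl innerDr innerZr symS// conj_imaginary//.
have [x dx Sx] := om (y - w); have := h x dx; rewrite Sx => h0.
have yw : y = w.
  apply/eqP; rewrite -subr_eq0; apply/eqP/nrm_eq0/eqP.
  by rewrite -sqrf_eq0 -nrm_sq h0 nrm0.
by rewrite yw; split=> //; move: Sw; rewrite yw scaleNr => /addIr.
Qed.

Lemma onto_shift_regular (S : operator E) (m : R[i]) :
  imaginary m -> m != 0 -> onto_shift S m -> onto_shift S (- m) -> regular S.
Proof.
move=> im m0 om oN; exists m; split.
- by move: m0 im; rewrite /imaginary; case: m {om oN} => a b /= + a0;
    rewrite eq_complex /= a0 eqxx.
- by move=> O [x Ox] _; have [u du ux] := om x; exists x; split=> //; exists u.
- move=> O [x Ox] _; have [u du ux] := oN x; exists x; split=> //; exists u => //.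
  by rewrite -scaleNr.
Qed.

End SelfadjointCriterion.

Section PencilParams.
Context {R : realType}.

Lemma pencil_params_ratio (m l : R[i]) : pencil_params m l ->
  exists2 t : R, 0 < t < 1 & m = t%:C * l.
Proof.
move=> [_ ml ml0]; have l0 : l != 0.
  by apply: contraTneq ml => ->; rewrite normr0 normr_lt0.
have tE : ((complex.Re (m / l))%:C : R[i]) = m / l by rewrite RRe_real// gtr0_real.
exists (complex.Re (m / l)); last by rewrite tE divfK.
rewrite -ltr0c tE ml0 -ltcR tE /=.
have -> : m / l = `|m| / `|l| by rewrite -normf_div gtr0_norm.
by rewrite ltr_pdivrMr ?mul1r// normr_gt0.
Qed.

End PencilParams.

Section Sum.
Context {R : realType} {B : cstarAlgType R} {E : hilbertModType B}.
Local Notation C := R[i].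
Variables (S T : operator E) (K l0 : R).
Hypothesis symS : symmetric_op S.
Hypothesis symT : symmetric_op T.
Hypothesis closedS : closed_op S.
Hypothesis closedT : closed_op T.
Hypothesis denseS : dense (dom S).
Hypothesis denseT : dense (dom T).
Hypothesis ontoS : forall l : C, imaginary l -> l != 0 -> onto_shift S l.
Hypothesis ontoT : forall l : C, imaginary l -> l != 0 -> onto_shift T l.
Hypothesis K_gt0 : 0 < K.
Hypothesis anti_cle : forall x, Fdom S T x ->
  ⟨anticomm S T x, anticomm S T x⟩ ≼ K%:C *: (⟨x, x⟩ + ⟨S x, S x⟩ + ⟨T x, T x⟩).
Hypothesis l0_ge : 16 * K + 5 <= l0.
Hypothesis Fdom_res : forall (l : C) y, imaginary l -> l0 <= cabs l ->
  dom T y -> Fdom S T (op_inv (op_shift S l) y).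
Local Notation D := (op_add S T).

(** [K + 1] dominates [sqrt K], so no root is taken. With [c = K + 1] the threshold [16 K + 5]
    covers both [4 c + 1], for the anticommutator estimates, and [16 K + 1], for the pencil. *)
Lemma anticomm_bound x : Fdom S T x ->
  nrm (anticomm S T x) <= (K + 1) * (nrm x + nrm (S x) + nrm (T x)).
Proof.
move=> /anti_cle /(cle_nrm (inner_pos _)); have K0 := K_gt0.
rewrite nrm_sq nrmZr ?(ltW K0)//.
have := nrm_triangle (⟨x, x⟩ + ⟨S x, S x⟩) ⟨T x, T x⟩.
have := nrm_triangle ⟨x, x⟩ ⟨S x, S x⟩; rewrite !nrm_sq.
have := nrm_ge0 x; have := nrm_ge0 (S x); have := nrm_ge0 (T x).
set n1 := nrm x; set n2 := nrm (S x); set n3 := nrm (T x).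
set n4 := nrm (_ + _ + _); set n5 := nrm (_ + _); set n6 := nrm (anticomm _ _ _).
move=> h3 h2 h1 h5 h4 h6.
have h7 : 0 <= n1 + n2 + n3 by lra.
rewrite -(ler_pXn2r (n := 2))// ?nnegrE ?nrm_ge0 ?mulr_ge0//; last by lra.
have h8 : n4 <= (n1 + n2 + n3) ^+ 2 by nra.
apply: le_trans h6 _; rewrite exprMn.
by apply: ler_pM => //; [lra|exact: nrm_ge0|nra].
Qed.

Lemma Fdom_approx_sum x : dom S x -> dom T x -> exists u : nat -> E,
  [/\ forall k, Fdom S T (u k), u k @[k --> \oo] --> x,
      T (u k) @[k --> \oo] --> T x & S (u k) @[k --> \oo] --> S x].
Proof.
move=> dS dT; have K0 := K_gt0; have lK := l0_ge.
have [||u [Fu ux Tu Su]] := Fdom_approx (c := K + 1) (l0 := l0)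
  symS ontoS denseS _ anticomm_bound _ Fdom_res dT; [lra|lra|].
by exists u; split=> //; exact: Su.
Qed.

Lemma symmetric_add : symmetric_op D.
Proof.
by move=> x y [dS dT] [dS' dT'] /=; rewrite innerDl innerDr symS// symT.
Qed.

Lemma add_bounds x : dom D x ->
  nrm (S x) <= (2 + K) * (nrm x + nrm (D x)) /\
  nrm (T x) <= (2 + K) * (nrm x + nrm (D x)).
Proof.
move=> [dS dT].
exact: (sum_lower_nrm symS symT K_gt0 anti_cle Fdom_approx_sum dS dT).
Qed.

Lemma closed_add : closed_op D.
Proof.
move=> u x z du ux Du; have K0 := K_gt0; have K2 : 0 <= 2 + K by lra.
have hb n m : nrm (S (u n) - S (u m)) <=
      (2 + K) * (nrm (u n - u m) + nrm (D (u n) - D (u m))) /\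
    nrm (T (u n) - T (u m)) <=
      (2 + K) * (nrm (u n - u m) + nrm (D (u n) - D (u m))).
  have [dS dT] := du n; have [dS' dT'] := du m.
  by have := add_bounds (domB (du n) (du m)); rewrite (opfunB (S := D))// !opfunB.
have [|y Sy] := @cauchys_cvg _ _ (fun n => S (u n)).
  apply: (cauchys_le (v := u) (w := fun n => D (u n)) K2) => [||n m];
    [exact: cvg_cauchys ux|exact: cvg_cauchys Du|exact: (hb n m).1].
have [|w Tw] := @cauchys_cvg _ _ (fun n => T (u n)).
  apply: (cauchys_le (v := u) (w := fun n => D (u n)) K2) => [||n m];
    [exact: cvg_cauchys ux|exact: cvg_cauchys Du|exact: (hb n m).2].
have [dS Sx] := closedS (fun n => (du n).1) ux Sy.
have [dT Tx] := closedT (fun n => (du n).2) ux Tw.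
split=> //=; rewrite Sx Tx; apply: cvg_nrm_unique Du; exact: cvgD.
Qed.

Lemma dense_Fdom : dense (Fdom S T).
Proof.
apply/denseP => x e e0; have e2 : 0 < e / 2 by lra.
have [y dy xy] := (denseP _).1 denseT x _ e2.
have K0 := K_gt0; have lK := l0_ge.
have [||u [Fu /cvg_nrmP/(_ _ e2)[N hN] _ _]] := Fdom_approx (c := K + 1) (l0 := l0)
  symS ontoS denseS _ anticomm_bound _ Fdom_res dy; [lra|lra|].
exists (u N) => //; have := nrm_triangle3 (u N) y x; have := hN N (leqnn N); lra.
Qed.

Section FixedMu.
Variable m : C.
Hypothesis imm : imaginary m.
Hypothesis l0m : l0 <= cabs m.

Let l0_gt0 : 0 < l0. Proof. by move: l0_ge K_gt0; lra. Qed.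

Let m_neq0 : m != 0. Proof. exact: imaginary_neq0 l0_gt0 l0m. Qed.

Local Notation P l := (op_pencil S T l m).
Local Notation Pinv l x := (op_inv (op_pencil S T l m) x).

Let l0K : 16 * K + 1 <= l0. Proof. by move: l0_ge; lra. Qed.

Lemma pencil_params_bounds l u : pencil_params m l -> Fdom S T u ->
  nrm (S u) <= 2 * nrm (P l u) /\ nrm (l^-1 *: T (S u)) <= nrm (P l u).
Proof.
move=> pl Fu; have [t t01 mE] := pencil_params_ratio pl; have [iml ml _] := pl.
have l0l : l0 <= cabs l by apply: le_trans l0m _; rewrite ltW// -ltcR -!cabsE.
by have [_ h1 _ h2] := pencil_bounds symS symT K_gt0 anti_cle l0K iml l0l l0m
  t01 mE Fu.
Qed.

Lemma pencil_params_bijective l : pencil_params m l ->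
  op_bijective (P l) /\ bounded_adjointable (op_inv (P l)).
Proof.
move=> pl; have [t t01 mE] := pencil_params_ratio pl; have [iml ml _] := pl.
have l0l : l0 <= cabs l by apply: le_trans l0m _; rewrite ltW// -ltcR -!cabsE.
split.
  exact: (pencil_bijective symS symT ontoS ontoT K_gt0 anti_cle l0K Fdom_res
    iml l0l l0m t01 mE).
exact: (pencil_inv_bounded_adjointable symS symT ontoS ontoT K_gt0 anti_cle l0K
  Fdom_res iml l0l l0m t01 mE).
Qed.

Lemma pencil_inv_bounds l x : pencil_params m l ->
  [/\ Fdom S T (Pinv l x), P l (Pinv l x) = x, nrm (S (Pinv l x)) <= 2 * nrm x &
      nrm (l^-1 *: T (S (Pinv l x))) <= nrm x].
Proof.
move=> pl; have [t t01 mE] := pencil_params_ratio pl; have [iml ml _] := pl.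
have l0l : l0 <= cabs l by apply: le_trans l0m _; rewrite ltW// -ltcR -!cabsE.
have [Fu ux] := pencil_invP symS symT ontoS ontoT K_gt0 l0K Fdom_res
  iml l0l t01 mE x.
by have [] := pencil_params_bounds pl Fu; rewrite ux.
Qed.

Lemma pencil_inv_add l x : pencil_params m l ->
  D (Pinv l x) + m *: Pinv l x = x - l^-1 *: T (S (Pinv l x)).
Proof.
move=> pl; have [_ ux _ _] := pencil_inv_bounds x pl.
by rewrite -[X in X - _]ux /=; lmod R; ring.
Qed.

(** The offset [2] makes [|m| < |l|] strict already at [k = 0]. *)
Lemma pencil_params_scale (k : nat) : pencil_params m (k.+2%:R%:C * m).
Proof.
split.
- rewrite /imaginary ReZ; have : complex.Re m = 0 by exact: imm.
  by move=> ->; rewrite mulr0.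
- rewrite !cabsE ltcR cabsM cabs_real ger0_norm// ltr_pMl ?cabs_gt0//.
  by rewrite ltr1n.
- by rewrite invfM mulrCA mulfV// mulr1 -fmorphV/= ltr0c invr_gt0.
Qed.

(* The error terms [l^-1 T S u] are bounded and of the form [T e] with [e] small,
   so their averages can be made small. *)
Lemma dense_range_Fdom x (e : R) : 0 < e ->
  exists2 u, Fdom S T u & nrm (D u + m *: u - x) <= e.
Proof.
move=> e0; pose l k : C := k.+2%:R%:C * m; pose u k := Pinv (l k) x.
have hu k := pencil_inv_bounds x (pencil_params_scale k).
have dTS k : dom T (S (u k)) by case: (hu k) => -[].
pose f k := T ((l k)^-1 *: S (u k)).
have fE k : f k = (l k)^-1 *: T (S (u k)) by rewrite /f opfunZ.
have m0 : 0 < cabs m by rewrite cabs_gt0.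
have lge k : k.+1%:R * cabs m <= cabs (l k).
  by rewrite /l cabsM cabs_real ger0_norm// ler_pM2r// ler_nat.
have f0 z : ⟨z, f k⟩ @[k --> \oo] --> (0 : B).
  apply: (@weakly_null_op _ _ _ T (fun k => (l k)^-1 *: S (u k)) (nrm x)) => //.
  - by move=> k; apply: domZ.
  - apply: (@cvg_nrm_squeeze _ _ _ _ (fun k => (2 * nrm x / cabs m) * k.+1%:R^-1)).
      move=> k; rewrite subr0 nrmZ cabsV; have [_ _ hS _] := hu k.
      have lk : 0 < cabs (l k) by apply: lt_le_trans (lge k); rewrite mulr_gt0.
      rewrite ler_pdivrMl//; apply: le_trans hS _.
      have xE : 2 * nrm x = k.+1%:R * cabs m * (2 * nrm x / cabs m * k.+1%:R^-1).
        have n0 : k.+1%:R != 0 :> R by rewrite pnatr_eq0.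
        by move: (k.+1%:R : R) n0 => n n0; field; rewrite n0 gt_eqF.
      by rewrite [leLHS]xE ler_wpM2r// !mulr_ge0 ?invr_ge0 ?nrm_ge0// ltW.
    by rewrite -[X in _ --> X](mulr0 (2 * nrm x / cabs m)); apply: cvgMr; exact: cvg_harmonic.
  - by move=> k; rewrite opfunZ//; case: (hu k).
(* [w] is the defect with which a sum [v] of [k] terms [u n] solves the equation for [k x]; dividing
   by [k] makes a small average an approximate solution. *)
pose A (k : nat) (w : E) := exists2 v, Fdom S T v & D v + m *: v + w = k%:R%:C *: x.
have [|||k [w [k0 [v Fv vE] hw]]] := @banach_saks _ _ _ f (nrm x) 0 A _ f0 _ _ e e0.
- by move=> k; rewrite fE; case: (hu k).
- exists 0; first exact: Fdom0.
  by rewrite op0 scaler0 !addr0 scale0r.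
- move=> k w n [v Fv vE] _; exists (v + u n); first by apply: FdomD => //; case: (hu n).
  have dv : dom D v by case: Fv.
  have du : dom D (u n) by case: (hu n) => -[].
  rewrite (opfunD (o := D))// -natr1 rmorphD scalerDl scale1r -vE fE.
  have := pencil_inv_add x (pencil_params_scale n); rewrite -/(l n) -/(u n).
  move=> /(congr1 (fun y => y + (l n)^-1 *: T (S (u n)))); rewrite subrK => <-.
  by lmod R; ring.
have kR : 0 < k%:R :> R by rewrite ltr0n.
exists (k%:R^-1%:C *: v); first exact: FdomZ.
have dv : dom D v by case: Fv.
rewrite (opfunZ (o := D))//.
have -> : k%:R^-1%:C *: D v + m *: (k%:R^-1%:C *: v) - x = k%:R^-1%:C *: (- w).
  have -> : - w = D v + m *: v - k%:R%:C *: x by rewrite -vE; lmod R; ring.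
  have kx : k%:R^-1%:C *: (k%:R%:C *: x) = x.
    by rewrite scalerA -rmorphM/= mulVf ?scale1r// gt_eqF.
  by rewrite scalerBr kx; lmod R; ring.
by rewrite nrmZr ?invr_ge0 ?(ltW kR)// nrmN mulrC ler_pdivrMr.
Qed.

Lemma onto_add_large : onto_shift D m.
Proof.
apply: onto_shift_dense; [exact: symmetric_add|exact: closed_add| |].
  move: m_neq0 imm; rewrite /imaginary; case: (m) => a b /= + a0.
  by rewrite eq_complex /= a0 eqxx.
apply/denseP => x e e0; have e2 : 0 < e / 2 by lra.
have [u Fu ux] := dense_range_Fdom x e2.
by exists (D u + m *: u); [exists u => //; case: Fu|lra].
Qed.

(** Compare with a fixed [z] in [F] for which [(D + m) z] is close to [x]: [P l (u - z)] is then
    small for large [|l|], and it controls [l^-1 T S (u - z)] uniformly in [l]. *)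
Lemma cvg_pencil_inv_strong x (e : R) : 0 < e ->
  exists M : R, forall l, pencil_params m l -> M < cabs l ->
    nrm (D (Pinv l x) + m *: Pinv l x - x) < e.
Proof.
move=> e0; have e4 : 0 < e / 4 by lra.
have [z Fz zx] := dense_range_Fdom x e4.
exists (nrm (T (S z)) / (e / 4)) => l pl lM.
have lp : 0 < cabs l by apply: le_lt_trans lM; rewrite divr_ge0 ?nrm_ge0 ?(ltW e4).
have small : nrm (l^-1 *: T (S z)) < e / 4.
  by rewrite nrmZ cabsV mulrC ltr_pdivrMr// mulrC -ltr_pdivrMr.
have [Fu ux _ _] := pencil_inv_bounds x pl; rewrite pencil_inv_add//.
set u := Pinv l x in Fu ux *.
have [dSu _ dTSu _] := Fu; have [dSz _ dTSz _] := Fz.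
have [_] := pencil_params_bounds pl (FdomB Fu Fz).
rewrite (opfunB (S := P l))// ux !opfunB//.
have -> : x - P l z = - (D z + m *: z - x) - l^-1 *: T (S z) by rewrite /=; lmod R; ring.
move=> /le_trans/(_ (nrm_triangleB _ _)); rewrite nrmN => h.
have -> : x - l^-1 *: T (S u) - x
    = - (l^-1 *: (T (S u) - T (S z)) + l^-1 *: T (S z)) by lmod R; ring.
rewrite nrmN; apply: le_lt_trans (nrm_triangle _ _) _; lra.
Qed.

End FixedMu.

Let cl0 : imaginary (0 +i* l0) /\ l0 <= cabs (0 +i* l0).
Proof.
split=> //; rewrite /cabs normc_def /= expr0n add0r sqrtr_sqr; exact: ler_norm.
Qed.

Let l0_gt0 : 0 < l0. Proof. by move: l0_ge K_gt0; lra. Qed.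

Lemma add_onto_pm : onto_shift D (0 +i* l0) /\ onto_shift D (- (0 +i* l0)).
Proof.
have [i1 i2] := cl0.
by split; apply: onto_add_large => //; rewrite ?cabsN//; exact: imaginaryN.
Qed.

Lemma dense_add : dense (dom D).
Proof.
apply/denseP => x e e0; have [u [? ? _ _] ux] := (denseP _).1 dense_Fdom x e e0.
by exists u.
Qed.

Lemma selfadjoint_add : selfadjoint D.
Proof.
have [i1 i2] := cl0; have [h1 h2] := add_onto_pm.
exact: symmetric_onto_selfadjoint dense_add symmetric_add i1 h1 h2.
Qed.

Lemma regular_add : regular D.
Proof.
have [i1 i2] := cl0; have [h1 h2] := add_onto_pm.
exact: onto_shift_regular i1 (imaginary_neq0 l0_gt0 i2) h1 h2.
Qed.

Lemma onto_add (l : C) : imaginary l -> l != 0 -> onto_shift D l.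
Proof. exact: regular_onto_shift selfadjoint_add regular_add. Qed.

(* [(D + m)^-1 T] is bounded, because [T (D - m)^-1] is. *)
Lemma add_resolvent_bound (m : C) v a : imaginary m -> l0 <= cabs m ->
  dom D v -> dom T a -> D v + m *: v = T a ->
  nrm v <= 8 * (2 + K) * nrm a.
Proof.
move=> im l0m dv da va; have K0 := K_gt0.
have m0 : m != 0 by exact: imaginary_neq0 l0_gt0 l0m.
have m1 : 1 <= cabs m by apply: le_trans l0m; move: l0_ge K0; lra.
have iN := imaginaryN im; have mN : - m != 0 by rewrite oppr_eq0.
have [h dh Dh] := onto_add iN mN v.
have [h1 h2] := shift_sq_bound symmetric_add iN dh; rewrite Dh cabsN in h1 h2.
have [_ hT] := add_bounds dh; have dTh : dom T h by case: dh.
have vv : ⟨v, v⟩ = ⟨a, T h⟩.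
  rewrite -{2}Dh -(symT da dTh) -va innerDr innerZr innerDl innerZl.
  by rewrite symmetric_add// conj_imaginary.
have := nrm_inner a (T h); rewrite -vv nrm_sq.
have := nrm_ge0 a; have := nrm_ge0 v; have := nrm_ge0 h.
set nv := nrm v in h1 h2 *; set na := nrm a; set nh := nrm h in h1 hT *.
set nT := nrm (T h) in hT *; set nD := nrm (D h) in h2 hT.
move=> nh0 nv0 na0 hh.
have nh1 : nh <= nv by apply: le_trans h1; rewrite ler_peMl.
have hT2 : nT <= (2 + K) * (2 * nv).
  by apply: le_trans hT _; rewrite ler_wpM2l//; lra.
have h4 : 4 * (na * nT) <= 4 * (na * ((2 + K) * (2 * nv))).
  by rewrite ler_wpM2l// ler_wpM2l.
have [->|nv1] := eqVneq nv 0; first by rewrite !mulr_ge0//; lra.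
have nvp : 0 < nv by rewrite lt_def nv1.
rewrite -(ler_pM2r nvp) -expr2; apply: le_trans hh _; apply: le_trans h4 _.
by rewrite le_eqVlt; apply/orP; left; apply/eqP; ring.
Qed.

(** The difference [v] of the two inverses at [x] solves [(D + m) v = T a] with [a = l^-1 S u], up
    to sign. The bound [|S u| <= 2 |x|] doubles the constant of [add_resolvent_bound]. *)
Lemma pencil_inv_diff_bound (m l : C) x : imaginary m -> l0 <= cabs m ->
  pencil_params m l ->
  cabs l * nrm (op_inv (op_pencil S T l m) x - op_inv (op_shift D m) x)
    <= 16 * (2 + K) * nrm x.
Proof.
move=> im l0m pl; have K0 := K_gt0.
have m0 : m != 0 by exact: imaginary_neq0 l0_gt0 l0m.
have [Fu ux hS _] := pencil_inv_bounds l0m x pl.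
have addE := pencil_inv_add l0m x pl.
set u := op_inv (op_pencil S T l m) x in Fu ux hS addE *.
have [dw Dw] := resP onto_add x im m0; set w := op_inv _ x in dw Dw *.
have [dS dT dTS dST] := Fu.
have l_gt0 : 0 < cabs l.
  by have [_ ml _] := pl; rewrite -ltr0c -cabsE; apply: le_lt_trans ml.
have := @add_resolvent_bound m (w - u) (l^-1 *: S u) im l0m.
have du : dom D u by [].
rewrite (opfunB (S := D))// opfunZ// => /(_ (domB dw du) (domZ _ dTS)) h.
rewrite nrmB; have {h} : nrm (w - u) <= 8 * (2 + K) * nrm (l^-1 *: S u).
  apply: h; have -> : D w - D u + m *: (w - u) = x - (D u + m *: u).
    by rewrite -[in RHS]Dw; lmod R; ring.
  by rewrite addE opprB addrC subrK.
rewrite nrmZ cabsV => h; rewrite -ler_pdivlMl//; apply: le_trans h _.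
rewrite mulrCA ler_wpM2l ?invr_ge0 ?(ltW l_gt0)//.
apply: (@le_trans _ _ (8 * (2 + K) * (2 * nrm x))); first by rewrite ler_wpM2l//; lra.
by rewrite le_eqVlt; apply/orP; left; apply/eqP; ring.
Qed.

End Sum.

(** * Exchanging the roles of S and T *)

Section Swap.
Context {R : realType} {B : cstarAlgType R} {E : hilbertModType B}.
Local Notation C := R[i].
Variables (S T : operator E) (c l0 : R).
Hypothesis symS : symmetric_op S.
Hypothesis symT : symmetric_op T.
Hypothesis closedS : closed_op S.
Hypothesis closedT : closed_op T.
Hypothesis denseS : dense (dom S).
Hypothesis ontoS : forall l : C, imaginary l -> l != 0 -> onto_shift S l.
Hypothesis ontoT : forall l : C, imaginary l -> l != 0 -> onto_shift T l.
Hypothesis c_ge0 : 0 <= c.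
Hypothesis anti_le : forall x, Fdom S T x ->
  nrm (anticomm S T x) <= c * (nrm x + nrm (S x) + nrm (T x)).
Hypothesis l0_ge : 4 * c + 1 <= l0.
Local Notation res l y := (op_inv (op_shift S l) y).
Hypothesis Fdom_res : forall (l : C) y, imaginary l -> l0 <= cabs l ->
  dom T y -> Fdom S T (res l y).

Lemma anticommZ (k : C) x : Fdom S T x -> anticomm S T (k *: x) = k *: anticomm S T x.
Proof. by move=> [dS dT dTS dST]; rewrite /anticomm !opfunZ// scalerDr. Qed.

Section Sequence.
Variable l : nat -> C.
Hypothesis iml : forall k, imaginary (l k).
Hypothesis lge : forall k, l0 + k.+1%:R <= cabs (l k).

Let l0_gt0 : 0 < l0. Proof. by move: l0_ge c_ge0; lra. Qed.

Let ll0 k : l0 <= cabs (l k).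
Proof. by have := lge k; have := ler0n R k.+1; lra. Qed.

Let l_neq0 k : l k != 0.
Proof. exact: imaginary_neq0 l0_gt0 (ll0 k). Qed.

Lemma op_res_shift (m : C) a : imaginary m -> m != 0 ->
  S (m *: res m a) = m *: (a - m *: res m a).
Proof.
move=> im m0; have [dr Sr] := resP ontoS a im m0.
by rewrite opfunZ//; congr (_ *: _); rewrite -[X in _ = X - _]Sr addrK.
Qed.

Lemma op_yosida_eq (m : C) x y k : dom T y -> T y + m *: y = x -> dom S x ->
  T (S (l k *: res (l k) y)) - m *: S (- l k *: res (- l k) y) =
  - l k *: res (- l k) (anticomm S T (l k *: res (l k) y) - S x).
Proof.
move=> dy Ty dx; have Fr := Fdom_res (iml k) (ll0 k) dy.
have iN := imaginaryN (iml k); have N0 : - l k != 0 by rewrite oppr_eq0.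
have [dSr dTr dTS dST] := FdomZ (l k) Fr.
set z := l k *: res (l k) y in dSr dTr dTS dST *.
have WE : anticomm S T z = l k *: anticomm S T (res (l k) y) by exact: anticommZ.
have -> : T (S z) = anticomm S T z - S (T z) by rewrite /anticomm addrC addKr.
have TyE : T y = x - m *: y by rewrite -[in RHS]Ty addrK.
have -> : T z = - l k *: res (- l k) (x - m *: y - anticomm S T (res (l k) y)).
  rewrite -TyE /z opfunZ; last by case: Fr.
  exact: (op_res_anticomm symS ontoS c_ge0 l0_ge Fdom_res iml lge).
have SxE : S (- l k *: res (- l k) x) = - l k *: res (- l k) (S x).
  have [dr _] := resP ontoS x iN N0.
  by rewrite opfunZ// (res_op symS ontoS iN N0 dx).2.
rewrite op_res_shift// in SxE.
rewrite !op_res_shift// !(resB symS ontoS)// (res_scale symS ontoS)// WE.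
rewrite (res_scale symS ontoS)// [RHS]scalerBr -SxE.
by lmod R; ring.
Qed.

(** The point is the shape of the bound: the only quantity on the right that may grow with [k] is
    [S J y], and its coefficient [2 c] is small against [|m|]. *)
Lemma yosida_error_bound (m : C) x y k : dom T y -> T y + m *: y = x -> dom S x ->
  nrm (anticomm S T (l k *: res (l k) y)) +
  nrm (T (S (l k *: res (l k) y)) - m *: S (- l k *: res (- l k) y)) <=
  2 * c * nrm (S (l k *: res (l k) y)) +
  (2 * c * (nrm y + 2 * (1 + 2 * c) * (nrm y + nrm (T y))) + nrm (S x)).
Proof.
move=> dy Ty dx; rewrite (op_yosida_eq k dy Ty dx).
have iN := imaginaryN (iml k); have N0 : - l k != 0 by rewrite oppr_eq0.
have Fr := Fdom_res (iml k) (ll0 k) dy; have Fz := FdomZ (l k) Fr.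
have := anti_le Fz; set W := anticomm S T _ => hW.
have [hy _] := res_bound symS ontoS y (iml k) (l_neq0 k).
have lk : 4 * c + 1 <= cabs (l k) by apply: le_trans l0_ge (ll0 k).
have [_ _ hT _] := Fdom_bound symS c_ge0 anti_le (iml k) lk Fr.
have [_ ry] := resP ontoS y (iml k) (l_neq0 k).
rewrite /= ry in hT; rewrite -nrmZ in hy; rewrite -nrmZ -opfunZ in hT; last by case: Fr.
have [hJ _] := res_bound symS ontoS (W - S x) iN N0; rewrite -nrmZ in hJ.
have := nrm_triangleB W (S x); have c0 := c_ge0.
have : c * (nrm (l k *: res (l k) y) + nrm (T (l k *: res (l k) y))) <=
  c * (nrm y + 2 * (1 + 2 * c) * (nrm y + nrm (T y))).
  by rewrite ler_wpM2l// lerD.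
move: hW hJ; lra.
Qed.

End Sequence.

(* With [v = S J y] and [v' = S J^* y], where [J = l (S + l)^-1], the elements
   [g = T v - m v'] and [g' = T v' - m v] are controlled; adding and subtracting
   these equations bounds [v + v'] by [(T - m)^-1] and [v - v'] by [(T + m)^-1]. *)
Lemma yosida_op_bounded (m : C) x y : imaginary m -> 4 * c + 1 <= cabs m ->
  dom T y -> T y + m *: y = x -> dom S x ->
  exists M : R, forall k (l := yosida_seq l0 k) (z := l *: res l y),
    nrm (S (T z + m *: z) - S x) <= M.
Proof.
move=> im mc dy Ty dx; have c0 := c_ge0; have lc := l0_ge.
pose l := yosida_seq l0; pose l' k := - l k.
have il k : imaginary (l k) by exact: yosida_seq_imaginary.
have lge k : l0 + k.+1%:R <= cabs (l k) by exact: yosida_seq_ge.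
have il' k : imaginary (l' k) by exact: imaginaryN (il k).
have lge' k : l0 + k.+1%:R <= cabs (l' k) by rewrite cabsN.
pose Q := 2 * c * (nrm y + 2 * (1 + 2 * c) * (nrm y + nrm (T y))) + nrm (S x).
exists (Q + 8 * c * Q + cabs m * (4 * Q) + nrm (S x)) => k /=.
rewrite -/(l k); set z := l k *: res (l k) y.
pose z' := l' k *: res (l' k) y.
have Fz : Fdom S T z by exact: (Fdom_yosida Fdom_res il lge).
have Fz' : Fdom S T z' by exact: (Fdom_yosida Fdom_res il' lge').
have := yosida_error_bound il lge k dy Ty dx.
have := yosida_error_bound il' lge' k dy Ty dx.
have l'K : - l' k = l k by rewrite /l' opprK.
rewrite l'K -/(l' k) -/z -/z' -/Q.
set v := S z; set v' := S z'; set g := T v - _; set g' := T v' - _ => e' e.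
have [dS dT dTS dST] := Fz; have [dS' dT' dTS' dST'] := Fz'.
have [] := shift_sq_bound symT (imaginaryN im) (domD dTS dTS').
have [] := shift_sq_bound symT im (domB dTS dTS').
rewrite opfunB// opfunD// cabsN -/v -/v'.
have -> : T v - T v' + m *: (v - v') = g - g' by rewrite /g /g'; lmod R; ring.
have -> : T v + T v' + (- m) *: (v + v') = g + g' by rewrite /g /g'; lmod R; ring.
move=> h1 _ h2 _.
have hv : cabs m * nrm v <= nrm g + nrm g'.
  have : nrm (2%:C *: v) <= nrm (v + v') + nrm (v - v').
    have <- : (v + v') + (v - v') = 2%:C *: v by lmod R; ring.
    exact: nrm_triangle.
  rewrite nrmZr// -(ler_pM2l (x := cabs m)); last lra.
  by have := nrm_triangle g g'; have := nrm_triangleB g g'; move: h1 h2; lra.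
have hv' : cabs m * nrm v' <= nrm g + nrm g'.
  have : nrm (2%:C *: v') <= nrm (v + v') + nrm (v - v').
    have <- : (v + v') - (v - v') = 2%:C *: v' by lmod R; ring.
    exact: nrm_triangleB.
  rewrite nrmZr// -(ler_pM2l (x := cabs m)); last lra.
  by have := nrm_triangle g g'; have := nrm_triangleB g g'; move: h1 h2; lra.
have W0 := nrm_ge0 (anticomm S T z); have W0' := nrm_ge0 (anticomm S T z').
have v0 := nrm_ge0 v; have v0' := nrm_ge0 v'.
(* The estimates add up to [|m| (|v| + |v'|) <= 4 c (|v| + |v'|) + 4 Q], and [4 c + 1 <= |m|]
   absorbs the first term. *)
have vv : nrm v + nrm v' <= 4 * Q.
  have : (4 * c + 1) * (nrm v + nrm v') <= cabs m * (nrm v + nrm v').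
    by rewrite ler_wpM2r// addr_ge0.
  by move: hv hv' e e'; lra.
have -> : S (T z + m *: z) - S x
    = (anticomm S T z - g) - m *: v' + m *: v - S x.
  rewrite (opfunD dST (domZ m dS)) (opfunZ m dS) /anticomm /g /v.
  by lmod R; ring.
apply: le_trans (nrm_triangleB _ _) _; rewrite lerD2r.
have h3 := nrm_triangleB (anticomm S T z) g.
have h4 := nrm_triangleB (anticomm S T z - g) (m *: v').
have h5 := nrm_triangle (anticomm S T z - g - m *: v') (m *: v).
rewrite nrmZ in h4; rewrite nrmZ in h5.
have h6 : c * nrm v <= c * (4 * Q) by rewrite ler_wpM2l//; lra.
have h7 : cabs m * (nrm v + nrm v') <= cabs m * (4 * Q).
  by rewrite ler_wpM2l ?cabs_ge0.
by move: e h3 h4 h5 h6 h7; lra.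
Qed.

(** The errors [(T + m) J y - x] tend to [0], and their images under [S] are bounded, hence null
    against every vector. Averaging makes those images small in norm too, giving approximation in
    the graph norm of [S]. *)
Lemma shift_Fdom_dense (m : C) x (e : R) : imaginary m -> 4 * c + 1 <= cabs m ->
  dom S x -> 0 < e -> exists2 u, Fdom S T u &
    nrm (T u + m *: u - x) + nrm (S (T u + m *: u) - S x) < e.
Proof.
move=> im mc dx e0; have c0 := c_ge0.
have m1 : 0 < 4 * c + 1 by lra.
have [dy Ty] := resP ontoT x im (imaginary_neq0 m1 mc).
set y := op_inv _ x in dy Ty.
have [M hM] := yosida_op_bounded im mc dy Ty dx.
pose l := yosida_seq l0; pose z k := l k *: res (l k) y.
have il k : imaginary (l k) by exact: yosida_seq_imaginary.
have lge k : l0 + k.+1%:R <= cabs (l k) by exact: yosida_seq_ge.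
have Fz k : Fdom S T (z k) by exact: (Fdom_yosida Fdom_res il lge).
have cz : z k @[k --> \oo] --> y.
  exact: (cvg_yosida symS ontoS denseS c_ge0 l0_ge il lge).
have cTz : T (z k) @[k --> \oo] --> T y.
  exact: (cvg_T_yosida symS ontoS denseS c_ge0 anti_le l0_ge Fdom_res il lge dy).
pose err k := T (z k) + m *: z k - x.
have derr k : dom S (err k).
  have [dS dT dTS dST] := Fz k.
  by apply: domB => //; apply: domD => //; exact: domZ.
have Serr k : S (err k) = S (T (z k) + m *: z k) - S x.
  have [dS dT dTS dST] := Fz k.
  by rewrite /err opfunB//; apply: domD => //; exact: domZ.
have err0 : err k @[k --> \oo] --> (0 : E).
  rewrite -(subrr x) -{1}Ty; apply: cvgB; last exact: cvg_cst.
  by apply: cvgD => //; exact: cvgZl_tmp.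
have e4 : 0 < e / 4 by lra.
have /cvg_nrmP/(_ _ e4)[N0 hN0] := err0.
have errM k : nrm (S (err k)) <= M by rewrite Serr; exact: hM.
have weak := weakly_null_op symS denseS derr err0 errM.
(* Only indices beyond [N0] are averaged, so the error before applying [S] stays below [e / 4] per
   term. *)
pose A (k : nat) (w : E) := exists2 v, Fdom S T v &
  nrm (T v + m *: v - k%:R%:C *: x) <= k%:R * (e / 4) /\
  S (T v + m *: v) - k%:R%:C *: S x = w.
have [||k [w [k0 [v Fv [vx vw]] hw]]] :=
  @banach_saks _ _ _ (fun k => S (err k)) M N0 A errM weak _ _ _ e4.
- exists 0; first exact: Fdom0.
  by rewrite !op0 !scaler0 !addr0 !scale0r subr0 nrm0 mul0r lexx op0 subr0.
- move=> k w n [v Fv [vx vw]] Nn; exists (v + z n); first exact: FdomD.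
  have [dS dT dTS dST] := Fz n; have [dS' dT' dTS' dST'] := Fv.
  have TE : T (v + z n) + m *: (v + z n) = (T v + m *: v) + (T (z n) + m *: z n).
    by rewrite opfunD//; lmod R; ring.
  have kE : k.+1%:R%:C = k%:R%:C + 1 :> C by rewrite -natr1 rmorphD.
  rewrite TE kE; split.
    have -> : T v + m *: v + (T (z n) + m *: z n) - (k%:R%:C + 1) *: x
       = (T v + m *: v - k%:R%:C *: x) + err n by rewrite /err; lmod R; ring.
    apply: le_trans (nrm_triangle _ _) _; rewrite -natr1 mulrDl mul1r lerD//.
    by have := hN0 _ Nn; rewrite subr0 => /ltW.
  rewrite opfunD; [|apply: domD => //; exact: domZ|apply: domD => //; exact: domZ].
  by rewrite Serr -vw; lmod R; ring.
have kR : 0 < k%:R :> R by rewrite ltr0n.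
exists (k%:R^-1%:C *: v); first exact: FdomZ.
have [dS dT dTS dST] := Fv.
have kx a : k%:R^-1%:C *: (k%:R%:C *: a) = a :> E.
  by rewrite scalerA -rmorphM/= mulVf ?scale1r// gt_eqF.
have -> : T (k%:R^-1%:C *: v) + m *: (k%:R^-1%:C *: v)
    = k%:R^-1%:C *: (T v + m *: v) by rewrite opfunZ//; lmod R; ring.
rewrite opfunZ; last by apply: domD => //; exact: domZ.
rewrite -[X in _ - X](kx x) -(kx (S x)) -!scalerBr vw !nrmZr ?invr_ge0 ?(ltW kR)//.
have hw' : k%:R^-1 * nrm w <= e / 4 by rewrite mulrC ler_pdivrMr.
have hx' : k%:R^-1 * nrm (T v + m *: v - k%:R%:C *: x) <= e / 4.
  by rewrite mulrC ler_pdivrMr// mulrC.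
lra.
Qed.

(** The anticommutator bound is symmetric, so [Fdom_closure] applies with [S] and [T] exchanged to
    the approximants of [shift_Fdom_dense]. *)
Lemma Fdom_resT (m : C) x : imaginary m -> 4 * c + 1 <= cabs m -> dom S x ->
  Fdom S T (op_inv (op_shift T m) x).
Proof.
move=> im mc dx; have c0 := c_ge0; have m1 : 0 < 4 * c + 1 by lra.
have [|u Fu hu] := @approx_seq _ E (Fdom S T) (fun u =>
    nrm (T u + m *: u - x) + nrm (S (T u + m *: u) - S x)).
  by move=> e e0; exact: shift_Fdom_dense.
have h1 : T (u k) + m *: u k @[k --> \oo] --> x.
  apply: cvg_harmonic_le => k; apply: le_lt_trans (hu k).
  by rewrite lerDl nrm_ge0.
have h2 : S (T (u k) + m *: u k) @[k --> \oo] --> S x.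
  apply: cvg_harmonic_le => k; apply: le_lt_trans (hu k).
  by rewrite lerDr nrm_ge0.
have anti_le' y : Fdom T S y ->
    nrm (anticomm T S y) <= c * (nrm y + nrm (T y) + nrm (S y)).
  by move=> /FdomC /anti_le; rewrite anticommC addrAC.
have [z Fz zx] := Fdom_closure symT closedT closedS c_ge0 anti_le' im mc
  (fun k => FdomC (Fu k)) h1 h2.
have dz : dom T z by case: Fz.
rewrite (res_unique symT ontoT im (imaginary_neq0 m1 mc) dz zx).
exact: FdomC.
Qed.

End Swap.

(** * Operator norm limits *)

Section OperatorNorm.
Context {R : realType} {B : cstarAlgType R} {E : hilbertModType B}.
Local Notation C := R[i].

Lemma op_norm_bounds (f : E -> E) (M : R) : 0 <= M ->
  (forall x, nrm (f x) <= M * nrm x) ->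
  (0%:E <= op_norm f)%E /\ (op_norm f <= M%:E)%E.
Proof.
move=> M0 fM; split.
  apply: (@le_trans _ _ (nrm (f 0))%:E); first by rewrite lee_fin nrm_ge0.
  by apply: ereal_sup_ubound; exists 0 => //=; rewrite normr0 ler01.
apply: ge_ereal_sup => _ [x /= x1 <-]; rewrite lee_fin.
apply: le_trans (fM x) _; rewrite ler_piMr//.
by rewrite -lecR -nrmE.
Qed.

Lemma norm_infty_cvg (D : set C) (f : C -> E) (y : E) :
  (forall e : R, 0 < e -> exists M : R, forall l, D l -> M < cabs l ->
    nrm (f l - y) < e) ->
  f l @[l --> norm_infty_in D] --> y.
Proof.
move=> h; apply/cvgrPdist_lt => e e0.
have eE : e = (complex.Re e)%:C by rewrite RRe_real// gtr0_real.
rewrite eE ltr0c in e0 *; have [M hM] := h _ e0.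
exists M => // l [Dl]; rewrite cabsE ltcR => Ml /=.
by rewrite nrmE ltcR nrmB hM.
Qed.

Lemma norm_infty_op_norm_cvg (D : set C) (f : C -> E -> E) (K : R) : 0 <= K ->
  (forall l x, D l -> cabs l * nrm (f l x) <= K * nrm x) ->
  op_norm (f l) @[l --> norm_infty_in D] --> 0%E.
Proof.
move=> K0 h.
have hb l : D l -> 0 < cabs l ->
    (0%:E <= op_norm (f l))%E /\ (op_norm (f l) <= (K / cabs l)%:E)%E.
  move=> Dl l0; apply: op_norm_bounds => [|x]; first by rewrite divr_ge0// ltW.
  by rewrite mulrAC ler_pdivlMr// mulrC h.
apply/fine_cvgP; split.
  exists 0 => // l [Dl]; rewrite cabsE ltcR => l0 /=.
  have [h1 h2] := hb l Dl l0; rewrite fin_numElt.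
  by rewrite (lt_le_trans _ h1) ?ltNyr// (le_lt_trans h2)// ltry.
apply/cvgrPdist_lt => e e0; exists (K / e) => // l [Dl]; rewrite cabsE ltcR => lM /=.
have l0 : 0 < cabs l by apply: le_lt_trans lM; rewrite divr_ge0// ltW.
have [h1 h2] := hb l Dl l0.
have fin : op_norm (f l) \is a fin_num.
  by rewrite fin_numElt (lt_le_trans _ h1) ?ltNyr// (le_lt_trans h2)// ltry.
rewrite sub0r normrN ger0_norm ?fine_ge0//.
rewrite -lte_fin fineK//; apply: le_lt_trans h2 _.
by rewrite lte_fin ltr_pdivrMr// mulrC -ltr_pdivrMr.
Qed.

End OperatorNorm.

(** * Constants extracted from weak anticommutation *)

Section WeaklyAnticommuting.
Context {R : realType} {B : cstarAlgType R} {E : hilbertModType B}.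
Local Notation C := R[i].
Variables S T : operator E.
Hypothesis wac : weakly_anticommuting S T.

Lemma wac_anti_cle : exists2 K : R, 0 < K & forall x, Fdom S T x ->
  ⟨anticomm S T x, anticomm S T x⟩ ≼ K%:C *: (⟨x, x⟩ + ⟨S x, S x⟩ + ⟨T x, T x⟩).
Proof.
have [C0 [C1 [C2 [h0 h1 h2 hW]]]] := wac_bound wac.
exists (C0 + C1 + C2) => [|x Fx]; first by rewrite !addr_gt0.
have := hW x Fx; rewrite /cle => p.
have q (k : R) (y : E) : 0 < k -> cpositive (k%:C *: ⟨y, y⟩).
  by move=> k0; apply: cpositiveZ; [exact: ltW|exact: inner_pos].
have := cpositiveD p (cpositiveD (q (C1 + C2) x (addr_gt0 h1 h2))
  (cpositiveD (q (C0 + C2) (S x) (addr_gt0 h0 h2))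
              (q (C0 + C1) (T x) (addr_gt0 h0 h1)))).
by congr cpositive; lmod R; ring.
Qed.

(** This extends condition (2) from the core to all of [dom T]: core elements approximate [y] in the
    graph norm of [T], the topology in which [Fdom_closure] gives closedness. *)
Lemma wac_Fdom_res (K : R) : 0 < K -> (forall x, Fdom S T x ->
  ⟨anticomm S T x, anticomm S T x⟩ ≼ K%:C *: (⟨x, x⟩ + ⟨S x, S x⟩ + ⟨T x, T x⟩)) ->
  exists2 l0 : R, 16 * K + 5 <= l0 & forall (l : C) y, imaginary l ->
    l0 <= cabs l -> dom T y -> Fdom S T (op_inv (op_shift S l) y).
Proof.
move=> K0 anti; have [A [[_ AT hA] [l1 [l1_gt0 AF]]]] := wac_core wac.
have saS := wac_selfadjointl wac; have saT := wac_selfadjointr wac.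
have symS := selfadjoint_symmetric saS.
have onS := regular_onto_shift saS (wac_regularl wac).
exists (l1 + 16 * K + 5) => [|l y il ll dy]; first lra.
have l_neq0 : l != 0 by apply: imaginary_neq0 ll; lra.
have [|u Au uy] := @approx_seq _ E A (fun a => nrm (a - y) + nrm (T a - T y)).
  move=> e e0; have e2 : 0 < (e / 2)%:C by rewrite ltr0c; lra.
  have [a Aa ya] := hA y dy _ e2; exists a => //.
  have da := AT _ Aa; have := graph_norm_ge ya; rewrite opfunB//.
  by rewrite nrmB [nrm (T y - _)]nrmB => -[]; lra.
have Fu k : Fdom S T (op_inv (op_shift S l) (u k)).
  apply: (AF l il) => //; last by exists (u k).
  by rewrite cabsE lecR; lra.
have ru k := (resP onS (u k) il l_neq0).2.
have [||||x Fx xy] := @Fdom_closure _ _ _ S T (K + 1) symS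
    (selfadjoint_closed saS) (selfadjoint_closed saT) _ (anticomm_bound K0 anti)
    l (fun k => op_inv (op_shift S l) (u k)) y (T y) il _ Fu; try lra.
- have -> : (fun k => S (op_inv (op_shift S l) (u k))
      + l *: op_inv (op_shift S l) (u k)) = u by apply/funext => k; exact: ru.
  apply: cvg_harmonic_le => k; apply: le_lt_trans (uy k).
  by rewrite lerDl nrm_ge0.
- have -> : (fun k => T (S (op_inv (op_shift S l) (u k))
      + l *: op_inv (op_shift S l) (u k))) = (fun k => T (u k)).
    by apply/funext => k; rewrite ru.
  apply: cvg_harmonic_le => k; apply: le_lt_trans (uy k).
  by rewrite lerDr nrm_ge0.
by rewrite (res_unique symS onS il l_neq0 _ xy)//; case: Fx.
Qed.

End WeaklyAnticommuting.

Theorem theorem2p6 (R : realType) (B : cstarAlgType R) (E : hilbertModType B)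
    (S T : operator E) (wac : weakly_anticommuting S T) :
  [/\ selfadjoint (op_add S T) /\ regular (op_add S T),
  exists C : R, 0 < C /\ forall x : E, (dom S `&` dom T) x ->
    C^-1%:C *: (⟨x, x⟩ + ⟨op_add S T x, op_add S T x⟩)
      ≼ ⟨x, x⟩ + ⟨S x, S x⟩ + ⟨T x, T x⟩ /\
    ⟨x, x⟩ + ⟨S x, S x⟩ + ⟨T x, T x⟩
      ≼ C%:C *: (⟨x, x⟩ + ⟨op_add S T x, op_add S T x⟩),
  exists l0 : R, 0 < l0 /\ forall l m : R[i],
    imaginary l -> imaginary m -> l0%:C <= `|l| -> l0%:C <= `|m| ->
    [/\ op_inv (op_shift T m) @` dom S = Fdom S T,
        op_inv (op_shift S l) @` dom T = Fdom S T,
        range (op_inv (op_shift T m) \o op_inv (op_shift S l)) = Fdom S T &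
        range (op_inv (op_shift S l) \o op_inv (op_shift T m)) = Fdom S T],
  exists l0 : R, 0 < l0 /\ forall m : R[i], imaginary m -> l0%:C <= `|m| ->
    [/\ forall l : R[i], imaginary l -> `|m| < `|l| -> 0 < m / l ->
          op_bijective (op_pencil S T l m) /\
          bounded_adjointable (op_inv (op_pencil S T l m)),
        forall x : E,
          op_shift (op_add S T) m (op_inv (op_pencil S T l m) x)
            @[l --> norm_infty_in (pencil_params m)] --> x &
        op_norm (fun x : E => op_inv (op_pencil S T l m) x
                              - op_inv (op_shift (op_add S T) m) x)
          @[l --> norm_infty_in (pencil_params m)] --> 0%E] &
  [/\ core (Fdom S T) S, core (Fdom S T) T & core (Fdom S T) (op_add S T)]].
Proof.
have saS := wac_selfadjointl wac; have saT := wac_selfadjointr wac.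
have symS := selfadjoint_symmetric saS; have symT := selfadjoint_symmetric saT.
have clS := selfadjoint_closed saS; have clT := selfadjoint_closed saT.
have onS := regular_onto_shift saS (wac_regularl wac).
have onT := regular_onto_shift saT (wac_regularr wac).
have [dS _] := saS; have [dT _] := saT.
have [K K0 anti] := wac_anti_cle wac.
have [l0 lK Fres] := wac_Fdom_res wac K0 anti.
have anti' := anticomm_bound K0 anti.
have l0_gt0 : 0 < l0 by lra.
have c0 : 0 <= K + 1 by lra.
have l0c : 4 * (K + 1) + 1 <= l0 by lra.
split.
- split; first exact: (selfadjoint_add symS symT clS clT dS dT onS onT K0 anti lK Fres).
  exact: (regular_add symS symT clS clT dS dT onS onT K0 anti lK Fres).
- exists (2 + K); split=> [|x [dSx dTx]]; first lra.
  split; first exact: (sum_upper _ _ K0).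
  exact: (sum_lower symS symT K0 anti
    (Fdom_approx_sum symS dS onS K0 anti lK Fres) dSx dTx).
- exists l0; split=> // l m il im; rewrite !cabsE !lecR => ll lm.
  have l_neq0 := imaginary_neq0 l0_gt0 ll; have m_neq0 := imaginary_neq0 l0_gt0 lm.
  have mc : 4 * (K + 1) + 1 <= cabs m by apply: le_trans lm.
  have FresT x : dom S x -> Fdom S T (op_inv (op_shift T m) x).
    exact: (Fdom_resT symS symT clS clT dS onS onT c0 anti' l0c Fres im mc).
  have surjT x : Fdom S T x ->
      dom S (T x + m *: x) /\ op_inv (op_shift T m) (T x + m *: x) = x.
    move=> [dSx dTx _ dSTx]; split; last exact: (resK symT onT).
    by apply: domD => //; exact: domZ.
  have surjS x : Fdom S T x ->
      dom T (S x + l *: x) /\ op_inv (op_shift S l) (S x + l *: x) = x.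
    move=> [dSx dTx dTSx _]; split; last exact: (resK symS onS).
    by apply: domD => //; exact: domZ.
  split; apply/seteqP; split=> [x [y]|x Fx].
  + by move=> dy <-; exact: FresT.
  + by have [h1 h2] := surjT x Fx; exists (T x + m *: x).
  + by move=> dy <-; exact: Fres.
  + by have [h1 h2] := surjS x Fx; exists (S x + l *: x).
  + by move=> _ <- /=; apply: FresT; case: (resP onS y il l_neq0).
  + have [h1 h2] := surjT x Fx; set y := T x + m *: x in h1 h2.
    by exists (S y + l *: y) => //=; rewrite (resK symS onS).
  + by move=> _ <- /=; apply: Fres => //; case: (resP onT y im m_neq0).
  + have [h1 h2] := surjS x Fx; set y := S x + l *: x in h1 h2.
    by exists (T y + m *: y) => //=; rewrite (resK symT onT).
- exists l0; split=> // m im; rewrite cabsE lecR => lm; split.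
  + move=> l il ml ml0.
    exact: (pencil_params_bijective symS symT onS onT K0 anti lK Fres lm).
  + move=> x; apply: norm_infty_cvg => e e0.
    exact: (cvg_pencil_inv_strong symS symT dT onS onT K0 anti lK Fres im lm x e0).
  + apply: (norm_infty_op_norm_cvg (K := 16 * (2 + K))) => [|l x pl].
      by rewrite mulr_ge0//; lra.
    exact: (pencil_inv_diff_bound symS symT clS clT dS dT onS onT K0 anti lK Fres).
- split.
  + exact: (core_FdomS symS onS c0 l0c Fres dT).
  + exact: (core_FdomT symS onS dS c0 anti' l0c Fres).
  + exact: (core_Fdom_add symS onS dS c0 anti' l0c Fres).
Qed.
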